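(* Let $k\geq 2$ be an integer and let $\omega=\omega(n)$ be any function with $\omega\to\infty$ as $n\to\infty$. For each $j\in\{1,\dots,k-1\}$, with high probability the following three statements hold simultaneously: (i) $\displaystyle \frac{(j+1)\log n+\log\log n-\omega}{(k-j+1)n^{k-j}}(k-j)! < p_{M_j} < \frac{(j+1)\log n+\log\log n+\omega}{(k-j+1)n^{k-j}}(k-j)!$; (ii) for all $p<p_{M_j}$, $\mathcal{G}_p$ is not $\mathbb{F}_2$-cohomologically $j$-connected, i.e. $H^0(\mathcal{G}_p;\mathbb{F}_2)\neq\mathbb{F}_2$ or $H^i(\mathcal{G}_p;\mathbb{F}_2)\neq 0$ for some $i\in\{1,\dots,j\}$; (iii) for all $p\geq p_{M_j}$, $\mathcal{G}_p$ is $\mathbb{F}_2$-cohomologically $j$-connected, i.e. $H^0(\mathcal{G}_p;\mathbb{F}_2)=\mathbb{F}_2$ and $H^i(\mathcal{G}_p;\mathbb{F}_2)=0$ for all $i\in\{1,\dots,j\}$.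
   Context: Random complex process: fix $k\ge 2$. To each $(k+1)$-subset of $[n]=\{1,\dots,n\}$ independently assign a birth time uniformly distributed in $[0,1]$. For $p\in[0,1]$, $\mathcal{G}_p=\mathcal{G}(k;n,p)$ is the simplicial complex on $[n]$ consisting of all singletons $\{v\}$, $v\in[n]$, together with all non-empty subsets of those $(k+1)$-sets whose birth time is at most $p$ (the downward closure of the binomial random $(k+1)$-uniform hypergraph). The $i$-simplices are its elements of size $i+1$. ''With high probability'' (whp) means with probability tending to $1$ as $n\to\infty$; $\log$ is the natural logarithm. Cohomology: for a complex $\mathcal{G}$, $C^i(\mathcal{G})$ is the $\mathbb{F}_2$-vector space of functions from $i$-simplices to $\mathbb{F}_2$; the coboundary $\delta^i:C^i\to C^{i+1}$ is $\delta^i f(\sigma)=\sum_{\tau\subset\sigma,|\tau|=i+1}f(\tau)$ mod 2, $\delta^{-1}:\{0\}\to C^0$ is the zero map, and $H^i(\mathcal{G};\mathbb{F}_2)=\ker\delta^i/\operatorname{im}\delta^{i-1}$. $\mathcal{G}$ is $\mathbb{F}_2$-cohomologically $j$-connected if $H^0(\mathcal{G};\mathbb{F}_2)\cong\mathbb{F}_2$ and $H^i(\mathcal{G};\mathbb{F}_2)=0$ for all $i\in\{1,\dots,j\}$. Flowers and $M_j$: for a $k$-simplex $K$ and a $j$-element subset $C\subseteq K$, the $j$-flower $\mathcal{F}(K,C)=\{C\cup\{w\}: w\in K\setminus C\}$; its elements are petals. A $j$-cycle is a set $J$ of $j$-simplices such that every $j$-element set is contained in an even number of members of $J$. A copy of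 $M_j$ in a $k$-complex $\mathcal{G}$ is a triple $(K,C,J)$ where $K$ is a $k$-simplex of $\mathcal{G}$, $C\subseteq K$ with $|C|=j$ such that every petal of $\mathcal{F}(K,C)$ is contained in no $k$-simplex of $\mathcal{G}$ other than $K$, and $J$ is a $j$-cycle in $\mathcal{G}$ with $|J\cap\mathcal{F}(K,C)|=1$. Define $p_{M_j}=\sup\{p\in[0,1]:\mathcal{G}_p\text{ contains a copy of }M_j\}$. *)

(* Defs.v *)
From HB Require Import structures.
From mathcomp Require Import all_boot all_order all_algebra all_fingroup.
From mathcomp Require Import all_classical all_reals all_analysis.

Set Implicit Arguments.
Unset Strict Implicit.
Unset Printing Implicit Defensive.

Import Order.TTheory GRing.Theory Num.Theory.
Import numFieldNormedType.Exports.

Local Open Scope ring_scope.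

(* The vertex set [n] is 'I_n, and a complex is the set of its simplices;
   an i-simplex has i+1 vertices. *)
Definition simplex n (G : {set {set 'I_n}}) (i : nat) : finType :=
  {s : {set 'I_n} | (s \in G) && (#|s| == i.+1)}.

Section Cohomology.
Variables (n : nat) (G : {set {set 'I_n}}).

Definition cochain (i : nat) : Type := {ffun simplex G i -> 'F_2}.

HB.instance Definition _ i := Finite.on (cochain i).
HB.instance Definition _ i := GRing.Zmodule.on (cochain i).
(* The group law on cochains is addition; for F_2-vector spaces, additive
   subgroups, quotient groups and group isomorphisms are the same as linear
   subspaces, quotient spaces and linear isomorphisms. *)
HB.instance Definition _ i := [finGroupMixin of cochain i for +%R].

Definition coboundary i (f : cochain i) : cochain i.+1 :=
  [ffun sigma : simplex G i.+1 =>
    \sum_(tau : simplex G i | val tau \subset val sigma) (f tau : 'F_2)].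

Lemma coboundaryD i : {morph @coboundary i : f g / (f * g)%g}.
Proof.
move=> f g; apply/ffunP => s; rewrite !ffunE -big_split /=.
by apply: eq_bigr => t _; rewrite !ffunE.
Qed.

Canonical coboundary_morphism i :=
  @Morphism _ _ [set: cochain i] (@coboundary i)
    (in2W (@coboundaryD i)).

Definition cocycles i : {group cochain i} := 'ker (@coboundary i).

(* In degree 0 this is the image of the zero map. *)
Definition coboundaries i : {group cochain i} :=
  match i with
  | 0 => 1%G
  | i'.+1 => (@coboundary i' @* [set: cochain i'])%G
  end.

Definition cohomology i := (cocycles i / coboundaries i)%g.

Definition cohomologically_connected (j : nat) : Prop :=
  cohomology 0 \isog [set: 'F_2] /\
  forall i, (1 <= i <= j)%N -> cohomology i = 1%g.

End Cohomology.

Section CopyOfM.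
Variable n : nat.
Implicit Types (G J : {set {set 'I_n}}) (K C : {set 'I_n}).

Definition flower K C : {set {set 'I_n}} := [set w |: C | w in K :\: C].

Definition is_cycle (j : nat) J : Prop :=
  (forall s, s \in J -> #|s| = j.+1) /\
  (forall s : {set 'I_n}, #|s| = j -> ~~ odd #|[set t in J | s \subset t]|).

Definition copy_of_M (k j : nat) G K C J : Prop :=
  [/\ K \in G /\ #|K| = k.+1,
      C \subset K /\ #|C| = j,
      forall petal K', petal \in flower K C ->
        K' \in G -> #|K'| = k.+1 -> petal \subset K' -> K' = K,
      J \subset G /\ is_cycle j J &
      #|J :&: flower K C| = 1%N].

End CopyOfM.

Notation hyperedge k n := {K : {set 'I_n} | #|K| == k.+1}.

Section Process.
Variables (R : realType) (k n : nat).
Implicit Type b : hyperedge k n -> R.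

Definition complex_at b (p : R) : {set {set 'I_n}} :=
  [set s : {set 'I_n} | (#|s| == 1%N) ||
    (s != finset.set0) && [exists K, (b K <= p) && (s \subset val K)]].

(* [sup] is 0 on the empty set, the supremum of the empty set in [0, 1]. *)
Definition p_M (j : nat) b : R :=
  sup [set p : R | 0 <= p <= 1 /\
    exists K C J, copy_of_M k j (complex_at b p) K C J]%classic.

End Process.

Section Probability.
Local Open Scope classical_set_scope.

Definition mutually_independent d (T : measurableType d) (R : realType)
    (P : probability T R) (I : finType) (X : I -> {RV P >-> R}) : Prop :=
  forall (S : {set I}) (A : I -> set R), (forall i, measurable (A i)) ->
    P (\bigcap_(i in [set` S]) X i @^-1` A i) =
    (\prod_(i in S) P (X i @^-1` A i))%E.

Definition iid_uniform01 d (T : measurableType d) (R : realType)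
    (P : probability T R) (I : finType) (X : I -> {RV P >-> R}) : Prop :=
  (forall i (A : set R), measurable A ->
    distribution P (X i) A = uniform_prob (@ltr01 R) A) /\
  mutually_independent X.

(* The inner-probability form of [P n (A n) --> 1]: the two agree when the
   [A n] are measurable, and nothing is said about non-measurable sets. *)
Definition whp (R : realType) (d : nat -> measure_display)
    (T : forall n, measurableType (d n)) (P : forall n, probability (T n) R)
    (A : forall n, set (T n)) : Prop :=
  exists E : forall n, set (T n),
    [/\ forall n, measurable (E n),
        forall n, E n `<=` A n &
        P n (E n) @[n --> \oo] --> 1%:E].

End Probability.

(* Main.v *)
(* Put r = k - j + 1 and let p- < p+ be ((j+1) log n + log log n -/+ w) (k-j)! / (r n^(k-j))
   with w = min(omega/2, log log n/4).

   Already at a small constant times p-, every (j+1)-set inside a (k+1)-set has an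
   apex v, such that the boundary of the set, coned off from v, is covered by
   hyperedges. This kills H^i for i < j and gives a j-cycle through exactly one
   petal of a flower, so that a hyperedge with an isolated flower is a copy of M_j.
   Some such hyperedge survives until p-, while one that exists after p- was born
   before p- and disappears before p+; this is (i). It also gives (ii) once there
   are apexes, since the set of petals is then a cocycle that pairs to 1 with the
   j-cycle. For smaller p either a given vertex is isolated, or, for some i, more
   than n^i hyperedges have an isolated i-flower, which gives more independent
   i-cocycles than there are (i-1)-cochains.

   For (iii), call a cocycle trivial if it is cohomologous to one supported on
   (j+1)-sets that lie in a single hyperedge. At p- every cocycle is trivial: the
   support S of a smallest counterexample is connected through hyperedges, hence is
   found by an exploration, and no hyperedge contains exactly one element of S; by
   the isoperimetric inequality of Meshulam and Wallach this is too unlikely. The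
   hyperedges born later preserve triviality unless they join two local pieces. If
   a trivial cocycle is no coboundary then it is nonzero inside a hyperedge on sets
   that lie in no other hyperedge. There are at least r such sets, with high
   probability exactly r, and then they form a flower: a copy of M_j, whereas no
   copy is left from p_M on. *)

(* The statements concern all [p] at once, whereas probabilities are estimated at finitely many
   fixed times. The bridge is monotonicity: a set that lies in no other hyperedge at some time lies
   in none earlier. A time [pB] beyond p+ is needed because a union bound over all (k+1)-sets fails
   at p+ unless it carries a birth probability; between p- and p+ it is the short window that
   compensates.

   Hyperedges with an isolated flower do exist at p-, so the cohomology cannot be shown to vanish
   there, and triviality has to be taken modulo cocycles inside single hyperedges. A support that is
   not of this kind has more than r elements, and this one extra element gains a power of n, which
   beats any bounded power of log n. Supports can be as large as n^(j+1), too large to be enumerated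
   as sets. An exploration costs only a bounded power of log n per element, while each element
   forbids of the order of n^(k-j) hyperedges and so gains a power of n. *)
From HB Require Import structures.
From mathcomp Require Import all_boot all_order all_algebra all_fingroup.
From mathcomp Require Import cyclic zify.

Set Implicit Arguments.
Unset Strict Implicit.
Unset Printing Implicit Defensive.

Import Order.TTheory GRing.Theory Num.Theory.

(** * Cochains on all finite sets, supports of cocycles, triviality up to local pieces *)

Section Cochains.
Local Open Scope ring_scope.
Variable T : finType.
Implicit Types (f g h : {ffun {set T} -> 'F_2}) (s t K : {set T}).
Implicit Types (H S F : {set {set T}}) (v : T).

Lemma addrr_F2 (a : 'F_2) : a + a = 0.
Proof. by apply/val_inj; case: a => [[|[|]]]. Qed.

Lemma neq0_F2 (a : 'F_2) : a != 0 -> a = 1.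
Proof. by case: a => [[|[|]]] // i _; apply/val_inj. Qed.

(** Cochains of all degrees of the full simplex on [T] share one type, the empty set included. A
    complex enters only through the sets on which [cobd f] has to vanish. *)
Definition cobd f : {ffun {set T} -> 'F_2} :=
  [ffun s : {set T} => \sum_(x in s) f (s :\ x)].

Definition cone v f : {ffun {set T} -> 'F_2} :=
  [ffun s : {set T} => if v \in s then 0 else f (v |: s)].

(** The degree counts vertices: a j-cochain has degree [j.+1]. *)
Definition degree m f := [forall s : {set T}, (#|s| != m) ==> (f s == 0)].

Lemma degreeP m f : reflect (forall s, f s != 0 -> #|s| = m) (degree m f).
Proof.
apply: (iffP forallP) => [Hf s fs|Hf s]; last first.
  by apply/implyP; apply: contraNT => /Hf ->.
by apply/eqP; apply: contraNT fs => sm; apply: (implyP (Hf s)).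
Qed.

Lemma cobdD f g : cobd (f + g) = cobd f + cobd g.
Proof.
by apply/ffunP => s; rewrite !ffunE -big_split; apply: eq_bigr => x _; rewrite ffunE.
Qed.

Lemma cobdK f : cobd (cobd f) = 0.
Proof.
apply/ffunP => s; rewrite !ffunE.
under eq_bigr => x xs do rewrite ffunE.
rewrite pair_big_dep /=.
(* An order on [T] splits the ordered pairs into two halves; swapping the pair matches their terms,
   which cancel in characteristic 2. *)
rewrite (bigID (fun p : T * T => enum_rank p.1 < enum_rank p.2)%N) /=.
rewrite [X in _ + X](reindex_inj (h := fun p : T * T => (p.2, p.1))) /=; last first.
  by move=> [a b] [c d] [-> ->].
rewrite -[RHS](addrr_F2 (\sum_(i : T * T | (i.1 \in s) && (i.2 \in s :\ i.1) &&
  (enum_rank i.1 < enum_rank i.2)%N) f (s :\ i.1 :\ i.2))).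
congr (_ + _); apply: eq_big => [[x y]|[x y] _] /=; last first.
  by congr (f _); apply/setP => z; rewrite !inE andbCA.
rewrite !inE -leqNgt; case: (x =P y) => [->|/eqP xy].
  by rewrite eqxx ltnn /= !andbF.
rewrite eq_sym xy /= [(y \in s) && _]andbC; congr (_ && _).
rewrite leq_eqVlt orb_idl // => /eqP/val_inj/enum_rank_inj E.
by rewrite E eqxx in xy.
Qed.

Lemma degree_cobd m f : degree m f -> degree m.+1 (cobd f).
Proof.
move=> /degreeP Hf; apply/degreeP => s; apply: contra_neq_eq => sm.
rewrite ffunE big1 // => x xs; apply/eqP; apply: contra_neqT sm => /Hf <-.
by rewrite (cardsD1 x s) xs.
Qed.

Lemma degreeD m f g : degree m f -> degree m g -> degree m (f + g).
Proof.
move=> /forallP Hf /forallP Hg; apply/forallP => s; apply/implyP => sm.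
by rewrite ffunE (eqP (implyP (Hf s) sm)) (eqP (implyP (Hg s) sm)) addr0.
Qed.

Lemma degree_cone m v f : degree m.+1 f -> degree m (cone v f).
Proof.
move=> /degreeP Hf; apply/degreeP => s; rewrite ffunE; case: ifP => vs.
  by rewrite eqxx.
by move=> /Hf; rewrite cardsU1 vs => -[].
Qed.

Lemma cobdU1 f v t : v \notin t ->
  cobd f (v |: t) = f t + \sum_(x in t) f ((v |: t) :\ x).
Proof. by move=> vt; rewrite ffunE big_setU1 //= setU1K. Qed.

Lemma cobd_cone_in f v s : v \in s -> cobd (cone v f) s = f s.
Proof.
move=> vs; rewrite ffunE (bigD1 v) //= ffunE setD11 setD1K //.
rewrite big1 ?addr0 // => x /andP[xs xv].
by rewrite ffunE !inE eq_sym xv vs.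
Qed.

(* In characteristic 2, [cone v] is a contracting homotopy. *)
Lemma cobd_cone_notin f v s : v \notin s ->
  cobd (cone v f) s + f s = cobd f (v |: s).
Proof.
move=> vs; rewrite cobdU1 // addrC; congr (_ + _); rewrite ffunE.
apply: eq_bigr => x xs; rewrite ffunE !inE (negPf vs) andbF; congr (f _).
apply/setP => z; rewrite !inE; case: (z =P v) => [->|//].
by rewrite eq_sym (memPn vs).
Qed.

Definition closed_on K f := [forall s : {set T}, (s \subset K) ==> (cobd f s == 0)].

Lemma closed_onP K f :
  reflect (forall s, s \subset K -> cobd f s = 0) (closed_on K f).
Proof.
apply: (iffP forallP) => Hf s; first by move=> /(implyP (Hf s))/eqP.
by apply/implyP => /Hf ->.
Qed.

(** In the cocycle condition at [v |: t] the nonzero term at [t] must be cancelled by another face,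
    which then contains [v]. *)
Lemma closed_exchange K f t v : closed_on K f -> t \subset K -> f t != 0 ->
  v \in K -> v \notin t -> exists2 u, u \in t & f ((v |: t) :\ u) != 0.
Proof.
move=> /closed_onP Hf tK ft vK vt; apply/exists_inP; apply: contraT.
rewrite negb_exists_in => /forall_inP Hu.
have := Hf (v |: t); rewrite subUset sub1set vK tK cobdU1 // => /(_ isT).
rewrite big1 ?addr0 => [f0|x xt]; first by rewrite f0 eqxx in ft.
by apply/eqP; have := Hu x xt; rewrite negbK.
Qed.

Definition supp_in K f := [set s : {set T} | (s \subset K) && (f s != 0)].

(** Removing [t] from a support set reveals the exchanged vertex. The count is kept as an inclusion
    because its case of equality later identifies the least cocycles. *)
Lemma supp_in_imset K f t : closed_on K f -> t \subset K -> f t != 0 ->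
  set0 |: [set [set v] | v in K :\: t] \subset
    [set s :\: t | s in supp_in K f].
Proof.
move=> cf tK ft; apply/subsetP => s /setU1P[->|/imsetP[v]].
  by apply/imsetP; exists t; rewrite ?setDv // inE tK.
rewrite inE => /andP[vt vK] ->.
have [u ut fu] := closed_exchange cf tK ft vK vt.
apply/imsetP; exists ((v |: t) :\ u).
  rewrite inE fu andbT; apply: subset_trans (subsetDl _ _) _.
  by rewrite subUset sub1set vK.
have vu : v != u by apply: contraNneq vt => ->.
apply/setP => z; rewrite !inE; case: (z =P v) => [->|_] /=; first by rewrite vt vu.
by case: (z \in t) => //; rewrite andbF.
Qed.

Lemma card_setU1_set1 (A : {set T}) :
  #|set0 |: [set [set v] | v in A]| = #|A|.+1.
Proof.
rewrite cardsU1 card_imset; last exact: set1_inj.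
rewrite (_ : set0 \in _ = false) //; apply/negbTE/imsetP => -[v _ /setP/(_ v)].
by rewrite !inE eqxx.
Qed.

(** Exchanges for different [v] in [K :\: t] give different support sets, and [t] is one more. For a
    hyperedge and a (j+1)-set the bound is k - j + 1, the number of petals of a flower. *)
Lemma card_supp_in K f t : closed_on K f -> t \subset K -> f t != 0 ->
  (#|K| - #|t| < #|supp_in K f|)%N.
Proof.
move=> cf tK ft; rewrite -{1}(setIidPr tK) -cardsD -card_setU1_set1.
apply: leq_trans (leq_imset_card (fun s => s :\: t) _).
exact/subset_leq_card/supp_in_imset.
Qed.

(** Exchanging a vertex of [t] for a vertex of [K] outside [K'] moves the support out of [K']. *)
Lemma closed_escape K K' f t : closed_on K f -> t \subset K -> t \subset K' ->
  f t != 0 -> ~~ (K \subset K') ->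
  exists2 t' : {set T}, t' \subset K & f t' != 0 /\ ~~ (t' \subset K').
Proof.
move=> cf tK tK' ft /subsetPn[v vK vK'].
have vt : v \notin t by apply: contra vK' => /(subsetP tK').
have [u ut fu] := closed_exchange cf tK ft vK vt.
have uv : v != u by apply: contraNneq vt => ->.
exists ((v |: t) :\ u).
  by apply: subset_trans (subsetDl _ _) _; rewrite subUset sub1set vK.
by split => //; apply/subsetPn; exists v; rewrite // !inE eqxx uv.
Qed.

Definition compat H f := [forall (K | K \in H), closed_on K f].

Definition cover_of H s := [set K in H | s \subset K].

(** Sets in no hyperedge count as light too, so the values of a cochain outside the complex never
    matter. *)
Definition light H s := (#|cover_of H s| <= 1)%N.

(** Triviality in the sense of the overview, as a Boolean so that a smallest counterexample can be
    selected. *)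
Definition almost_trivial m H f :=
  [exists h, degree m h && [forall s, ((f + cobd h) s != 0) ==> light H s]].

Lemma almost_trivialP m H f : reflect
  (exists2 h, degree m h & forall s, (f + cobd h) s != 0 -> light H s)
  (almost_trivial m H f).
Proof.
apply: (iffP existsP) => -[h].
  by move=> /andP[dh /forallP fh]; exists h => // s; apply/implyP.
by move=> dh fh; exists h; rewrite dh; apply/forallP => s; apply/implyP/fh.
Qed.

Lemma compatP H f : reflect (forall K, K \in H -> closed_on K f) (compat H f).
Proof. exact: forall_inP. Qed.

Lemma closed_onD K f g : closed_on K f -> closed_on K g -> closed_on K (f + g).
Proof.
move=> /closed_onP Hf /closed_onP Hg; apply/closed_onP => s sK.
by rewrite cobdD ffunE Hf ?Hg // addr0.
Qed.

Lemma closed_on_cobd K h : closed_on K (cobd h).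
Proof. by apply/closed_onP => s _; rewrite cobdK ffunE. Qed.

Lemma compatD H f g : compat H f -> compat H g -> compat H (f + g).
Proof.
by move=> /compatP Hf /compatP Hg; apply/compatP => K KH; rewrite closed_onD ?Hf ?Hg.
Qed.

Lemma compat_cobd H h : compat H (cobd h).
Proof. by apply/compatP => K _; apply: closed_on_cobd. Qed.

Definition uniform m (H : {set {set T}}) := forall K, K \in H -> #|K| = m.

Definition isolated_in H K S :=
  forall s, s \in S -> s \subset K /\ cover_of H s = [set K].

(* The configuration by which the arrival of [K] can merge a local piece of
   cohomology with something else. *)
Definition merging k j H K :=
  exists K0 S t t',
  [/\ K0 \in H, (forall s, s \in S -> #|s| = j.+1), (k - j < #|S|)%N &
    isolated_in H K0 S] /\
  [/\ t \in S /\ t \subset K, #|t'| = j.+1, t' \subset K, ~~ (t' \subset K0) &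
    light H t'].

(** The old [h] is kept. If [g = f + cobd h] is nonzero on a set [s] that ceases to be light, then
    [s] lies in [K] and in exactly one older [K0]. The support of [g] inside [K0] is isolated there
    and escapes from [K0] within [K], which is a merging. *)
Lemma almost_trivial_add k j H K f :
  uniform k.+1 (K |: H) -> K \notin H -> (j <= k)%N -> degree j.+1 f ->
  compat (K |: H) f -> ~ merging k j H K -> almost_trivial j H f ->
  almost_trivial j (K |: H) f.
Proof.
move=> uH KH jk df cf nm /almost_trivialP[h dh fh]; apply/almost_trivialP.
exists h => // s gs; set g := f + cobd h in gs fh.
have dg : degree j.+1 g by rewrite degreeD // degree_cobd.
have cg : compat (K |: H) g by rewrite compatD // compat_cobd.
have ls := fh s gs; apply: contraT => nls.
have sK : s \subset K.
  apply: contraNT nls => sK; rewrite /light.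
  rewrite (_ : cover_of _ _ = cover_of H s) //; apply/setP => K'; rewrite !inE.
  by have [->|_] := eqVneq K' K; rewrite ?(negPf sK) ?andbF.
have [K0 cK0] : exists K0, cover_of H s = [set K0].
  apply/cards1P; rewrite eqn_leq [(_ <= 1)%N]ls lt0n; apply: contraNN nls => c0.
  rewrite /light -(cards1 K).
  apply/subset_leq_card/subsetP => K'; rewrite !inE.
  rewrite cards_eq0 in c0; move=> /andP[/orP[//|K'H sK']].
  by have /setP/(_ K') := eqP c0; rewrite !inE K'H sK'.
have [K0H sK0] : K0 \in H /\ s \subset K0.
  by have /setP/(_ K0) := cK0; rewrite !inE eqxx => /andP.
have cKg : closed_on K g by have /compatP := cg; apply; rewrite setU11.
have cK0g : closed_on K0 g by have /compatP := cg; apply; rewrite setU1r.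
have KK0 : ~~ (K \subset K0).
  apply: contra KH => KK0; rewrite (_ : K = K0) //; apply/eqP.
  by rewrite eqEcard KK0 !uH ?setU11 ?setU1r ?leqnn.
have [t' t'K [gt' t'K0]] := closed_escape cKg sK sK0 gs KK0.
case: nm; exists K0, (supp_in K0 g), s, t'.
have sz x : g x != 0 -> #|x| = j.+1 by move/degreeP: dg => /(_ x).
split; split => //.
- by move=> x; rewrite inE => /andP[_ /sz].
- have := card_supp_in cK0g sK0 gs; rewrite uH ?setU1r // sz //.
- move=> x; rewrite inE => /andP[xK0 gx]; split => //.
  apply/eqP; rewrite eq_sym eqEcard sub1set inE K0H xK0 cards1 /=.
  exact: fh.
- by rewrite inE sK0 gs.
- exact: sz.
- exact: fh.
Qed.

Definition ind S : {ffun {set T} -> 'F_2} := [ffun s => (s \in S)%:R].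

Lemma ind_neq0 S s : (ind S s != 0) = (s \in S).
Proof. by rewrite ffunE; case: (s \in S). Qed.

Definition supp f := [set s | f s != 0].

Lemma ind_supp f : ind (supp f) = f.
Proof.
apply/ffunP => s; rewrite ffunE inE; have [->//|/neq0_F2 ->//] := eqVneq (f s) 0.
Qed.

(** Connectedness of [S] when two elements are joined whenever some hyperedge contains both. *)
Definition linked H S := forall F, F \subset S -> F != set0 ->
  (forall K s t, K \in H -> s \in F -> t \in S -> s \subset K -> t \subset K ->
    t \in F) -> F = S.

(** Inside [K] the set [F] either agrees with [S] or is empty, so a union of components of a cocycle
    is again closed on [K]. *)
Lemma closed_on_ind K S F : closed_on K (ind S) -> F \subset S ->
  (forall s t, s \in F -> t \in S -> s \subset K -> t \subset K -> t \in F) ->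
  closed_on K (ind F).
Proof.
move=> /closed_onP cS FS lF; apply/closed_onP => s sK.
have sub x : s :\ x \subset K by apply: subset_trans (subsetDl _ _) sK.
have [/exists_inP[y ys yF]|noF] := boolP [exists (x | x \in s), s :\ x \in F].
  rewrite -(cS s sK) !ffunE; apply: eq_bigr => x xs; rewrite !ffunE.
  congr (_%:R); congr nat_of_bool; apply/idP/idP; first exact: (subsetP FS).
  by move=> xS; apply: (lF _ _ yF).
rewrite ffunE big1 // => x xs; rewrite ffunE.
by case xF: (_ \in F) => //; case/negP: noF; apply/exists_inP; exists x.
Qed.

Lemma almost_trivialD m H f g : almost_trivial m H f -> almost_trivial m H g ->
  almost_trivial m H (f + g).
Proof.
move=> /almost_trivialP[h1 d1 f1] /almost_trivialP[h2 d2 f2].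
apply/almost_trivialP; exists (h1 + h2); first exact: degreeD.
move=> s; rewrite cobdD addrACA ffunE => ns.
have [E|/f1//] := eqVneq ((f + cobd h1) s) 0.
by apply: f2; move: ns; rewrite E add0r.
Qed.

(** [f + cobd (cone v f)] vanishes on the sets containing [v], and its value at any other [s] is
    [cobd f (v |: s)]; adding or removing [v] is the bijection. *)
Lemma sum_cone_supp f v j : degree j.+1 f ->
  #|supp (f + cobd (cone v f))| = #|[set s in supp (cobd f) | v \in s]|.
Proof.
move=> df; rewrite -(card_imset (mem [set s in supp (cobd f) | v \in s])
  (f := fun s => if v \in s then s :\ v else v |: s)); last first.
  move=> s t; case: ifP => vs; case: ifP => vt E.
  - by rewrite -(setD1K vs) E setD1K.
  - by have := setU11 v t; rewrite -E setD11.
  - by have := setU11 v s; rewrite E setD11.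
  - by rewrite -[s](setU1K (negbT vs)) E setU1K // vt.
apply: eq_card => s; apply/idP/imsetP.
  rewrite inE ffunE; case: (boolP (v \in s)) => vs.
    by rewrite cobd_cone_in // addrr_F2 eqxx.
  rewrite addrC cobd_cone_notin // => ns; exists (v |: s).
    by rewrite !inE eqxx ns.
  by rewrite setU11 setU1K.
move=> [t]; rewrite !inE => /andP[nt vt] ->; rewrite vt.
rewrite ffunE addrC cobd_cone_notin ?setD11 // setD1K //.
Qed.

(* Meshulam and Wallach: a cochain of least weight modulo coboundaries has a
   large coboundary. *)
Lemma minimal_isoperimetry f j : degree j.+1 f ->
  (forall v, #|supp f| <= #|supp (f + cobd (cone v f))%R|)%N ->
  (#|T| * #|supp f| <= j.+2 * #|supp (cobd f)|)%N.
Proof.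
move=> df minf.
apply: (@leq_trans (\sum_(v : T) #|supp (f + cobd (cone v f))%R|)%N).
  by rewrite -sum_nat_const; apply: leq_sum => v _; apply: minf.
under eq_bigr => v _ do rewrite (sum_cone_supp v df).
under eq_bigr => v _ do rewrite -sum1dep_card big_mkcondr.
rewrite exchange_big /= mulnC -sum_nat_const; apply: leq_sum => s sS.
rewrite -big_mkcond sum1dep_card cardsE.
by move: sS; rewrite inE => /(degreeP _ _ (degree_cobd df)) ->.
Qed.

(** [S] is the support of a non-trivial [g] of least weight. It is linked, since otherwise [g] would
    be a sum of two lighter, hence trivial, pieces. Its coboundary is large, since
    [g + cobd (cone v g)] is again non-trivial and so not lighter. *)
Lemma minimal_nontrivial k j H f :
  uniform k.+1 H -> (j < k)%N -> degree j.+1 f -> compat H f ->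
  ~~ almost_trivial j H f ->
  exists S, [/\ (forall s, s \in S -> #|s| = j.+1), compat H (ind S), linked H S,
    (k - j + 1 < #|S|)%N & (#|T| * #|S| <= j.+2 * #|supp (cobd (ind S))|)%N].
Proof.
move=> uH jk df cf ntf.
pose P g := [&& degree j.+1 g, compat H g & ~~ almost_trivial j H g].
have Pf : P f by apply/and3P.
have [g /and3P[dg cg ntg] ming] := arg_minnP (fun g => #|supp g|) Pf.
have sz x : g x != 0 -> #|x| = j.+1 by move/degreeP: dg => /(_ x).
have at0 : almost_trivial j H 0.
  apply/almost_trivialP; exists 0; first by apply/degreeP => s; rewrite ffunE eqxx.
  move=> s; rewrite add0r ffunE big1 ?eqxx // => x _; by rewrite ffunE.
exists (supp g); rewrite ind_supp; split => //.
- by move=> s; rewrite inE => /sz.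
- move=> F FS F0 lF; apply/eqP; rewrite eqEsubset FS /=; apply: contraNT ntg => SF.
  have cI F' : F' \subset supp g ->
      (forall K s t, K \in H -> s \in F' -> t \in supp g -> s \subset K ->
         t \subset K -> t \in F') -> compat H (ind F').
    move=> sF' lF'; apply/compatP => K KH; apply: (closed_on_ind (S := supp g)) => //.
      by rewrite ind_supp; move/compatP: cg; apply.
    by move=> s t; apply: lF'.
  have dI F' : F' \subset supp g -> degree j.+1 (ind F').
    by move=> sF'; apply/degreeP => s; rewrite ind_neq0 => /(subsetP sF'); rewrite inE => /sz.
  have small F' : F' \proper supp g -> compat H (ind F') -> almost_trivial j H (ind F').
    move=> pF' cF'; apply: contraT => nt; have := proper_card pF'; rewrite ltnNge.
    have sI : supp (ind F') = F' by apply/setP => s; rewrite inE ind_neq0.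
    by rewrite -{1}sI ming // /P dI ?proper_sub // cF' nt.
  have -> : g = ind F + ind (supp g :\: F).
    rewrite -[LHS]ind_supp; apply/ffunP => s; rewrite [RHS]ffunE 3!ffunE.
    rewrite in_setD; case sF: (s \in F) => /=; last by rewrite add0r.
    by rewrite (subsetP FS _ sF) addr0.
  apply: almost_trivialD; apply: small.
  + by rewrite properE FS.
  + exact: cI.
  + rewrite properE subsetDl /=; apply: contra F0 => sub; apply/eqP/setP => s.
    rewrite in_set0; apply: contraTF (sub) => sF; apply/subsetPn; exists s.
      exact: (subsetP FS).
    by rewrite in_setD sF.
  + apply: cI; first exact: subsetDl.
    move=> K s t KH /setDP[sS sF] tS sK tK; rewrite in_setD tS andbT.
    by apply: contra sF => tF; apply: (lF K t s).
(* The zero cochain does not witness triviality of [g], so some support set lies in two hyperedges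
   [K1] and [K2]. Inside [K2] there are already k - j + 1 support sets, and an escape within [K1]
   gives one more outside [K2]. *)
- have /existsP[s /andP[gs ns]] : [exists s, (g s != 0) && ~~ light H s].
    apply: contraNT ntg; rewrite negb_exists => /forallP al; apply/almost_trivialP.
    exists 0; first by apply/degreeP => s; rewrite ffunE eqxx.
    move=> s; rewrite (_ : cobd 0 = 0); last first.
      by apply/ffunP => x; rewrite !ffunE big1 // => y _; rewrite ffunE.
    by rewrite addr0 => gs; have := al s; rewrite gs negbK.
  move: ns; rewrite /light -ltnNge => /card_gt1P[K1 [K2 []]].
  rewrite !inE => /andP[K1H sK1] /andP[K2H sK2] K12.
  have cK K : K \in H -> closed_on K g by move/compatP: cg; apply.
  have nK12 : ~~ (K1 \subset K2).
    by apply: contra K12 => K12; rewrite eqEcard K12 !uH ?leqnn.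
  have [t tK1 [gt tK2]] := closed_escape (cK _ K1H) sK1 sK2 gs nK12.
  have := card_supp_in (cK _ K2H) sK2 gs; rewrite uH // sz // subSS => lt1.
  apply: (leq_ltn_trans (n := #|supp_in K2 g|)); first by rewrite addn1.
  apply: proper_card; rewrite properE; apply/andP; split.
    by apply/subsetP => x; rewrite !inE => /andP[].
  by apply/subsetPn; exists t; rewrite !inE // (negPf tK2).
- apply: minimal_isoperimetry => // v; apply: ming; apply/and3P; split.
  + by rewrite degreeD // degree_cobd // degree_cone.
  + by rewrite compatD // compat_cobd.
  + apply: contra ntg => at1; rewrite (_ : g = (g + cobd (cone v g)) + cobd (cone v g)).
      apply: almost_trivialD => //; apply/almost_trivialP; exists (cone v g).
        exact: degree_cone.
      by move=> s; rewrite ffunE addrr_F2 eqxx.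
    by apply/ffunP => s; rewrite !ffunE -addrA addrr_F2 addr0.
Qed.

End Cochains.

(** * Counting faces and supersets *)

Section Faces.
Local Open Scope ring_scope.
Variable T : finType.
Implicit Types (f g h : {ffun {set T} -> 'F_2}) (s t K C : {set T}).
Implicit Types (H S F J : {set {set T}}) (v : T).

Lemma faces_setD1 m s : #|s| = m.+1 ->
  [set s :\ x | x in s] = [set t : {set T} | (t \subset s) && (#|t| == m)].
Proof.
move=> sm; apply/setP => t; rewrite inE; apply/imsetP/andP.
  by move=> [x xs ->]; rewrite subsetDl; have := cardsD1 x s; rewrite xs sm => -[->].
move=> [ts /eqP tm]; have : #|s :\: t| == 1%N by rewrite cardsD (setIidPr ts) sm tm subSnn.
move=> /cards1P[x /setP E]; exists x; first by have := E x; rewrite !inE eqxx => /andP[].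
apply/setP => y; have := E y; rewrite !inE => <-.
by case yt: (y \in t); rewrite //= ?(subsetP ts _ yt) // andNb.
Qed.

Lemma setD1_inj s : {in s &, injective (fun x => s :\ x)}.
Proof.
by move=> x y xs ys /setP/(_ x); rewrite !inE eqxx xs andbT; case: eqVneq.
Qed.

Lemma cobd_faces m f s : #|s| = m.+1 ->
  cobd f s = \sum_(t : {set T} | (t \subset s) && (#|t| == m)) f t.
Proof.
move=> sm; rewrite ffunE.
rewrite -(big_imset f (@setD1_inj s)) (faces_setD1 sm).
by apply: eq_bigl => t; rewrite inE.
Qed.

Lemma exists_superset m s : (#|s| <= m <= #|T|)%N ->
  exists2 t : {set T}, s \subset t & #|t| = m.
Proof.
move=> /andP[sm]; rewrite -(subnK sm); elim: (m - #|s|)%N => [|d IH] dm.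
  by exists s.
have [|t st td] := IH; first exact: ltnW.
have /set0Pn[x] : ~: t != set0 by rewrite -card_gt0 cardsCs setCK subn_gt0 td.
rewrite inE => xt; exists (x |: t); first exact: subset_trans st (subsetUr _ _).
by rewrite cardsU1 xt td addSn.
Qed.

Lemma card_supersets m t : (#|t| <= m)%N ->
  #|[set K : {set T} | (t \subset K) && (#|K| == m)]| = 'C(#|T| - #|t|, m - #|t|).
Proof.
move=> tm; rewrite -[X in 'C(X, _)](_ : #|~: t| = _)%N; last by rewrite cardsCs setCK.
rewrite -cards_draws -(card_in_imset (f := fun K => K :\: t)).
  apply: eq_card => B; rewrite [RHS]inE; apply/imsetP/andP.
    move=> [K]; rewrite inE => /andP[tK /eqP Km] ->.
    by rewrite subsetDr cardsD (setIidPr tK) Km.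
  move=> [Bt /eqP Bm]; have dBt : B :&: t = set0.
    by apply/eqP; rewrite setI_eq0 disjoints_subset.
  exists (B :|: t); last first.
    by rewrite setDUl setDv setU0; apply/esym/setDidPl; rewrite disjoints_subset.
  by rewrite inE subsetUr cardsU dBt cards0 subn0 Bm subnK ?eqxx.
move=> K K'; rewrite !inE => /andP[tK _] /andP[tK' _] E.
by rewrite -[LHS](setID K t) -[RHS](setID K' t) E (setIidPr tK) (setIidPr tK').
Qed.

Lemma bin_le_expn n m : ('C(n, m) <= n ^ m)%N.
Proof.
elim: m => [|m IH]; first by rewrite bin0.
apply: (@leq_trans (m.+1 * 'C(n, m.+1))%N); first by rewrite leq_pmull.
by rewrite mul_bin_left expnS leq_mul // leq_subr.
Qed.

Lemma card_supersets_le m t : (#|t| <= m)%N ->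
  (#|[set K : {set T} | (t \subset K) && (#|K| == m)]| <= #|T| ^ (m - #|t|))%N.
Proof.
move=> tm; rewrite card_supersets //; apply: leq_trans (bin_le_expn _ _) _.
by case: (m - #|t|)%N => // d; rewrite leq_exp2r // leq_subr.
Qed.

Lemma leq_bigcup_card (I : finType) (P : pred I) (A : finType) (B : I -> {set A}) :
  (#|\bigcup_(i | P i) B i| <= \sum_(i | P i) #|B i|)%N.
Proof.
elim/big_rec2: _ => [|i y x _ IH]; first by rewrite cards0.
by rewrite cardsU (leq_trans (leq_subr _ _)) // leq_add2l.
Qed.

(** Two distinct (j+1)-sets have at least j + 2 elements between them, which costs one power of
    [#|T|] compared with a single set. *)
Lemma card_supersets_pair k j s s' : (j < k)%N -> #|s| = j.+1 -> #|s'| = j.+1 ->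
  s != s' ->
  (#|[set K : {set T} | (s :|: s' \subset K) && (#|K| == k.+1)]| <=
   #|T| ^ (k - j - 1))%N.
Proof.
move=> jk sj s'j ns.
have lt : (j.+1 < #|s :|: s'|)%N.
  rewrite -sj proper_card // properE subsetUl /=; apply: contra ns => sub.
  by rewrite eq_sym eqEcard sj s'j leqnn (subset_trans (subsetUr _ _) sub).
have [le|gt] := leqP #|s :|: s'| k.+1.
  apply: leq_trans (card_supersets_le le) _.
  have [T0|Tp] := posnP #|T|.
    by have := max_card (s :|: s'); rewrite T0 leqNgt (leq_ltn_trans _ lt).
  by rewrite leq_pexp2l //; rewrite -subnDA leq_subLR addn1; lia.
rewrite (_ : [set K | _] = set0) ?cards0 //; apply/setP => K; rewrite !inE.
apply/negP => /andP[/subset_leq_card le /eqP KE]; move: gt.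
by rewrite -KE ltnNge le.
Qed.

(* Inclusion-exclusion, truncated after the pairs. *)
Lemma card_exactly_one k j S : (j < k)%N -> (forall s, s \in S -> #|s| = j.+1) ->
  (#|S| * 'C(#|T| - j.+1, k - j) <=
   #|[set K : {set T} | (#|K| == k.+1) && (#|[set s in S | s \subset K]| == 1)]| +
   #|S| * #|S| * #|T| ^ (k - j - 1))%N.
Proof.
move=> jk uS.
pose up t : {set {set T}} := [set K : {set T} | (t \subset K) && (#|K| == k.+1)].
pose one := [set K : {set T} | (#|K| == k.+1) && (#|[set s in S | s \subset K]| == 1)%N].
pose bad s := \bigcup_(s' in S :\ s) up (s :|: s').
have upE s : s \in S -> #|up s| = 'C(#|T| - j.+1, k - j).
  by move=> sS; rewrite /up card_supersets (uS s sS) ?subSS // ltnS ltnW.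
have badE s : s \in S -> (#|bad s| <= #|S| * #|T| ^ (k - j - 1))%N.
  move=> sS; apply: leq_trans (leq_bigcup_card _ _) _.
  rewrite -sum_nat_const [leqRHS](big_setD1 s) //= -[leqLHS]add0n leq_add //.
  apply: leq_sum => s' /setD1P[ns s'S].
  by apply: card_supersets_pair; rewrite ?uS // eq_sym.
have lo s : s \in S -> ('C(#|T| - j.+1, k - j) - #|S| * #|T| ^ (k - j - 1) <=
    #|[set K in one | s \subset K]|)%N.
  move=> sS; rewrite -(upE s sS).
  apply: (@leq_trans (#|up s| - #|bad s|)); first by rewrite leq_sub2l // badE.
  rewrite leq_subLR; apply: leq_trans (leq_trans (leq_card_setU _ _) (leqnn _)).
  apply/subset_leq_card/subsetP => K; rewrite !inE => /andP[sK /eqP Kk].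
  rewrite Kk eqxx sK andbT /= orbC.
  case: (boolP (#|_| == 1%N)) => //= /negPf n1.
  have : (0 < #|[set s in S | s \subset K]|)%N.
    by rewrite card_gt0; apply/set0Pn; exists s; rewrite inE sS sK.
  rewrite leq_eqVlt eq_sym n1 /= => /card_gt1P[a [b []]].
  rewrite !inE => /andP[aS aK] /andP[bS bK] ab.
  have [c [cS cK cs]] : exists c, [/\ c \in S, c \subset K & c != s].
    have [E|] := eqVneq a s; last by exists a.
    by exists b; split=> //; rewrite -E eq_sym.
  apply/bigcupP; exists c; first by rewrite !inE cs cS.
  by rewrite inE subUset sK cK Kk eqxx.
rewrite addnC -leq_subLR -mulnA -mulnBr.
rewrite -sum_nat_const; apply: leq_trans (leq_sum _ lo) _.
under eq_bigr => s _ do rewrite -sum1dep_card big_mkcondr.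
rewrite exchange_big /= -sum1_card; apply: leq_sum => K Kone.
rewrite -big_mkcondr sum1dep_card; move: Kone; rewrite inE => /andP[_ /eqP E].
by rewrite E.
Qed.

End Faces.

(** * Forbidden hyperedges, apexes and flowers *)

Section Obstructions.
Local Open Scope ring_scope.
Variable T : finType.
Implicit Types (f g h : {ffun {set T} -> 'F_2}) (s t K C : {set T}).
Implicit Types (H S F J : {set {set T}}) (v : T).

Definition forbidden k f :=
  [set K : {set T} | (#|K| == k.+1) && ~~ closed_on K f].

(** A hyperedge containing exactly one element of [S] is forbidden: a cocycle that is nonzero inside
    a hyperedge has at least k - j + 1 > 1 support sets there. *)
Lemma card_forbidden_small k j S : (j < k)%N -> (forall s, s \in S -> #|s| = j.+1) ->
  (#|S| * 'C(#|T| - j.+1, k - j) <=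
   #|forbidden k (ind S)| + #|S| * #|S| * #|T| ^ (k - j - 1))%N.
Proof.
move=> jk uS; apply: leq_trans (card_exactly_one jk uS) _; rewrite leq_add2r.
apply/subset_leq_card/subsetP => K; rewrite !inE => /andP[/eqP Kk /cards1P[s Es]].
rewrite Kk eqxx /=; apply/negP => cK.
have : s \in [set s in S | s \subset K] by rewrite Es set11.
rewrite inE => /andP[sS sK].
have := card_supp_in cK sK; rewrite ind_neq0 sS => /(_ isT).
rewrite Kk uS // subSS (_ : supp_in K (ind S) = [set s]).
  by rewrite cards1 ltnS leqn0 subn_eq0 leqNgt jk.
by rewrite -Es; apply/setP => x; rewrite !inE ind_neq0 andbC.
Qed.

(** Every (k+1)-set above a set of the support of [cobd f] is forbidden, and is counted at most once
    per subset. Together with the isoperimetric inequality this is linear in the support at all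
    sizes, where [card_forbidden_small] is spoilt by its quadratic error. *)
Lemma card_forbidden_large k j f : (j < k)%N -> degree j.+1 f ->
  (#|supp (cobd f)| * 'C(#|T| - j.+2, k - j - 1) <= 2 ^ k.+1 * #|forbidden k f|)%N.
Proof.
move=> jk df.
rewrite -sum_nat_const mulnC -sum_nat_const.
pose up s := [set K : {set T} | (s \subset K) && (#|K| == k.+1)].
apply: (@leq_trans (\sum_(s in supp (cobd f)) #|up s|)).
  apply: leq_sum => s; rewrite inE => /(degreeP _ _ (degree_cobd df)) sj.
  by rewrite card_supersets sj // subSS -subnDA addn1.
under eq_bigr => s _ do rewrite -sum1dep_card.
rewrite (exchange_big_dep (fun K => K \in forbidden k f)) /=; last first.
  move=> s K; rewrite !inE => ns /andP[sK ->] /=; apply: contra ns.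
  by move/closed_onP/(_ s sK)/eqP.
apply: leq_sum => K; rewrite inE => /andP[/eqP Kk _].
rewrite sum1dep_card -Kk -card_powerset; apply/subset_leq_card/subsetP => s.
by rewrite !inE => /and3P[].
Qed.

(** The covered faces are those of [v |: t] that contain [v]; with [t] they form a cycle. That [v]
    avoids all of [K] keeps this cycle off the other petals of a flower in [K]. *)
Definition good_apex k j H := forall K t, #|K| = k.+1 -> t \subset K ->
  #|t| = j.+1 -> exists2 v, v \notin K &
    forall u, u \in t -> exists2 K', K' \in H & (v |: t) :\ u \subset K'.

Lemma apex_cover k j H s : good_apex k j H -> (j <= k < #|T|)%N -> (#|s| <= j)%N ->
  exists2 K, K \in H & s \subset K.
Proof.
move=> ga /andP[jk kT] sj.
have [t st tj] : exists2 t : {set T}, s \subset t & #|t| = j.+1.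
  by apply: exists_superset; rewrite leqW //= (leq_ltn_trans jk).
have [K tK Kk] : exists2 K : {set T}, t \subset K & #|K| = k.+1.
  by apply: exists_superset; rewrite tj ltnS jk.
have [v vK cov] := ga K t Kk tK tj.
have /subsetPn[u ut us] : ~~ (t \subset s).
  by apply: contraL sj => /subset_leq_card; rewrite tj -ltnNge.
have [K' K'H sub] := cov u ut; exists K' => //; apply: subset_trans sub.
apply/subsetP => x xs; rewrite !inE (subsetP st) // orbT andbT.
by apply: contraNneq us => <-.
Qed.

(** All sets of at most j vertices are covered. For an uncovered (j+1)-set [s] with apex [v],
    [cobdK] at [v |: s] makes [cobd f s] a sum over covered faces. So [f] is a cocycle of the full
    simplex, which a cone contracts. *)
Lemma low_acyclic k j i H f : good_apex k j H -> (j <= k < #|T|)%N -> (i < j)%N ->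
  degree i.+1 f ->
  (forall s, #|s| = i.+2 -> (exists2 K, K \in H & s \subset K) -> cobd f s = 0) ->
  exists2 h, degree i h & cobd h = f.
Proof.
move=> ga jkT ij df cf; have /andP[jk kT] := jkT.
have ff : cobd f = 0.
  apply/ffunP => s; rewrite [RHS]ffunE.
  have [si|/eqP] := eqVneq #|s| i.+2; last first.
    by move=> /eqP; have /degreeP ds := degree_cobd df; apply: contra_neq_eq => /ds.
  have [sj|js] := leqP #|s| j; first exact: cf (apex_cover ga jkT sj).
  have {js} sj : #|s| = j.+1 by apply/eqP; rewrite eqn_leq js si ltnS ij.
  have [K sK Kk] : exists2 K : {set T}, s \subset K & #|K| = k.+1.
    by apply: exists_superset; rewrite sj ltnS jk.
  have [v vK cov] := ga K s Kk sK sj.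
  have vs : v \notin s by apply: contra vK; apply: (subsetP sK).
  have := cobdU1 (cobd f) vs; rewrite cobdK ffunE big1 ?addr0 // => u us.
  apply: cf (cov u us); have := cardsD1 u (v |: s).
  by rewrite !inE us orbT cardsU1 vs si => -[].
have [v _] : exists v : T, v \in T by apply/card_gt0P; apply: leq_ltn_trans kT.
exists (cone v f); first exact: degree_cone.
apply/ffunP => s; have [vs|vs] := boolP (v \in s); first exact: cobd_cone_in.
have := cobd_cone_notin f vs; rewrite ff [in RHS]ffunE => E.
by rewrite -[LHS]addr0 -(addrr_F2 (f s)) addrA E add0r.
Qed.

(** The [flower] of the theorem, over an arbitrary finite type. *)
Definition petals K C : {set {set T}} := [set w |: C | w in K :\: C].

Lemma card_petals K C : C \subset K -> #|petals K C| = (#|K| - #|C|)%N.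
Proof.
move=> CK; rewrite card_in_imset ?cardsD ?(setIidPr CK) // => x y.
rewrite !inE => /andP[xC _] /andP[yC _] /setP/(_ x).
by rewrite !inE eqxx (negPf xC) !orbF => /esym/eqP.
Qed.

Lemma petals_sub K C s : C \subset K -> s \in petals K C -> s \subset K.
Proof.
move=> CK /imsetP[w]; rewrite inE => /andP[_ wK] ->.
by rewrite subUset sub1set wK.
Qed.

Lemma petals_size K C s : s \in petals K C -> #|s| = #|C|.+1.
Proof. by move=> /imsetP[w]; rewrite inE => /andP[wC _] ->; rewrite cardsU1 wC. Qed.

(** Makes a flower closed on its own hyperedge. On the whole complex it need not be a coboundary,
    since [C] may lie in further hyperedges. *)
Lemma ind_petals K C s : s \subset K ->
  ind (petals K C) s = cobd (ind [set C]) s.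
Proof.
move=> sK; rewrite !ffunE; have [/imsetP[w]|nF] := boolP (s \in petals K C).
  rewrite inE => /andP[wC wK] ->; rewrite (bigD1 w) ?setU11 //= ffunE setU1K // set11.
  rewrite big1 ?addr0 // => x /andP[]; rewrite !inE => /orP[->//|xC] xw.
  rewrite ffunE !inE; case: eqP => // /setP/(_ w).
  by rewrite !inE eqxx eq_sym xw (negPf wC).
rewrite big1 // => x xs; rewrite ffunE !inE; case: eqP => // E.
case/negP: nF; apply/imsetP; exists x.
  by rewrite inE (subsetP sK) // andbT -E !inE eqxx.
by rewrite -E setD1K.
Qed.

Lemma closed_on_local K f g : (forall s, s \subset K -> f s = g s) ->
  closed_on K f -> closed_on K g.
Proof.
move=> fg /closed_onP cf; apply/closed_onP => s sK; rewrite -(cf s sK) !ffunE.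
by apply: eq_bigr => x xs; rewrite fg // (subset_trans (subsetDl _ _) sK).
Qed.

Lemma closed_on_petals K C : closed_on K (ind (petals K C)).
Proof.
by apply: closed_on_local (closed_on_cobd K (ind [set C])) => s sK; rewrite ind_petals.
Qed.

(** Each hyperedge of [H] contains either its own flower and no other petal, or no petal at all. *)
Lemma compat_petals H (W : {set {set T}}) (c : {set T} -> {set T}) :
  (forall K, K \in W -> K \in H /\ isolated_in H K (petals K (c K))) ->
  compat H (ind (\bigcup_(K in W) petals K (c K))).
Proof.
move=> iW; apply/compatP => K KH.
have only K' s : K' \in W -> s \in petals K' (c K') -> s \subset K -> K = K'.
  move=> /iW[_ iso] sF sK; have [_ /setP/(_ K)] := iso s sF.
  by rewrite !inE KH sK => /esym/eqP.
have [KW|KW] := boolP (K \in W).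
  apply: closed_on_local (closed_on_petals K (c K)) => s sK; rewrite !ffunE.
  congr (_%:R); congr nat_of_bool; apply/idP/bigcupP => [sF|[K' K'W sF]].
    by exists K.
  by rewrite (only _ _ K'W sF sK).
have : closed_on K 0 by apply/closed_onP => s _; rewrite ffunE big1 // => x _; rewrite ffunE.
apply: closed_on_local => s sK; rewrite !ffunE.
case: bigcupP => // -[K' K'W sF]; case/negP: KW.
by rewrite (only _ _ K'W sF sK).
Qed.

(** This is the case of equality in [card_supp_in]: every support set has at most one vertex outside
    [t]. One exchange of [u0] for [v0] fixes the centre [t :\ u0], and all further exchanges have to
    respect it. *)
Lemma least_cocycle_petals k j K f t : (j < k)%N -> #|K| = k.+1 -> #|t| = j.+1 ->
  closed_on K f -> t \subset K -> f t != 0 -> (#|supp_in K f| <= k - j + 1)%N ->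
  exists2 C : {set T}, C \subset K /\ #|C| = j & supp_in K f = petals K C.
Proof.
move=> jk Kk tj cf tK ft le.
have cKt : #|K :\: t| = (k - j)%N by rewrite cardsD (setIidPr tK) Kk tj subSS.
have imE : set0 |: [set [set v] | v in K :\: t] = [set s :\: t | s in supp_in K f].
  apply/eqP; rewrite eqEcard supp_in_imset //= card_setU1_set1 cKt.
  by apply: leq_trans (leq_imset_card _ _) _; rewrite -addn1.
have small s : s \subset K -> f s != 0 -> (#|s :\: t| <= 1)%N.
  move=> sK fs; have : s :\: t \in [set s :\: t | s in supp_in K f].
    by apply: imset_f; rewrite inE sK.
  rewrite -imE => /setU1P[->|/imsetP[v _ ->]]; first by rewrite cards0.
  by rewrite cards1.
have /set0Pn[v0] : K :\: t != set0 by rewrite -card_gt0 cKt subn_gt0.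
rewrite inE => /andP[v0t v0K].
have [u0 u0t fs0] := closed_exchange cf tK ft v0K v0t.
have v0u0 : v0 != u0 by apply: contraNneq v0t => ->.
set s0 := (v0 |: t) :\ u0 in fs0.
have s0K : s0 \subset K.
  by apply: subset_trans (subsetDl _ _) _; rewrite subUset sub1set v0K.
have CK : t :\ u0 \subset K by apply: subset_trans (subsetDl _ _) tK.
have Cj : #|t :\ u0| = j by have := cardsD1 u0 t; rewrite u0t tj => -[].
have sub : petals K (t :\ u0) \subset supp_in K f.
  apply/subsetP => s sF; rewrite inE (petals_sub CK sF) /=.
  case/imsetP: sF => w; rewrite !inE => /andP[wC wK] ->.
  have [->|wu0] := eqVneq w u0; first by rewrite setD1K.
  rewrite wu0 /= in wC.
  have [->|wv0] := eqVneq w v0.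
    rewrite (_ : v0 |: _ = s0) //; apply/setP => z; rewrite !inE.
    by case: (z =P v0) => [->|] //=; rewrite v0u0.
  have ws0 : w \notin s0 by rewrite !inE (negPf wv0) (negPf wC) andbF.
  have [u us0 fu] := closed_exchange cf s0K fs0 wK ws0.
  have wu : w != u by apply: contraNneq ws0 => ->.
  have s2K : (w |: s0) :\ u \subset K.
    by apply: subset_trans (subsetDl _ _) _; rewrite subUset sub1set wK.
  (* If [v0] stayed, the new support set would contain both [w] and [v0] outside [t], against
     [small]. *)
  have uv0 : u = v0.
    apply/eqP; apply: contraT => uv0; have := small _ s2K fu; rewrite leqNgt.
    case/negP; apply/card_gt1P; exists w, v0.
    split=> //; rewrite !inE ?wC ?wu ?eqxx //.
    by rewrite v0t v0u0 orbT eq_sym uv0.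
  rewrite (_ : w |: _ = (w |: s0) :\ u) //; apply/setP => z; rewrite uv0 !inE.
  have [->|zw] := eqVneq z w; first by rewrite wv0.
  by have [->|zv0] := eqVneq z v0; rewrite ?(negPf v0t) ?andbF.
exists (t :\ u0) => //; apply/eqP; rewrite eq_sym eqEcard sub card_petals //.
by rewrite Kk Cj (leq_trans le) // subSn ?addn1 // ltnW.
Qed.

Definition faces m s : {set {set T}} := [set t : {set T} | (t \subset s) && (#|t| == m)].

Lemma faces_even j s t : #|s| = j.+2 -> #|t| = j ->
  ~~ odd #|[set x in faces j.+1 s | t \subset x]|.
Proof.
move=> sj tj; have [ts|ts] := boolP (t \subset s); last first.
  rewrite (_ : [set x in _ | _] = set0) ?cards0 //; apply/setP => x; rewrite !inE.
  apply: contraNF ts => /andP[/andP[xs _] tx]; exact: subset_trans tx xs.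
rewrite (_ : [set x in _ | _] = petals s t); last first.
  apply/setP => x; rewrite !inE; apply/andP/idP => [[/andP[xs /eqP xj] tx]|xF].
    have : #|x :\: t| == 1%N by rewrite cardsD (setIidPr tx) xj tj subSnn.
    move=> /cards1P[w Ew]; apply/imsetP; exists w.
      have : w \in x :\: t by rewrite Ew set11.
      by rewrite !inE => /andP[-> /(subsetP xs)].
    by rewrite -Ew -[LHS](setID x t) (setIidPr tx) setUC.
  rewrite (petals_sub ts xF) (petals_size xF) tj eqxx; split => //.
  by case/imsetP: xF => w _ ->; rewrite subsetUr.
by rewrite card_petals // sj tj -addn2 addKn.
Qed.

(** Exchanging the sums counts each j-set once for every member of [J] above it, hence an even
    number of times. *)
Lemma sum_cobd_even j J h : (forall s, s \in J -> #|s| = j.+1) ->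
  (forall t, #|t| = j -> ~~ odd #|[set x in J | t \subset x]|) ->
  \sum_(s in J) cobd h s = 0.
Proof.
move=> uJ eJ; under eq_bigr => s sJ do rewrite (cobd_faces h (uJ s sJ)).
rewrite (exchange_big_dep (fun t : {set T} => #|t| == j)) /=; last by move=> ? ? _ /andP[].
rewrite big1 // => t /eqP tj.
transitivity (\sum_(x in [set x in J | t \subset x]) h t); last first.
  rewrite sumr_const -(odd_double_half #|_|) (negPf (eJ t tj)) add0n -mul2n.
  by rewrite mulrnA mulr2n addrr_F2 mul0rn.
by apply: eq_bigl => x; rewrite !inE tj eqxx andbT.
Qed.

(** The cycle is the boundary of [v |: (w |: C)], where [w |: C] is a petal and [v] its apex. The
    only other candidate for a petal in it is [v |: C], but [v] is not in [K]. *)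
Lemma apex_cycle k j H K C : good_apex k j H -> (j < k)%N ->
  K \in H -> #|K| = k.+1 -> C \subset K -> #|C| = j ->
  exists s, [/\ #|s| = j.+2,
    forall t, t \in faces j.+1 s -> exists2 K', K' \in H & t \subset K' &
    #|faces j.+1 s :&: petals K C| = 1%N].
Proof.
move=> ga jk KH Kk CK Cj.
have /set0Pn[w] : K :\: C != set0.
  by rewrite -card_gt0 cardsD (setIidPr CK) Kk Cj subn_gt0 ltnW.
rewrite inE => /andP[wC wK].
have tK : w |: C \subset K by rewrite subUset sub1set wK.
have tj : #|w |: C| = j.+1 by rewrite cardsU1 wC Cj.
have [v vK cov] := ga K _ Kk tK tj.
have vt : v \notin w |: C by apply: contra vK; apply: (subsetP tK).
exists (v |: (w |: C)); have sj : #|v |: (w |: C)| = j.+2 by rewrite cardsU1 vt tj.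
split=> //.
  move=> t; rewrite /faces -(faces_setD1 sj) => /imsetP[u].
  have [-> _ ->|uv] := eqVneq u v; first by exists K; rewrite // setU1K.
  by rewrite in_setU1 (negPf uv) => ut ->; apply: cov.
apply/eqP/cards1P; exists (w |: C); apply/setP => x; rewrite 3!inE.
apply/idP/eqP => [/andP[/andP[xs _] /imsetP[w' w'K Ex]]|->].
  move: w'K; rewrite inE => /andP[w'C w'K].
  have : w' \in v |: (w |: C) by apply: (subsetP xs); rewrite Ex setU11.
  rewrite !inE (negPf w'C) orbF => /orP[/eqP E|/eqP <- //].
  by rewrite -E w'K in vK.
by rewrite subsetUr tj eqxx /=; apply: imset_f; rewrite inE wC.
Qed.

End Obstructions.

(** * Exploration of connected supports *)

Section Exploration.
Variables (V E : finType) (inc : E -> {set V}).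
Implicit Types (q : seq V) (F S A : {set V}) (U H : {set E}).

(* Breadth-first exploration with queue [q], found vertices [F] and used edges
   [U]. A step either discards the head of the queue or uses a new edge through
   it, which adds a set of vertices of that edge. The result lists the possible
   outcomes [(F, U)] after at most [l] steps. *)
Fixpoint explore l q F U : seq ({set V} * {set E}) :=
  match l, q with
  | l'.+1, v :: q' => explore l' q' F U ++
      flatten [seq explore l' (q ++ enum A) (F :|: A) (e |: U) |
        e <- enum [set e | (v \in inc e) && (e \notin U)],
        A <- enum (powerset (inc e))]
  | _, _ => [:: (F, U)]
  end.

(** With [x] a birth probability this sums, over all outcomes, the probability that the used edges
    are born. Each step contributes 1 for a discard and [x] for each of at most [D] edges and
    [2 ^ c] subsets. *)
Lemma explore_weight (R : numDomainType) (x : R) D c l q F U :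
  (0 <= x)%R -> (forall v, #|[set e | v \in inc e]| <= D)%N ->
  (forall e, #|inc e| <= c)%N ->
  (\sum_(st <- explore l q F U) x ^+ #|st.2| <=
   x ^+ #|U| * (1 + x * (D * 2 ^ c)%:R) ^+ l)%R.
Proof.
move=> x0 degD sizec; elim: l q F U => [|l IH] [|v q] F U.
- by rewrite big_seq1 expr0 mulr1.
- by rewrite big_seq1 expr0 mulr1.
- rewrite big_seq1 /= ler_peMr ?exprn_ge0 // exprn_ege1 // lerDl.
  by rewrite mulr_ge0 // ler0n.
set y := (1 + _)%R; have y0 : (0 <= y)%R by rewrite addr_ge0 // mulr_ge0 // ler0n.
rewrite /= big_cat exprS mulrCA mulrDl mul1r lerD ?IH //.
rewrite big_flatten big_allpairs_dep big_enum /=.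
apply: (@le_trans _ _ (\sum_(e in [set e | v \in inc e])
   x * (2 ^ c)%:R * (x ^+ #|U| * y ^+ l))%R); last first.
  rewrite sumr_const -[leLHS]mulr_natl !mulrA ler_wpM2r ?exprn_ge0 //.
  rewrite ler_wpM2r ?exprn_ge0 // [(_ * x)%R]mulrC.
  by rewrite -mulrA -natrM ler_wpM2l // ler_nat leq_mul2r degD orbT.
rewrite [leLHS](_ : _ = (\sum_(e in [set e | v \in inc e] | e \notin U)
   \sum_(A <- enum (powerset (inc e)))
     \sum_(st <- explore l (v :: q ++ enum A) (F :|: A) (e |: U)) x ^+ #|st.2|)%R);
  last by apply: eq_bigl => e; rewrite !inE.
rewrite big_mkcondr; apply: ler_sum => e _; case: ifP => [eU|_]; last first.
  by rewrite !mulr_ge0 ?exprn_ge0.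
rewrite big_enum /=.
apply: (@le_trans _ _ (\sum_(A in powerset (inc e)) x * (x ^+ #|U| * y ^+ l))%R).
  apply: ler_sum => A _; apply: le_trans (IH _ _ _) _.
  by rewrite cardsU1 eU exprS mulrA.
rewrite sumr_const -[leLHS]mulr_natl card_powerset mulrA [(_ * x)%R]mulrC.
rewrite ler_wpM2r ?mulr_ge0 ?exprn_ge0 // ler_wpM2l // ler_nat leq_exp2l //.
Qed.

(** The potential [size q + 2 * (#|S| - #|F|)] drops at every step: a discard shortens the queue,
    and an edge with [a > 0] new vertices adds [a] to the queue but takes [2 * a] from the other
    term. *)
Lemma explore_complete H S l q F U :
  (forall F, F \subset S -> F != set0 ->
    (forall e v w, e \in H -> v \in F -> w \in S -> v \in inc e -> w \in inc e ->
      w \in F) -> F = S) ->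
  F \subset S -> F != set0 -> U \subset H -> {subset q <= F} ->
  (forall e, e \in U -> inc e :&: S \subset F) ->
  (forall e v, v \in F -> v \notin q -> e \in H -> v \in inc e -> inc e :&: S \subset F) ->
  (size q + 2 * (#|S| - #|F|) <= l)%N ->
  exists2 U', (S, U') \in explore l q F U & U' \subset H.
Proof.
move=> lS; elim: l q F U => [|l IH] [|v q] F U FS F0 UH qF usedF doneF lel.
- exists U; rewrite // inE; apply/eqP; congr (_, _); apply/esym.
  by apply: lS => // e v w eH vF wS ve we; apply: (subsetP (doneF e v vF _ eH ve)); rewrite ?inE ?we.
- by rewrite addSn in lel.
- exists U; rewrite // inE; apply/eqP; congr (_, _); apply/esym.
  by apply: lS => // e v w eH vF wS ve we; apply: (subsetP (doneF e v vF _ eH ve)); rewrite ?inE ?we.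
have vF : v \in F by apply: qF; rewrite mem_head.
(* The head is discarded once everything of [S] on edges of [H] through it has been found; otherwise
   such an edge is used, with [A] its new elements of [S]. *)
have [/forall_inP fin|] := boolP [forall (e | e \in H), (v \in inc e) ==> (inc e :&: S \subset F)].
  have [] := IH q F U; rewrite //.
  - by move=> w wq; apply: qF; rewrite inE wq orbT.
  - move=> e w wF wq eH we; have [E1|wv] := eqVneq w v.
      by apply: (implyP (fin e eH)); rewrite -E1.
    by apply: (doneF e w); rewrite // inE negb_or wv.
  - by move=> U' U'1 U'H; exists U' => //=; rewrite mem_cat U'1.
rewrite negb_forall_in => /exists_inP[e eH]; rewrite negb_imply => /andP[ve nF].
have eU : e \notin U by apply: contra nF; apply: usedF.
pose A := (inc e :&: S) :\: F.
have A0 : (0 < #|A|)%N by rewrite card_gt0 setD_eq0.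
have AS : F :|: A \subset S.
  by rewrite subUset FS; apply: subset_trans (subsetDl _ _) (subsetIr _ _).
have eFA : inc e :&: S \subset F :|: A.
  by apply/subsetP => w wI; rewrite !inE; case: (w \in F) => //=; rewrite inE in wI.
have [] := IH ((v :: q) ++ enum A) (F :|: A) (e |: U); rewrite //.
- by apply: contra F0; rewrite -!subset0; apply: subset_trans; apply: subsetUl.
- by rewrite subUset sub1set eH.
- move=> w; rewrite mem_cat mem_enum in_setU => /orP[/qF ->//|->]; exact: orbT.
- move=> e' /setU1P[->//|/usedF sub]; exact: subset_trans sub (subsetUl _ _).
- move=> e' w; rewrite in_setU mem_cat mem_enum negb_or => wFA /andP[wq wA] e'H we'.
  apply: subset_trans (subsetUl _ _); apply: (doneF e' w) => //.
  by move: wFA; rewrite (negPf wA) orbF.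
- have cFA : #|F :|: A| = (#|F| + #|A|)%N.
    rewrite cardsU (_ : F :&: A = set0) ?cards0 ?subn0 //.
    by apply/setP => w; rewrite !inE; case: (w \in F).
  have := subset_leq_card AS; rewrite size_cat -cardE cFA.
  by move: lel => /=; lia.
move=> U' U'1 U'H; exists U' => //=; rewrite mem_cat; apply/orP; right.
apply/flattenP; exists (explore l ((v :: q) ++ enum A) (F :|: A) (e |: U)) => //.
apply/allpairsPdep; exists e, A; split => //.
  by rewrite mem_enum inE ve.
by rewrite mem_enum inE; apply: subset_trans (subsetDl _ _) (subsetIl _ _).
Qed.

End Exploration.

Require Import Defs.
From mathcomp Require Import all_classical all_reals all_analysis ring lra.

Import numFieldNormedType.Exports.

Local Open Scope classical_set_scope.
Local Open Scope ring_scope.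

(** * Second moment method on a finite weighted space *)

Section SecondMoment.
Variables (R : realFieldType) (S I : finType) (w : S -> R) (A : I -> pred S).
Hypotheses (w0 : forall s, 0 <= w s) (w1 : \sum_s w s = 1).

Let pr (Q : pred S) := \sum_(s | Q s) w s.
Let mean := \sum_i pr (A i).
Let count s : R := \sum_i (A i s)%:R.

Lemma weight_sum_indic (Q : pred S) : \sum_s w s * (Q s)%:R = pr Q.
Proof.
rewrite /pr [RHS]big_mkcond; apply: eq_bigr => s _.
by case: (Q s); rewrite ?mulr1 ?mulr0.
Qed.

Lemma mean_count : \sum_s w s * count s = mean.
Proof.
under eq_bigr => s _ do rewrite mulr_sumr.
by rewrite exchange_big /=; apply: eq_bigr => i _; apply: weight_sum_indic.
Qed.

Lemma mean_count_sqr : \sum_s w s * count s ^+ 2 =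
  \sum_i \sum_j pr [pred s | A i s && A j s].
Proof.
under eq_bigr => s _.
  rewrite expr2 /count mulr_suml mulr_sumr.
  under eq_bigr => i _ do rewrite mulr_sumr mulr_sumr.
  over.
rewrite exchange_big /=; apply: eq_bigr => i _.
rewrite exchange_big /=; apply: eq_bigr => j _.
rewrite -weight_sum_indic; apply: eq_bigr => s _.
by rewrite -natrM mulnb.
Qed.

(** Chebyshev's inequality without division: where [2 * count < mean], the squared deviation is at
    least [mean ^+ 2 / 4]. In the variance the diagonal pairs account for [mean] and all others for
    [eps * mean ^+ 2]. *)
Lemma second_moment (eps : R) : 0 <= eps ->
  (forall i j, i != j ->
    pr [pred s | A i s && A j s] <= (1 + eps) * (pr (A i) * pr (A j))) ->
  pr [pred s | 2 * count s < mean] * mean ^+ 2 <= 4 * (mean + eps * mean ^+ 2).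
Proof.
move=> e0 Aij.
have pr0 Q : 0 <= pr Q by apply: sumr_ge0.
have mean0 : 0 <= mean by apply: sumr_ge0.
have sq : \sum_s w s * count s ^+ 2 <= mean + (1 + eps) * mean ^+ 2.
  rewrite mean_count_sqr expr2 /mean mulr_suml mulr_sumr -big_split /=.
  apply: ler_sum => i _; rewrite (bigD1 i) //=; apply: lerD.
    by rewrite le_eqVlt; apply/orP; left; apply/eqP/eq_bigl => s /=; rewrite andbb.
  rewrite mulr_sumr mulr_sumr [leRHS](bigD1 i) //= -[leLHS]add0r; apply: lerD.
    by rewrite !mulr_ge0 // addr_ge0.
  by apply: ler_sum => j ji; apply: Aij; rewrite eq_sym.
have var : \sum_s w s * (count s - mean) ^+ 2 <= mean + eps * mean ^+ 2.
  rewrite (_ : \sum_s _ = \sum_s w s * count s ^+ 2 - mean ^+ 2); first by lra.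
  transitivity (\sum_s (w s * count s ^+ 2 + (- 2 * mean) * (w s * count s)
      + mean ^+ 2 * w s)); first by apply: eq_bigr => s _; ring.
  by rewrite !big_split /= -!mulr_sumr mean_count w1; ring.
rewrite /pr mulr_suml.
apply: (@le_trans _ _ (\sum_s 4 * (w s * (count s - mean) ^+ 2))); last first.
  by rewrite -mulr_sumr ler_wpM2l.
rewrite big_mkcond; apply: ler_sum => s _; case: ifP => /= c; last first.
  by rewrite mulr_ge0 // mulr_ge0 // sqr_ge0.
rewrite [leRHS]mulrCA ler_wpM2l //.
have c0 : 0 <= count s by apply: sumr_ge0.
nra.
Qed.

End SecondMoment.

(** * Probabilities of events that depend on finite data *)

Section FiniteEvents.
Context d (T : measurableType d) (R : realType) (P : probability T R).

Definition prob (A : set T) : R := fine (P A).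

Lemma EFin_prob A : measurable A -> (prob A)%:E = P A.
Proof. by move=> mA; rewrite /prob fineK // fin_num_measure. Qed.

Lemma prob_ge0 A : 0 <= prob A.
Proof. by rewrite fine_ge0. Qed.

Lemma le_prob A B : measurable A -> measurable B -> A `<=` B -> prob A <= prob B.
Proof.
move=> mA mB AB; apply: fine_le; rewrite ?fin_num_measure //.
by apply: le_measure; rewrite ?inE.
Qed.

Lemma union_bound (I : eqType) (s : seq I) (A : I -> set T) (B : set T) :
  measurable B -> (forall i, measurable (A i)) ->
  (forall x, B x -> exists2 i, i \in s & A i x) ->
  prob B <= \sum_(i <- s) prob (A i).
Proof.
move=> mB mA; elim: s B mB => [|i s IH] B mB BA.
  rewrite big_nil (_ : B = set0) /prob ?measure0 // predeqE => x; split => //.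
  by move=> /BA[].
have mBA : measurable (B `\` A i) by apply: measurableD.
rewrite big_cons; apply: (@le_trans _ _ (prob (A i) + prob (B `\` A i))).
  rewrite -fineD ?fin_num_measure //; apply: fine_le.
  - by rewrite fin_num_measure.
  - by rewrite fin_numD !fin_num_measure.
  rewrite (measureDI P mB (mA i)) addeC; apply: leeD2r.
  by apply: le_measure; rewrite ?inE //; exact: measurableI.
rewrite lerD2l; apply: IH => // x [/BA[j]]; rewrite inE => /orP[/eqP -> //|js Aj _].
by exists j.
Qed.

(** Meant for finite [F]: then every property of [X x] is measurable, and single events need no
    measurability argument of their own. *)
Definition fin_measurable (F : Type) (X : T -> F) :=
  forall s, measurable [set x | X x = s].

Lemma fin_measurable_pred (F : finType) (X : T -> F) (Q : F -> Prop) :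
  fin_measurable X -> measurable [set x | Q (X x)].
Proof.
move=> mX; rewrite (_ : mkset _ = \bigcup_(s in [set s | Q s]) [set x | X x = s]).
  by apply: fin_bigcup_measurable => //; apply: finite_finset.
by rewrite predeqE => x; split => [Qx|[s Qs /= ->//]]; exists (X x).
Qed.

Lemma fin_measurable_pair (F G : Type) (X : T -> F) (Y : T -> G) :
  fin_measurable X -> fin_measurable Y -> fin_measurable (fun x => (X x, Y x)).
Proof.
move=> mX mY [s t]; rewrite (_ : mkset _ = [set x | X x = s] `&` [set x | Y x = t]).
  exact: measurableI.
by rewrite predeqE => x; split => /= [[<- <-] //|[<- <-]].
Qed.

Lemma prob_fin_sum (F : finType) (X : T -> F) (Q : pred F) : fin_measurable X ->
  prob [set x | Q (X x)] = \sum_(s | Q s) prob [set x | X x = s].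
Proof.
move=> mX; rewrite /prob.
rewrite (_ : mkset _ = \bigcup_(s in [set` Q]) [set x | X x = s]); last first.
  by rewrite predeqE => x; split => [Qx|[s Qs /= ->//]]; exists (X x).
rewrite measure_fin_bigcup //; last by move=> s t _ _ [x [/= <- <-]].
rewrite -(@bigfs _ _ _ _ (index_enum F) Q) ?index_enum_uniq //; last first.
  by move=> s _; rewrite mem_index_enum.
by rewrite -sum_fine // => s _; rewrite fin_num_measure.
Qed.

Lemma prob_setT : prob setT = 1.
Proof. by rewrite /prob probability_setT. Qed.

Lemma prob_second_moment (F I : finType) (X : T -> F) (A : I -> pred F)
    (mean eps : R) :
  mean = \sum_i prob [set x | A i (X x)] -> fin_measurable X -> 0 <= eps ->
  (forall i j, i != j -> prob [set x | A i (X x) && A j (X x)] <=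
     (1 + eps) * (prob [set x | A i (X x)] * prob [set x | A j (X x)])) ->
  prob [set x | 2 * #|[set i | A i (X x)]%SET|%:R < mean] * mean ^+ 2 <=
    4 * (mean + eps * mean ^+ 2).
Proof.
move=> mE mX e0 Aij; pose w s := prob [set x | X x = s].
have meanE : mean = \sum_i \sum_(s | A i s) w s.
  by rewrite mE; apply: eq_bigr => i _; apply: prob_fin_sum.
have cE s : \sum_i (A i s)%:R = #|[set i | A i s]%SET|%:R :> R.
  by rewrite -natr_sum -sum1dep_card [in RHS]big_mkcond; congr (_%:R).
pose Q := [pred s | 2 * (\sum_i (A i s)%:R) < mean].
rewrite (_ : [set x | _ < _] = [set x | Q (X x)]); last first.
  by rewrite predeqE => x; rewrite /Q /= cE.
rewrite (prob_fin_sum Q mX) /Q meanE; apply: second_moment => //.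
- by move=> s; apply: prob_ge0.
- rewrite -(prob_fin_sum predT mX) -prob_setT; congr (prob _).
  by rewrite predeqE.
move=> i j ij; have := Aij i j ij.
rewrite (prob_fin_sum (A i) mX) (prob_fin_sum (A j) mX).
by rewrite (prob_fin_sum [pred s | A i s && A j s] mX).
Qed.

End FiniteEvents.

(** * The random family of born hyperedges *)

Section Births.
Context (R : realType) (k n : nat) d (T : measurableType d) (P : probability T R).
Variable b : hyperedge k n -> {RV P >-> R}.
Hypothesis hb : iid_uniform01 b.
Implicit Types (X Y : {set {set 'I_n}}) (K : {set 'I_n}).

(** A set of sets rather than of elements of [hyperedge k n]: the cochain lemmas apply to it
    directly, and as a random variable it has finite range. *)
Definition born (c : hyperedge k n -> R) (p : R) : {set {set 'I_n}} :=
  [set K | [exists e : hyperedge k n, (val e == K) && (c e <= p)]]%SET.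

Lemma bornE c p (e : hyperedge k n) : (val e \in born c p) = (c e <= p).
Proof.
rewrite inE; apply/existsP/idP => [[e' /andP[/eqP/val_inj -> //]]|ep].
by exists e; rewrite eqxx.
Qed.

Lemma born_uniform c p : uniform k.+1 (born c p).
Proof. by move=> K; rewrite inE => /existsP[e /andP[/eqP <- _]]; apply/eqP/(valP e). Qed.

Lemma born_mono c p q : p <= q -> born c p \subset born c q.
Proof.
move=> pq; apply/fintype.subsetP => K; rewrite !inE => /existsP[e /andP[eK ep]].
by apply/existsP; exists e; rewrite eK (le_trans ep).
Qed.

Definition avoid X Y := forall K, K \in X -> K \notin Y.

Let path x : hyperedge k n -> R := fun e => b e x.

Lemma prob_le e q : 0 <= q <= 1 -> P (b e @^-1` [set` `]-oo, q]]) = q%:E.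
Proof.
move=> /andP[q0 q1]; have [dist _] := hb.
rewrite -[LHS]/(distribution P (b e) _) dist // /uniform_prob integral_uniform_pdf.
rewrite (_ : _ `&` _ = [set` `[0, q]]); last first.
  rewrite predeqE => x /=; rewrite !in_itv /=; split.
    by move=> [-> /andP[->]].
  by move=> /andP[-> xq]; rewrite xq (le_trans xq).
rewrite (eq_integral (fun=> 1%:E)); last first.
  move=> x; rewrite inE /= in_itv /= /uniform_pdf => /andP[-> xq].
  by rewrite (le_trans xq) // subr0 invr1.
rewrite integral_cst //= mul1e lebesgue_measure_itv /= lte_fin.
case: ltP => [_|qle0]; first by rewrite sube0.
by congr (_%:E); apply/eqP; rewrite eq_le q0 qle0.
Qed.

Lemma prob_gt e q : 0 <= q <= 1 -> P (b e @^-1` [set` `]q, +oo[]) = (1 - q)%:E.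
Proof.
move=> q01; rewrite (_ : b e @^-1` _ = ~` (b e @^-1` [set` `]-oo, q]])); last first.
  by rewrite predeqE => x /=; rewrite !in_itv /= andbT ltNge; split => /negP.
rewrite probability_setC ?prob_le //; last exact: measurable_funPTI.
Qed.

Lemma prob_between e p q : 0 <= p -> p <= q -> q <= 1 ->
  P (b e @^-1` [set` `]p, q]]) = (q - p)%:E.
Proof.
move=> p0 pq q1; rewrite (_ : b e @^-1` _ =
    (b e @^-1` [set` `]-oo, q]]) `\` (b e @^-1` [set` `]-oo, p]])); last first.
  rewrite predeqE => x /=; rewrite !in_itv /= ltNge andbC; split.
    by move=> /andP[-> /negP].
  by move=> [-> /negP].
have mle r : measurable (b e @^-1` [set` `]-oo, r]]) by apply: measurable_funPTI.
transitivity (P (b e @^-1` [set` `]-oo, q]]) - P (b e @^-1` [set` `]-oo, p]]))%E.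
  rewrite measureD //; last by rewrite ltey_eq fin_num_measure.
  by rewrite setIidr // => x /=; rewrite !in_itv /= => /le_trans; apply.
by rewrite !prob_le ?p0 ?(le_trans p0 pq) // (le_trans pq).
Qed.

Lemma fin_measurable_born p : fin_measurable (fun x => born (path x) p).
Proof.
pose X x := [ffun e => b e x <= p].
have mX : fin_measurable X.
  move=> f; rewrite (_ : mkset _ =
      \bigcap_(e in [set: hyperedge k n]) [set x | (b e x <= p) = f e]).
    apply: fin_bigcap_measurable => [|e _]; first exact: finite_finset.
    have mle : measurable [set x | b e x <= p].
      rewrite (_ : mkset _ = b e @^-1` [set` `]-oo, p]]); first exact: measurable_funPTI.
      by rewrite predeqE => x /=; rewrite in_itv.
    case: (f e) => //; rewrite (_ : mkset _ = ~` [set x | b e x <= p]).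
      exact: measurableC.
    by rewrite predeqE => x /=; split => [->|/negP/negbTE].
  rewrite predeqE => x /=; split => [<- e _ /=|Xf]; first by rewrite ffunE.
  by apply/ffunP => e; rewrite ffunE; apply: Xf.
move=> S; pose Q (f : {ffun hyperedge k n -> bool}) :=
  [set K | [exists e : hyperedge k n, (val e == K) && f e]]%SET = S.
rewrite (_ : mkset _ = [set x | Q (X x)]); first exact: fin_measurable_pred.
rewrite predeqE => x; rewrite /Q /born /=.
under [in X in _ <-> X = _]eq_finset => K do
  under eq_existsb => e do rewrite ffunE.
by [].
Qed.

Lemma card_hyperedges_in X : uniform k.+1 X ->
  #|[set e : hyperedge k n | val e \in X]%SET| = #|X|.
Proof.
move=> uX; rewrite -(card_imset _ val_inj); apply: eq_card => K.
apply/imsetP/idP => [[e]|KX]; first by rewrite inE => eX ->.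
have KP : #|K| == k.+1 by rewrite uX.
by exists (Sub K KP); rewrite ?inE SubK.
Qed.

Lemma prod_hyperedges_in X (c : R) : uniform k.+1 X ->
  \prod_(e in [set: hyperedge k n]%SET) (if val e \in X then c else 1) = c ^+ #|X|.
Proof.
move=> uX; rewrite -big_mkcondr /= -(card_hyperedges_in uX) -prodr_const.
by apply: eq_bigl => e; rewrite !inE.
Qed.

(** As the three families are disjoint, each birth time is confined to one interval, and
    independence gives a product. The window from [p1] to [p2] serves the hyperedges born between
    two thresholds. *)
Lemma prob_cylinder X0 X1 Y (p0 p1 p2 q : R) :
  uniform k.+1 X0 -> uniform k.+1 X1 -> uniform k.+1 Y ->
  avoid X0 (X1) -> avoid X0 (Y) -> avoid X1 (Y) ->
  0 <= p0 <= 1 -> 0 <= p1 -> p1 <= p2 -> p2 <= 1 -> 0 <= q <= 1 ->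
  prob P [set x | [/\ X0 \subset born (path x) p0, X1 \subset born (path x) p2,
     avoid X1 (born (path x) p1) & avoid Y (born (path x) q)]] =
  p0 ^+ #|X0| * (p2 - p1) ^+ #|X1| * (1 - q) ^+ #|Y|.
Proof.
move=> uX0 uX1 uY dX01 dX0 dX1 p001 p10 p12 p21 q01.
pose A (e : hyperedge k n) : set R :=
  if val e \in X0 then [set` `]-oo, p0]] else if val e \in X1 then [set` `]p1, p2]]
  else if val e \in Y then [set` `]q, +oo[] else setT.
have mA e : measurable (A e) by rewrite /A; do 3?case: ifP.
rewrite /prob (_ : mkset _ = \bigcap_(e in [set` [set: hyperedge k n]%SET]) b e @^-1` A e).
  have [_ ->] // := hb.
  rewrite (eq_bigr (fun e => ((if val e \in X0 then p0 else 1) *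
      (if val e \in X1 then p2 - p1 else 1) * (if val e \in Y then 1 - q else 1))%:E)).
    by rewrite prodEFin /= !big_split /= !prod_hyperedges_in.
  move=> e _; rewrite /A; have [eX0|_] := boolP (val e \in X0).
    rewrite (negPf (dX01 _ eX0)) (negPf (dX0 _ eX0)) !mulr1; exact: prob_le.
  have [eX1|_] := boolP (val e \in X1).
    by rewrite (negPf (dX1 _ eX1)) mul1r mulr1; apply: prob_between.
  rewrite !mul1r; case: ifP => _; first exact: prob_gt.
  by rewrite preimage_setT probability_setT.
rewrite predeqE => x /=; split.
  move=> [/fintype.subsetP s0 /fintype.subsetP s2 d1 dq] e _; rewrite /A.
  case: ifP => [/s0|_]; first by rewrite bornE /= in_itv.
  case: ifP => [eX1|_].
    rewrite /= in_itv /= -(bornE (path x)) s2 // andbT ltNge -(bornE (path x)).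
    by rewrite d1.
  case: ifP => // eY; rewrite /= in_itv /= andbT ltNge -(bornE (path x)).
  by rewrite dq.
move=> Ax; have wit X : uniform k.+1 X -> forall K, K \in X ->
    exists2 e : hyperedge k n, val e = K & A e (b e x).
  move=> uX K KX; have KP : #|K| == k.+1 by rewrite uX.
  by exists (Sub K KP); rewrite ?SubK //; apply: Ax; rewrite /= inE.
split.
- apply/fintype.subsetP => K KX; have [e eK] := wit _ uX0 _ KX.
  by rewrite /A eK KX -eK bornE /= in_itv.
- apply/fintype.subsetP => K KX; have [e eK] := wit _ uX1 _ KX.
  by rewrite /A eK KX [_ \in X0](negbTE (contraTN (dX01 K) KX)) -eK bornE /= in_itv => /andP[].
- move=> K KX; have [e eK] := wit _ uX1 _ KX.
  rewrite /A eK KX [_ \in X0](negbTE (contraTN (dX01 K) KX)) -eK bornE /= in_itv /= => /andP[+ _].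
  by rewrite ltNge.
- move=> K KX; have [e eK] := wit _ uY _ KX.
  rewrite /A eK KX [_ \in X0](negbTE (contraTN (dX0 K) KX)) [_ \in X1](negbTE (contraTN (dX1 K) KX)) -eK bornE /= in_itv /= andbT.
  by rewrite ltNge.
Qed.

End Births.

(** * Cohomology of a complex in terms of cochains on all sets *)

Section CohomologyOfComplexes.
Variables (n : nat) (G : {set {set 'I_n}}).
Implicit Types (s t : {set 'I_n}) (F h : {ffun {set 'I_n} -> 'F_2}).

Definition ext i (f : cochain G i) : {ffun {set 'I_n} -> 'F_2} :=
  [ffun s => if insub s is Some t then f t else 0].

Definition res i F : cochain G i := [ffun t : simplex G i => F (val t)].

Lemma ext_val i (f : cochain G i) (t : simplex G i) : ext f (val t) = f t.
Proof. by rewrite ffunE valK. Qed.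

Lemma degree_ext i (f : cochain G i) : degree i.+1 (ext f).
Proof.
apply/degreeP => s; rewrite ffunE; case: insubP => [u /andP[_ /eqP us] _ _ //|_].
by rewrite eqxx.
Qed.

Lemma coboundary_ext i (f : cochain G i) (s : simplex G i.+1) :
  coboundary f s = cobd (ext f) (val s).
Proof.
have /andP[_ /eqP sz] := valP s; rewrite (cobd_faces _ sz) ffunE.
rewrite [RHS](bigID (fun t => t \in G)) /= [X in _ + X]big1 ?addr0; last first.
  move=> t /andP[_ tG]; rewrite ffunE; case: insubP => // u /andP[uG _] _.
  by rewrite uG in tG.
under eq_bigr => t _ do rewrite -ext_val.
pose B := [set t : simplex G i | val t \subset val s]%SET.
transitivity (\sum_(t in B) ext f (val t)); first by apply: eq_bigl => t; rewrite inE.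
rewrite -(big_imset _ (in2W val_inj)) /=; apply: eq_bigl => t.
apply/imsetP/andP => [[u uB ->]|[/andP[ts ti] tG]].
  by rewrite inE in uB; have /andP[-> ->] := valP u; rewrite uB.
have tP : (t \in G) && (#|t| == i.+1) by rewrite tG.
by exists (Sub t tP); rewrite ?inE SubK.
Qed.

Lemma coboundary_res i F (s : simplex G i.+1) :
  (forall t, t \subset val s -> #|t| = i.+1 -> t \in G) ->
  coboundary (res i F) s = cobd F (val s).
Proof.
move=> clG; have /andP[_ /eqP sz] := valP s.
rewrite coboundary_ext !(cobd_faces _ sz); apply: eq_bigr => t /andP[ts /eqP ti].
have tP : (t \in G) && (#|t| == i.+1) by rewrite clG // ti eqxx.
by rewrite -[t]/(val (Sub t tP : simplex G i)) ext_val ffunE.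
Qed.

Lemma cocyclesP i (f : cochain G i) : reflect (coboundary f = 0) (f \in cocycles G i).
Proof.
rewrite /cocycles; apply: (iffP idP) => [/mker // | f0].
by apply/kerP; rewrite ?inE.
Qed.

Lemma cohomology_eq1 i : cohomology G i.+1 = 1%g <->
  forall f : cochain G i.+1, coboundary f = 0 ->
    exists h : cochain G i, coboundary h = f.
Proof.
have nN : (cocycles G i.+1 \subset 'N(coboundaries G i.+1))%g.
  apply: fintype.subset_trans (cent_sub _); apply/fintype.subsetP => f _.
  by apply/centP => g _; apply/ffunP => x; rewrite !ffunE addrC.
split=> [coh1 f /cocyclesP fZ|H].
  have : cohomology G i.+1 \subset 1%G by rewrite coh1.
  rewrite quotient_sub1 // => /fintype.subsetP/(_ f fZ)/morphimP[h _ _ ->].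
  by exists h.
apply/trivgP; rewrite quotient_sub1 //; apply/fintype.subsetP => f /cocyclesP/H[h <-].
by apply: mem_morphim; rewrite inE.
Qed.

(** Degree 0 has no nonzero coboundaries, so the cohomology has the order of the group of cocycles;
    a group of order 2 is cyclic and thus determined by its order. *)
Lemma cohomology0_isog : (cohomology G 0 \isog [set: 'F_2]%SET) <-> #|cocycles G 0| = 2.
Proof.
have cE : #|cohomology G 0| = #|cocycles G 0|.
  by rewrite /cohomology /= card_quotient ?norms1 // indexg1.
split=> [/card_isog|c2]; first by rewrite cE cardsT card_ord.
have cF : #|[set: 'F_2]%SET| = 2 by rewrite cardsT card_ord.
by rewrite isog_cyclic_card ?prime_cyclic ?cE ?c2 ?cF.
Qed.

Lemma connectedE j : (0 < j)%N -> cohomologically_connected G j <->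
  [/\ #|cocycles G 0| = 2 & forall i, (i < j)%N -> forall f : cochain G i.+1,
    coboundary f = 0 -> exists h : cochain G i, coboundary h = f].
Proof.
move=> j0; rewrite /cohomologically_connected cohomology0_isog; split => -[c2 H].
  split=> // i ij; apply/cohomology_eq1/H; rewrite ij; lia.
by split=> // -[|i] /andP[// _ ij]; apply/cohomology_eq1/H.
Qed.

End CohomologyOfComplexes.

(** * Connectedness of the complex at a given time *)

Section ComplexAt.
Context (R : realType) (k n : nat) (c : hyperedge k n -> R) (p : R).
Implicit Types (s t K C : {set 'I_n}) (F h : {ffun {set 'I_n} -> 'F_2}).
Let G := complex_at c p.
Let H := born c p.

Lemma mem_complex_at s : (s \in G) =
  (#|s| == 1%N) || ((s != finset.set0) && [exists (K | K \in H), s \subset K]).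
Proof.
rewrite inE; congr (_ || (_ && _)); apply/existsP/exists_inP.
  by move=> [K /andP[cK sK]]; exists (val K); rewrite ?bornE.
move=> [K]; rewrite inE => /existsP[e /andP[/eqP <- ep]] sK.
by exists e; rewrite ep.
Qed.

Lemma covered_in_complex K s : K \in H -> s \subset K -> s != finset.set0 -> s \in G.
Proof.
move=> KH sK s0; rewrite mem_complex_at s0 /=; apply/orP; right.
by apply/exists_inP; exists K.
Qed.

Lemma in_complex_cover s : s \in G -> (1 < #|s|)%N -> exists2 K, K \in H & s \subset K.
Proof.
rewrite mem_complex_at => /orP[/eqP -> //|/andP[_ /exists_inP[K KH sK]] _].
by exists K.
Qed.

Lemma complex_faces s t : s \in G -> t \subset s -> t != finset.set0 -> t \in G.
Proof.
rewrite mem_complex_at => /orP[|/andP[_ /exists_inP[K KH sK]] ts].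
  move=> /cards1P[x ->]; rewrite subset1 => /orP[/eqP -> _|/eqP ->]; last by rewrite eqxx.
  by rewrite mem_complex_at cards1.
by apply: covered_in_complex KH _; apply: fintype.subset_trans ts sK.
Qed.

Lemma coboundary_res_complex i F (s : simplex G i.+1) :
  coboundary (res G i F) s = cobd F (val s).
Proof.
apply: coboundary_res => t ts ti; have /andP[sG _] := valP s.
by apply: complex_faces ts _ => //; rewrite -card_gt0 ti.
Qed.

Lemma compat_ext i (f : cochain G i) : coboundary f = 0 -> compat H (ext f).
Proof.
move=> f0; apply/compatP => K KH; apply/closed_onP => s sK.
have [si|si] := eqVneq #|s| i.+2; last first.
  apply/eqP; apply: contraNT si => /(degreeP _ _ (degree_cobd (degree_ext f))) ->.
  by rewrite eqxx.
have sP : (s \in G) && (#|s| == i.+2).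
  by rewrite si eqxx andbT (covered_in_complex KH sK) // -card_gt0 si.
by rewrite -[s]/(val (Sub s sP : simplex G i.+1)) -coboundary_ext f0 ffunE.
Qed.

Lemma cocycle_res i F : compat H F -> coboundary (res G i F : cochain G i) = 0.
Proof.
move=> /compatP cF; apply/ffunP => s; rewrite coboundary_res_complex [RHS]ffunE.
have /andP[sG /eqP si] := valP s.
have [|K KH sK] := in_complex_cover sG; first by rewrite si.
exact: (closed_onP _ _ (cF K KH)).
Qed.

Lemma connected_of_apex j : (0 < j)%N -> (j < k)%N -> (k < n)%N ->
  good_apex k j H ->
  (forall F, degree j.+1 F -> compat H F -> exists2 h, degree j h &
     forall K s, K \in H -> s \subset K -> F s = cobd h s) ->
  cohomologically_connected G j.
Proof.
move=> j0 jk kn ga top; have jkn : (j <= k < #|'I_n|)%N by rewrite card_ord kn ltnW.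
have low i (f : cochain G i) : (i < j)%N -> coboundary f = 0 ->
    exists2 h, degree i h & cobd h = ext f.
  move=> ij f0; apply: (low_acyclic ga jkn ij (degree_ext f)) => s _ [K KH sK].
  by have /compatP/(_ K KH)/closed_onP := compat_ext f0; apply.
apply/connectedE => //; split.
  pose one : cochain G 0 := [ffun=> 1].
  have G1 v : ([set v]%SET \in G) && (#|[set v]%SET| == 1%N).
    by rewrite mem_complex_at cards1.
  have n0 : (0 < n)%N by apply: leq_ltn_trans kn.
  pose v0 : simplex G 0 := Sub [set Ordinal n0]%SET (G1 _).
  have -> : cocycles G 0 = [set 0; one]%SET :> {set cochain G 0}.
    apply/finset.setP => f; apply/cocyclesP/set2P => [f0|].
      (* A primitive of a 0-cocycle lives on the empty set alone, so the cocycle is constant. *)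
      have [h dh hf] := low 0%N f j0 f0.
      have fE (s : simplex G 0) : f s = h finset.set0.
        rewrite -ext_val -hf (cobd_faces (m := 0) h); last by apply/eqP; case/andP: (valP s).
        rewrite (big_pred1 finset.set0) // => t /=; rewrite cards_eq0.
        by have [->|_] := eqVneq t finset.set0; rewrite ?finset.sub0set ?andbF.
      have [h0|h1] := eqVneq (h finset.set0) 0.
        by left; apply/ffunP => s; rewrite fE h0 ffunE.
      by right; apply/ffunP => s; rewrite fE (neq0_F2 h1) ffunE.
    move=> [->|->]; apply/ffunP => s; rewrite [RHS]ffunE.
      by rewrite ffunE big1 // => t _; rewrite ffunE.
    have /andP[sG /eqP s2] := valP s.
    rewrite (_ : one = res G 0 (cobd (ind [set finset.set0]%SET))).
      by rewrite coboundary_res_complex cobdK ffunE.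
    apply/ffunP => t; rewrite !ffunE; have /andP[_ /cards1P[x ->]] := valP t.
    by rewrite big_set1 ffunE inE finset.setDv eqxx.
  rewrite cards2; case: eqP => // /ffunP/(_ v0); rewrite !ffunE => E.
  by have := oner_neq0 'F_2; rewrite -E eqxx.
move=> i; rewrite leq_eqVlt => /orP[/eqP[ij]|ij] f f0; last first.
  have [h dh hf] := low i.+1 f ij f0; exists (res G i h); apply/ffunP => s.
  by rewrite coboundary_res_complex hf ext_val.
have := top (ext f); rewrite -ij => -[|| h dh hf]; [exact: degree_ext|exact: compat_ext|].
exists (res G i h); apply/ffunP => s; rewrite coboundary_res_complex -ext_val.
have /andP[sG /eqP si] := valP s.
have [|K KH sK] := in_complex_cover sG; first by rewrite si.
by rewrite (hf K).
Qed.

Lemma not_connected_of_copy j K C J : (0 < j)%N -> (j < k)%N ->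
  copy_of_M k j G K C J -> ~ cohomologically_connected G j.
Proof.
move=> j0 jk [[KG Kk] [CK Cj] iso [JG [Jj Jev]] J1] /connectedE[] // _.
case: j j0 jk Cj Jj Jev => // i _ ik Cj Jj Jev /(_ i (ltnSn _)) exact.
have KH : K \in H.
  have [|K' K'H KK'] := in_complex_cover KG; first by rewrite Kk; lia.
  rewrite (_ : K = K') //; apply/eqP; rewrite eqEcard KK' Kk.
  by rewrite (born_uniform K'H) leqnn.
pose F := ind (petals K C).
have cF : compat H F.
  have -> : F = ind (\bigcup_(K' in [set K]%SET) petals K' C)%SET by rewrite big_set1.
  apply: (compat_petals (c := fun=> C)) => K' /set1P ->; split=> // s sF.
  have sK := petals_sub CK sF; split => //; apply/finset.setP => K''.
  rewrite finset.in_set1; apply/setIdP/eqP => [[K''H sK'']|->]; last by split.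
  have Kk'' : #|K''| = k.+1 := born_uniform K''H.
  have KG'' : K'' \in G by apply: covered_in_complex (K''H) _ _; rewrite // -card_gt0 Kk''.
  exact: iso sF KG'' Kk'' sK''.
have [h hF] := exact _ (cocycle_res i.+1 cF).
have := sum_cobd_even (ext h) Jj Jev.
rewrite (eq_bigr (fun s => F s)); last first.
  move=> s sJ; have sP : (s \in G) && (#|s| == i.+2) by rewrite (fintype.subsetP JG) // Jj ?eqxx.
  rewrite -[s]/(val (Sub s sP : simplex G i.+1)) -coboundary_ext hF.
  by rewrite ffunE.
under eq_bigr => s _ do rewrite ffunE.
rewrite -natr_sum -big_mkcondr sum1dep_card.
rewrite (_ : #|_| = 1%N); first by move=> /eqP; rewrite oner_eq0.
by rewrite -J1; apply: eq_card => s; rewrite !inE.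
Qed.

End ComplexAt.

(** * Isolated flowers, copies of M_j and the hitting time *)

Section HittingTime.
Context (R : realType) (k n : nat) (c : hyperedge k n -> R).
Implicit Types (s t K C : {set 'I_n}) (F h : {ffun {set 'I_n} -> 'F_2}).
Implicit Types (H S W : {set {set 'I_n}}) (p q : R).

(** A petal determines its hyperedge, so the sums of flowers over different subsets of [W] are
    different cocycles, [2 ^ #|W|] of them. *)
Lemma not_connected_of_hosts i j p W (cc : {set 'I_n} -> {set 'I_n}) :
  (0 < j)%N -> (i <= j)%N -> (i < k)%N ->
  (forall K, K \in W -> [/\ K \in born c p, cc K \subset K, #|cc K| = i &
     isolated_in (born c p) K (petals K (cc K))]) ->
  (n ^ i < #|W|)%N -> ~ cohomologically_connected (complex_at c p) j.
Proof.
move=> j0 ij ik HW big /connectedE[] // c2 exact.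
set G := complex_at c p in c2 exact *.
pose f (A : {set {set 'I_n}}) : cochain G i :=
  res G i (ind (\bigcup_(K in A) petals K (cc K))%SET).
have fZ A : A \in powerset W -> f A \in cocycles G i.
  rewrite inE => /fintype.subsetP AW; apply/cocyclesP/cocycle_res.
  by apply: compat_petals => K /AW/HW[].
have finj : {in powerset W &, injective f}.
  have half (A B : {set {set 'I_n}}) : A \subset W -> B \subset W -> f A = f B -> A \subset B.
    move=> /fintype.subsetP AW /fintype.subsetP BW fAB; apply/fintype.subsetP => K KA.
    have [KH cK ci iso] := HW K (AW K KA).
    have Kk : #|K| = k.+1 := born_uniform KH.
    have /card_gt0P[s sK] : (0 < #|petals K (cc K)|)%N.
      by rewrite card_petals // Kk ci subn_gt0 ltnW.
    have [sub /finset.setP cov] := iso s sK.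
    have si : #|s| = i.+1 by rewrite (petals_size sK) ci.
    have sP : (s \in G) && (#|s| == i.+1).
      by rewrite si eqxx andbT (covered_in_complex KH sub) // -card_gt0 si.
    have /ffunP/(_ (Sub s sP)) := fAB; rewrite !ffunE SubK.
    have -> : s \in (\bigcup_(K in A) petals K (cc K))%SET by apply/bigcupP; exists K.
    case: (boolP (s \in _)) => [/bigcupP[K' K'B sK'] _|_ /eqP]; last by rewrite oner_eq0.
    have [K'H cK' ci' iso'] := HW K' (BW K' K'B).
    have := cov K'; rewrite finset.in_set1; case: eqP => [<- //|_ /negbT].
    by rewrite finset.in_set K'H (petals_sub cK' sK').
  move=> A B; rewrite !inE => AW BW fAB; apply/eqP.
  by rewrite finset.eqEsubset; apply/andP; split; apply: half.
have le : (2 ^ #|W| <= #|cocycles G i|)%N.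
  rewrite -card_powerset -(card_in_imset finj); apply/subset_leq_card/fintype.subsetP.
  by move=> _ /imsetP[A AW ->]; apply: fZ.
case: i ij ik HW big f fZ finj le => [|i] ij ik HW big f fZ finj le.
  (* For [i = 0] the hypothesis gives at least two hyperedges, hence at least 4 cocycles, where
     connectedness allows 2. *)
  rewrite expn0 in big.
  by move: le; rewrite c2 -[X in (_ <= X)%N](expn1 2) leq_exp2l // leqNgt big.
have le2 : (#|cocycles G i.+1| <= #|{: cochain G i}|)%N.
  apply: leq_trans (leq_imset_card (@coboundary _ G i) _).
  apply/subset_leq_card/fintype.subsetP => g /cocyclesP/exact[//|h <-].
  exact: imset_f.
move: (leq_trans le le2); rewrite card_ffun card_ord leq_exp2l // leqNgt.
case/negP; apply: leq_ltn_trans big; apply: leq_trans (bin_le_expn _ _).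
rewrite -[n in 'C(n, _)]card_ord -card_draws.
rewrite -(card_imset _ val_inj); apply/subset_leq_card/fintype.subsetP.
by move=> _ /imsetP[s _ ->]; rewrite inE; have /andP[] := valP s.
Qed.

(** Unlike [isolated_in] this does not ask that [K] be in [H], and it is antitone in [H]: it passes
    to earlier times, even to those before the birth of [K]. *)
Definition lonely H K S := forall s K', s \in S -> K' \in H -> s \subset K' -> K' = K.

Lemma lonely_mono H H' K S S' : H' \subset H -> S' \subset S -> lonely H K S ->
  lonely H' K S'.
Proof.
move=> /fintype.subsetP HH /fintype.subsetP SS lo s K' /SS sS /HH K'H.
exact: lo sS K'H.
Qed.

(** Apexes at time [pa] remain apexes, so from [pa] on a lonely flower of a born hyperedge is enough
    for a copy. *)
Lemma copy_of_lonely j pa p K C : good_apex k j (born c pa) -> pa <= p ->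
  (0 < j)%N -> (j < k)%N -> K \in born c p -> C \subset K -> #|C| = j ->
  lonely (born c p) K (petals K C) ->
  exists J, copy_of_M k j (complex_at c p) K C J.
Proof.
move=> ga pap j0 jk KH CK Cj lo; have Kk : #|K| = k.+1 := born_uniform KH.
have ga' : good_apex k j (born c p).
  move=> K' t K'k tK' tj; have [v vK cov] := ga K' t K'k tK' tj.
  exists v => // u /cov[K1 K1H sub]; exists K1 => //.
  exact: (fintype.subsetP (born_mono c pap)) K1H.
have [s [sj cov one]] := apex_cycle ga' jk KH Kk CK Cj.
exists (faces j.+1 s); split=> //.
- by split=> //; apply: covered_in_complex (KH) _ _; rewrite // -card_gt0 Kk.
- move=> t K' tF K'G K'k tK'; apply: lo tF _ tK'.
  have [|K1 K1H sub] := in_complex_cover K'G; first by rewrite K'k; lia.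
  rewrite (_ : K' = K1) //; apply/eqP; rewrite eqEcard sub K'k.
  by rewrite (born_uniform K1H) leqnn.
- split.
    apply/fintype.subsetP => t tF; have [K1 K1H sub] := cov t tF.
    apply: covered_in_complex K1H sub _; rewrite -card_gt0.
    by move: tF; rewrite inE => /andP[_ /eqP ->].
  split; first by move=> t; rewrite inE => /andP[_ /eqP].
  by move=> t tj; apply: faces_even.
Qed.

Lemma lonely_of_copy j p K C J : (0 < j)%N -> (j < k)%N ->
  copy_of_M k j (complex_at c p) K C J ->
  [/\ K \in born c p, C \subset K, #|C| = j & lonely (born c p) K (petals K C)].
Proof.
move=> j0 jk [[KG Kk] [CK Cj] iso _ _]; split=> //.
  have [|K1 K1H sub] := in_complex_cover KG; first by rewrite Kk; lia.
  rewrite (_ : K = K1) //; apply/eqP; rewrite eqEcard sub Kk.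
  by rewrite (born_uniform K1H) leqnn.
move=> s K' sF K'H sK'; have K'k : #|K'| = k.+1 := born_uniform K'H.
have K'G : K' \in complex_at c p.
  by apply: covered_in_complex (K'H) _ _; rewrite // -card_gt0 K'k.
exact: iso sF K'G K'k sK'.
Qed.

Lemma exists_subset_card (A : {set {set 'I_n}}) x m : x \in A -> (0 < m <= #|A|)%N ->
  exists B : {set {set 'I_n}}, [/\ B \subset A, x \in B & #|B| = m].
Proof.
case: m => // m xA /= mA.
have [B] : exists B, B \in [set B : {set {set 'I_n}} | (B \subset A :\ x) && (#|B| == m)]%SET.
  apply/card_gt0P; rewrite cards_draws bin_gt0.
  by have := cardsD1 x A; rewrite xA add1n => E; rewrite -ltnS -E.
rewrite inE => /andP[BA /eqP Bm]; exists (x |: B)%SET; split.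
- rewrite finset.subUset finset.sub1set xA /=.
  by apply: fintype.subset_trans BA _; apply: finset.subD1set.
- exact: finset.setU11.
- rewrite cardsU1 Bm; case: (boolP (x \in B)) => // /(fintype.subsetP BA).
  by rewrite !inE eqxx.
Qed.

Variables (j : nat) (pa pm pp pB : R).
Hypotheses (j0 : (0 < j)%N) (jk : (j < k)%N) (kn : (k < n)%N).
Hypotheses (pa0 : 0 <= pa) (pam : pa <= pm) (pmp : pm < pp) (ppB : pp <= pB).
Hypothesis pp1 : pp < 1.
Hypothesis apex : good_apex k j (born c pa).
Hypothesis base : forall F, degree j.+1 F -> compat (born c pm) F ->
  almost_trivial j (born c pm) F.
(** The first three conditions exclude k - j + 1 lonely faces in a hyperedge born after [pm], by
    range of birth: up to [pp] the birth probability is [pp - pm], up to [pB] it is [pB], and beyond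
    that none is used. [lonely2] also ends the loneliness of older hyperedges by [pp]; [lonely4]
    leaves those of time [pm] no more lonely faces than a flower has. *)
Hypothesis lonely1 : forall K S, K \in born c pp -> K \notin born c pm ->
  S \subset faces j.+1 K -> #|S| = (k - j + 1)%N -> ~ lonely (born c pm) K S.
Hypothesis lonely2 : forall K S, K \in born c pB ->
  S \subset faces j.+1 K -> #|S| = (k - j + 1)%N -> ~ lonely (born c pp) K S.
Hypothesis lonely3 : forall K S, #|K| = k.+1 ->
  S \subset faces j.+1 K -> #|S| = (k - j + 1)%N -> ~ lonely (born c pB) K S.
Hypothesis lonely4 : forall K S, K \in born c pm ->
  S \subset faces j.+1 K -> #|S| = (k - j + 2)%N -> ~ lonely (born c pm) K S.
Hypothesis no_merging : forall K0 K S t t', K0 \in born c pm -> K \in born c pp ->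
  K \notin born c pm -> S \subset faces j.+1 K0 -> #|S| = (k - j + 1)%N ->
  t \in S -> t \subset K -> t' \in faces j.+1 K -> ~~ (t' \subset K0) ->
  ~ (lonely (born c pm) K0 S /\ light (born c pm) t').
Hypothesis early : exists K C, [/\ K \in born c pa, C \subset K, #|C| = j &
  lonely (born c pm) K (petals K C)].

(** Comparing [c e] with [pp] and [pB] selects the condition to use, always at a time before [c e].
    Only hyperedges born strictly before [e] have to be in [H], so coinciding births do no harm. *)
Lemma not_late H (e : hyperedge k n) S : (forall e', c e' < c e -> val e' \in H) ->
  S \subset faces j.+1 (val e) -> #|S| = (k - j + 1)%N -> lonely H (val e) S ->
  c e <= pm.
Proof.
move=> low SF Sr lo; rewrite leNgt; apply/negP => late.
have lo' q : q < c e -> lonely (born c q) (val e) S.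
  move=> qe; apply: lonely_mono lo => //; apply/fintype.subsetP => K; rewrite inE.
  by move=> /existsP[e' /andP[/eqP <- e'q]]; apply/low/(le_lt_trans e'q).
have [eB|Be] := leP (c e) pB; last first.
  by case: (lonely3 (eqP (valP e)) SF Sr (lo' _ Be)).
have [ep|pe] := leP (c e) pp; last first.
  by apply: (lonely2 _ SF Sr (lo' _ pe)); rewrite bornE.
by apply: (lonely1 _ _ SF Sr (lo' _ late)); rewrite bornE // -ltNge.
Qed.

Lemma not_late_born p K S : K \in born c p -> S \subset faces j.+1 K ->
  #|S| = (k - j + 1)%N -> lonely (born c p) K S -> K \in born c pm.
Proof.
rewrite {1}inE => /existsP[e /andP[/eqP <- ep]] SF Sr lo; rewrite bornE.
by apply: not_late SF Sr lo => e' /ltW/le_trans-/(_ _ ep); rewrite bornE.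
Qed.

Lemma petals_faces K C : C \subset K -> #|C| = j -> petals K C \subset faces j.+1 K.
Proof.
move=> CK Cj; apply/fintype.subsetP => s sF.
by rewrite inE (petals_sub CK sF) (petals_size sF) Cj eqxx.
Qed.

Lemma card_petals_top K C : #|K| = k.+1 -> C \subset K -> #|C| = j ->
  #|petals K C| = (k - j + 1)%N.
Proof. by move=> Kk CK Cj; rewrite card_petals // Kk Cj subSn ?addn1 // ltnW. Qed.

Lemma copy_born p K C J : copy_of_M k j (complex_at c p) K C J ->
  [/\ K \in born c pm, C \subset K, #|C| = j & lonely (born c p) K (petals K C)].
Proof.
move=> /(lonely_of_copy j0 jk)[KH CK Cj lo]; split=> //.
apply: (not_late_born KH (petals_faces CK Cj) _ lo).
by rewrite card_petals_top // (born_uniform KH).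
Qed.

Lemma no_copy_after p K C J : pp <= p -> ~ copy_of_M k j (complex_at c p) K C J.
Proof.
move=> pple /copy_born[KH CK Cj lo].
apply: (lonely2 (K := K) (S := petals K C)).
- by apply: (fintype.subsetP (born_mono c _)) KH; apply: le_trans ppB; apply: ltW.
- exact: petals_faces.
- by rewrite card_petals_top // (born_uniform KH).
- exact: lonely_mono (born_mono c pple) _ lo.
Qed.

Let copies := [set p : R | 0 <= p <= 1 /\
    exists K C J, copy_of_M k j (complex_at c p) K C J]%classic.

Let copies_ub : ubound copies 1. Proof. by move=> p [/andP[]]. Qed.

Lemma copy_until p : pa <= p -> p <= pm ->
  exists K C J, copy_of_M k j (complex_at c p) K C J.
Proof.
move=> pap ppm; have [K [C [KH CK Cj lo]]] := early; exists K, C.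
apply: (copy_of_lonely apex pap) => //.
  exact: (fintype.subsetP (born_mono c pap)) KH.
exact: lonely_mono (born_mono c ppm) _ lo.
Qed.

Lemma pm_le_p_M : pm <= p_M j c.
Proof.
apply: ub_le_sup; first by exists 1; apply: copies_ub.
split; last exact: copy_until.
by rewrite (le_trans pa0) //= (le_trans (ltW pmp)) // ltW.
Qed.

Lemma p_M_le_pp : p_M j c <= pp.
Proof.
apply: ge_sup.
  exists pm; split; last exact: copy_until.
  by rewrite (le_trans pa0) //= (le_trans (ltW pmp)) // ltW.
move=> p [_ [K [C [J copy]]]]; rewrite leNgt; apply/negP => /ltW pple.
exact: no_copy_after pple copy.
Qed.

(** Having a copy is not monotone in [p]. But the hyperedge of a copy at some [q > p] was born by
    [pm], and its flower is lonely at [p] too, so for [pm < p] it already gives a copy at [p]. *)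
Lemma not_connected_before p : pa <= p -> p < p_M j c ->
  ~ cohomologically_connected (complex_at c p) j.
Proof.
move=> pap plt; have [K [C [J copy]]] : exists K C J, copy_of_M k j (complex_at c p) K C J.
  have [ppm|pmlt] := leP p pm; first exact: copy_until.
  have hs : has_sup copies.
    split; last by exists 1; apply: copies_ub.
    exists pm; split; last exact: copy_until.
    by rewrite (le_trans pa0) //= (le_trans (ltW pmp)) // ltW.
  have eps0 : 0 < p_M j c - p by rewrite subr_gt0.
  have [q [_ [K [C [J copy]]]] pq] := sup_adherent eps0 hs.
  rewrite subKr in pq.
  have [KH CK Cj lo] := copy_born copy; exists K, C.
  apply: (copy_of_lonely apex pap) => //.
    exact: (fintype.subsetP (born_mono c (ltW pmlt))) KH.
  exact: lonely_mono (born_mono c (ltW pq)) _ lo.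
exact: not_connected_of_copy copy.
Qed.

(** For the time [p_M] itself: a copy present there would persist for a while, against the supremum.
    Here [m] is the next birth time, or 1 if none comes before. *)
Lemma born_right_constant p : p < 1 ->
  exists q, [/\ p < q, q <= 1 & born c q = born c p].
Proof.
move=> p1; pose m := \big[Order.min/1]_(e | p < c e) c e.
have pm' : p < m by apply: lt_bigmin.
have m1 : m <= 1 by apply: bigmin_le_id.
exists ((p + m) / 2); split; [by lra|by lra|].
apply/finset.setP => K; rewrite !inE; apply/existsP/existsP => -[e /andP[eK ep]];
  exists e; rewrite eK /=; last by lra.
rewrite leNgt; apply/negP => pe; have : m <= c e by apply: bigmin_le_cond.
by lra.
Qed.

Lemma complex_at_born p q : born c q = born c p -> complex_at c q = complex_at c p.
Proof. by move=> E; apply/finset.setP => s; rewrite !mem_complex_at E. Qed.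

Lemma no_copy_from p K C J : 0 <= p -> p_M j c <= p ->
  ~ copy_of_M k j (complex_at c p) K C J.
Proof.
move=> p0 pMp copy.
have pple : p < pp by rewrite ltNge; apply/negP => /no_copy_after/(_ copy).
have [q [pq q1 bq]] := born_right_constant (lt_trans pple pp1).
have : q <= p_M j c.
  apply: ub_le_sup; first by exists 1; apply: copies_ub.
  split; first by rewrite q1 (le_trans p0) // ltW.
  by exists K, C, J; rewrite (complex_at_born bq).
by rewrite leNgt (le_lt_trans pMp).
Qed.

(* The hyperedges born after [pm] are added in the order of their births. *)
Lemma almost_trivial_stage H : uniform k.+1 H -> born c pm \subset H ->
  (forall e e' : hyperedge k n, val e \in H -> val e' \notin H -> c e <= c e') ->
  forall F, degree j.+1 F -> compat H F -> almost_trivial j H F.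
Proof.
have [m] := ubnP #|H :\: born c pm|%SET; elim: m H => // m IH H mH uH subH stage F dF cF.
have [E|] := eqVneq (H :\: born c pm)%SET finset.set0.
  have HE : H = born c pm.
    apply/eqP; rewrite finset.eqEsubset subH andbT.
    by rewrite -finset.setD_eq0 E.
  by rewrite HE in cF *; apply: base.
move=> /set0Pn[K1 K1D].
have K1P : #|K1| == k.+1 by rewrite uH //; move: K1D; rewrite inE => /andP[].
pose late := [pred e : hyperedge k n | val e \in (H :\: born c pm)%SET].
have late1 : late (Sub K1 K1P) := K1D.
have [e /= eD emax] := arg_maxP c late1.
have [eH eb] : val e \in H /\ val e \notin born c pm.
  by move: eD; rewrite inE => /andP[].
have epm : pm < c e by rewrite ltNge -bornE.
set K := val e in eD eH eb.
have HE : (K |: (H :\ K))%SET = H by apply: finset.setD1K.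
have lowH e' : c e' < c e -> val e' \in (H :\ K)%SET.
  move=> lt; rewrite !inE; apply/andP; split.
    by apply: contraTneq lt => /val_inj ->; rewrite ltxx.
  by apply: contraTT lt => e'H; rewrite -leNgt; apply: stage.
have subHK : born c pm \subset (H :\ K)%SET.
  apply/fintype.subsetP => K'; rewrite inE => /existsP[e' /andP[/eqP <- e'p]].
  by apply/lowH/(le_lt_trans e'p).
have uHK : uniform k.+1 (H :\ K)%SET by move=> K'; rewrite inE => /andP[_ /uH].
have ek : forall e' : hyperedge k n, val e' \in (H :\ K)%SET -> c e' <= c e.
  move=> e' e'H; have [e'b|e'b] := boolP (val e' \in born c pm).
    by rewrite bornE in e'b; apply: le_trans e'b (ltW epm).
  by apply: emax; rewrite /= inE e'b; move: e'H; rewrite inE => /andP[].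
rewrite -HE; apply: (almost_trivial_add (k := k)); rewrite ?HE //.
- by rewrite !inE eqxx.
- exact: ltnW.
- move=> [K0 [S [t [t' [[K0H Sj Sr iso] [[tS tK] t'j t'K t'K0 li]]]]]].
  have [S' [S'S tS' S'r]] : exists B : {set {set 'I_n}},
      [/\ B \subset S, t \in B & #|B| = (k - j + 1)%N].
    by apply: exists_subset_card => //; rewrite addn1.
  have S'F : S' \subset faces j.+1 K0.
    apply/fintype.subsetP => s /(fintype.subsetP S'S) sS; rewrite inE Sj // eqxx andbT.
    by have [] := iso s sS.
  have lo : lonely (H :\ K)%SET K0 S'.
    move=> s K' /(fintype.subsetP S'S) sS K'H sK'.
    have [_ /finset.setP/(_ K')] := iso s sS.
    by rewrite finset.in_set1 finset.in_set K'H sK' => /esym/eqP.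
  have K0k : #|K0| == k.+1 by rewrite uHK.
  have K0E : K0 = val (Sub K0 K0k : hyperedge k n) by rewrite SubK.
  (* [K] is a latest member of [H], so everything born before [K0] is in [H :\ K], and [not_late]
     applies. *)
  have K0b : K0 \in born c pm.
    rewrite K0E bornE; apply: (not_late (H := (H :\ K)%SET) (S := S')); rewrite -?K0E //.
    move=> e' lt; apply: lowH; apply: lt_le_trans lt _; apply: ek.
    by rewrite -K0E.
  (* If [K] came after [pp], then [K0] would have stayed lonely until [pp]. *)
  have [epp|ppe] := leP (c e) pp; last first.
    apply: (lonely2 (K := K0) (S := S')) => //.
      by apply: (fintype.subsetP (born_mono c _)) K0b; apply: le_trans ppB; apply: ltW.
    apply: lonely_mono lo => //; apply/fintype.subsetP => K'; rewrite inE.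
    by move=> /existsP[e' /andP[/eqP <- e'p]]; apply/lowH/(le_lt_trans e'p).
  apply: (no_merging K0b _ eb S'F S'r tS' tK _ t'K0).
  + by rewrite bornE.
  + by rewrite inE t'K t'j eqxx.
  + split; first exact: lonely_mono subHK _ lo.
    apply: leq_trans li; apply/subset_leq_card/fintype.subsetP => K'.
    move=> /setIdP[K'b t'K']; apply/setIdP; split=> //.
    exact: (fintype.subsetP subHK).
- apply: IH => //.
  + rewrite -ltnS (leq_trans _ mH) // ltnS; apply: proper_card; rewrite properE; apply/andP; split.
      apply/fintype.subsetP => K'; rewrite !finset.in_setD finset.in_set1.
      by move=> /and3P[-> _ ->].
    by apply/fintype.subsetPn; exists K; rewrite // !inE eqxx !andbF.
  + move=> e1 e2 e1H; rewrite inE negb_and negbK => /orP[/set1P/val_inj ->|].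
      exact: ek.
    by move=> e2H; apply: stage e2H; move: e1H; rewrite inE => /andP[].
  + apply/compatP => K' K'H; move/compatP: cF; apply.
    by move: K'H; rewrite inE => /andP[].
Qed.

Lemma connected_from p : 0 <= p -> p_M j c <= p ->
  cohomologically_connected (complex_at c p) j.
Proof.
move=> p0 pMp; have pmple : pm <= p := le_trans pm_le_p_M pMp.
apply: connected_of_apex => //.
  move=> K' t K'k tK' tj; have [v vK cov] := apex K'k tK' tj.
  exists v => // u /cov[K1 K1H sub]; exists K1 => //.
  exact: (fintype.subsetP (born_mono c (le_trans pam pmple))) K1H.
move=> F dF cF; have : almost_trivial j (born c p) F.
  apply: almost_trivial_stage => //.
  - exact: born_uniform.
  - exact: born_mono.
  - by move=> e e'; rewrite !bornE -ltNge => ep /ltW; apply: le_trans.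
move=> /almost_trivialP[h dh fh]; exists h => // K s KH sK.
set g := F + cobd h in fh.
have dg : degree j.+1 g by rewrite degreeD // degree_cobd.
have cg : closed_on K g.
  have : compat (born c p) g by rewrite compatD // compat_cobd.
  by move/compatP; apply.
have [|gs] := eqVneq (g s) 0.
  rewrite ffunE => E.
  by rewrite -[LHS]addr0 -(addrr_F2 (cobd h s)) addrA E add0r.
exfalso; have Kk : #|K| = k.+1 := born_uniform KH.
have sz x : g x != 0 -> #|x| = j.+1 by move/degreeP: dg => /(_ x).
have sS : s \in supp_in K g by rewrite inE sK.
have big : (k - j + 1 <= #|supp_in K g|)%N.
  by have := card_supp_in cg sK gs; rewrite Kk sz // subSS addn1.
have SF : supp_in K g \subset faces j.+1 K.
  by apply/fintype.subsetP => x; rewrite !inE => /andP[-> /sz ->]; rewrite eqxx.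
have lo : lonely (born c p) K (supp_in K g).
  move=> x K'; rewrite inE => /andP[xK gx] K'H xK'.
  have := fh x gx; rewrite /light => /card_le1P/(_ K); rewrite finset.in_set KH xK.
  by move=> /(_ isT)/(_ K'); rewrite finset.in_set K'H xK' !inE => /esym/eqP.
have sub_lonely m : (0 < m <= #|supp_in K g|)%N -> exists S,
    [/\ S \subset faces j.+1 K, #|S| = m & lonely (born c p) K S].
  move=> /(exists_subset_card sS)[S [SS _ Sm]]; exists S; split=> //.
    exact: fintype.subset_trans SF.
  exact: lonely_mono lo.
have Kb : K \in born c pm.
  have [|S [SK Sr Slo]] := sub_lonely (k - j + 1)%N; first by rewrite big addn1.
  exact: not_late_born KH SK Sr Slo.
have [small|large] := leqP #|supp_in K g| (k - j + 1); last first.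
  have [|S [SK Sr Slo]] := sub_lonely (k - j + 2)%N; first by rewrite addnS.
  apply: (lonely4 Kb SK Sr); exact: lonely_mono (born_mono c pmple) _ Slo.
have [C [CK Cj] SE] := least_cocycle_petals jk Kk (sz s gs) cg sK gs small.
rewrite SE in lo.
have [J copy] := copy_of_lonely apex (le_trans pam pmple) j0 jk KH CK Cj lo.
exact: no_copy_from p0 pMp copy.
Qed.

End HittingTime.

(** * Estimates for binomial coefficients and exponentials *)

Lemma expn_le_bin n a m : (n ^ m <= 'C(n - a, m) * m`! + m * (a + m) * n ^ m.-1)%N.
Proof.
rewrite bin_ffact; elim: m => [|m IH]; first by rewrite ffactn0 expn0 leq_addr.
have ff : ((n - a) ^_ m <= n ^ m)%N.
  elim: m {IH} => [|m IH]; first by rewrite ffactn0 expn0.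
  by rewrite ffactnSr expnSr leq_mul // -subnDA leq_subr.
rewrite [m.+1.-1]/= expnSr ffactnSr.
apply: leq_trans (leq_mul IH (leqnn n)) _; rewrite mulnDl.
have -> : (m * (a + m) * n ^ m.-1 * n = m * (a + m) * n ^ m)%N.
  by case: m {IH ff} => [|m] //; rewrite -mulnA -expnSr.
have : ((n - a) ^_ m * n <= (n - a) ^_ m * (n - a - m) + n ^ m * (a + m))%N.
  apply: (@leq_trans ((n - a) ^_ m * ((n - a - m) + (a + m)))).
    by rewrite leq_mul2l -subnDA; apply/orP; right; lia.
  by rewrite mulnDr leq_add2l leq_mul2r ff orbT.
nia.
Qed.

Section Bounds.
Variable R : realType.
Implicit Types (x y p q : R).

Lemma onem_expR_le q m : 0 <= q <= 1 -> (1 - q) ^+ m <= expR (- (q * m%:R)).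
Proof.
move=> /andP[q0 q1]; rewrite mulrC -mulrN expRM_natl.
by apply: lerXn2r; rewrite ?nnegrE ?expR_ge0 ?subr_ge0 // expR_ge1Dx.
Qed.

(** [(1 - q) * (1 + q + 2 * q ^+ 2)] equals [1 + q ^+ 2 * (1 - 2 * q)], which is at least 1. *)
Lemma expR_le_onem q m : 0 <= q <= 1 / 2 ->
  expR (- (q * m%:R) - 2 * q ^+ 2 * m%:R) <= (1 - q) ^+ m.
Proof.
move=> /andP[q0 q2].
have -> : - (q * m%:R) - 2 * q ^+ 2 * m%:R = m%:R * (- (q + 2 * q ^+ 2)) by ring.
rewrite expRM_natl; apply: lerXn2r; rewrite ?nnegrE ?expR_ge0 //; first by lra.
rewrite expRN; have h : 1 + (q + 2 * q ^+ 2) <= expR (q + 2 * q ^+ 2) by apply: expR_ge1Dx.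
have e0 : 0 < expR (q + 2 * q ^+ 2) by apply: expR_gt0.
rewrite -[leLHS]mul1r ler_pdivrMr //.
by nra.
Qed.

Lemma onem_expn_ge q m : 0 <= q <= 1 -> 1 - q * m%:R <= (1 - q) ^+ m.
Proof.
move=> /andP[q0 q1]; elim: m => [|m IH]; first by rewrite mulr0 subr0 expr0.
rewrite exprS; apply: (@le_trans _ _ ((1 - q) * (1 - q * m%:R))).
  rewrite -natr1; have := ler0n R m; nra.
by rewrite ler_wpM2l // subr_ge0.
Qed.

(** The leading term of the number of (k+1)-sets above an (i+1)-set. *)
Definition faces_count (k n i : nat) : R := n%:R ^+ (k - i) / (k - i)`!%:R.

Lemma bin_le_faces_count k n a i : ('C(n - a, k - i))%:R <= faces_count k n i.
Proof.
rewrite ler_pdivlMr ?ltr0n ?fact_gt0 // -natrM -natrX ler_nat bin_ffact.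
elim: (k - i)%N => [|m IH]; first by rewrite ffactn0 expn0.
by rewrite ffactnSr expnSr leq_mul // -subnDA leq_subr.
Qed.

Lemma faces_count_le_bin k n i : (i < k)%N ->
  faces_count k n i - (k * k.+1)%:R * n%:R ^+ (k - i - 1) <=
  ('C(n - i.+1, k - i))%:R.
Proof.
move=> ik; have f0 : (0 < (k - i)`!)%N by rewrite fact_gt0.
rewrite lerBlDr /faces_count ler_pdivrMr ?ltr0n // -natrX -natrX -natrM -natrD -natrM ler_nat.
apply: leq_trans (expn_le_bin n i.+1 (k - i)) _.
rewrite mulnDl leq_add2l subn1.
have -> : (i.+1 + (k - i) = k.+1)%N by rewrite addSn subnKC // ltnW.
by rewrite -[X in (X <= _)%N]muln1 leq_mul // leq_mul2r leq_mul2r leq_subr !orbT.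
Qed.

(** The lower-order terms, overlaps [a] and exceptions [z], shift the exponent by at most 1. This is
    the 1 in the later factors [expR (1 - _)]. *)
Lemma deficit_bound q s a z m pw h y : 0 <= q -> 1 <= pw -> 0 <= z -> a + z <= m ->
  q * m * pw <= 1 -> s - a * pw <= h -> h - z <= y -> q * s <= 1 + q * y.
Proof.
move=> q0 pw1 z0 am qm sh hy.
have pw0 : 0 <= pw by apply: le_trans pw1.
have zp : z <= z * pw by rewrite ler_peMr.
have le : s <= (a + z) * pw + y by lra.
apply: (@le_trans _ _ (q * ((a + z) * pw) + q * y)).
  by rewrite -mulrDr ler_wpM2l.
rewrite lerD2r; apply: le_trans qm; rewrite -mulrA ler_wpM2l //.
by rewrite ler_wpM2r.
Qed.

End Bounds.

Section UnionBounds.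
Context d (T : measurableType d) (R : realType) (P : probability T R).

Lemma union_card (I : finType) (Q : {set I}) (A : I -> set T) (B : set T) (m : nat) (beta : R) :
  measurable B -> (forall i, measurable (A i)) -> 0 <= beta -> (#|Q| <= m)%N ->
  (forall i, i \in Q -> prob P (A i) <= beta) ->
  (forall x, B x -> exists2 i, i \in Q & A i x) ->
  prob P B <= m%:R * beta.
Proof.
move=> mB mA b0 Qm Ab BA.
apply: (@le_trans _ _ (\sum_(i <- enum Q) prob P (A i))).
  apply: union_bound => // x /BA[i iQ Ai]; exists i => //.
  by rewrite mem_enum.
rewrite big_enum; apply: (@le_trans _ _ (\sum_(i in Q) beta)); first exact: ler_sum.
by rewrite sumr_const -[leLHS]mulr_natl ler_wpM2r // ler_nat.
Qed.

End UnionBounds.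

(** * First-moment bounds *)

Section FirstMoment.
Context (R : realType) (k n j : nat) d (T : measurableType d) (P : probability T R).
Variable b : hyperedge k n -> {RV P >-> R}.
Hypothesis hb : iid_uniform01 b.
Hypotheses (jk : (j < k)%N) (n0 : (0 < n)%N).
Implicit Types (X Y Z S U : {set {set 'I_n}}) (K s t : {set 'I_n}).

Local Notation B p x := (born (fun e => b e x) p).
Local Notation nu := (faces_count R k n j).

Lemma measurable_born4 (p1 p2 p3 p4 : R)
    (Q : {set {set 'I_n}} -> {set {set 'I_n}} -> {set {set 'I_n}} -> {set {set 'I_n}} -> Prop) :
  measurable [set x | Q (B p1 x) (B p2 x) (B p3 x) (B p4 x)].
Proof.
have m p : fin_measurable (fun x => B p x) by apply: fin_measurable_born.
pose Q' (u : {set {set 'I_n}} * {set {set 'I_n}} * ({set {set 'I_n}} * {set {set 'I_n}})) :=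
  Q u.1.1 u.1.2 u.2.1 u.2.2.
apply: (@fin_measurable_pred _ _ _ (fun x => ((B p1 x, B p2 x), (B p3 x, B p4 x))) Q').
by do !apply: fin_measurable_pair.
Qed.

Definition hit S := [set K : {set 'I_n} | (#|K| == k.+1) && [exists (s | s \in S), s \subset K]]%SET.

Lemma card_hit S : (forall s, s \in S -> #|s| = j.+1) ->
  #|S|%:R * nu - (#|S| * (k * k.+1) + #|S| * #|S|)%:R * n%:R ^+ (k - j - 1) <= #|hit S|%:R.
Proof.
move=> uS.
have h := card_exactly_one jk uS; rewrite card_ord in h.
have le : (#|S| * 'C(n - j.+1, k - j) <= #|hit S| + #|S| * #|S| * n ^ (k - j - 1))%N.
  apply: leq_trans h _; rewrite leq_add2r; apply/subset_leq_card/fintype.subsetP => K.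
  rewrite !inE => /andP[-> /cards1P[s /finset.setP/(_ s)]].
  by rewrite !inE eqxx => /andP[sS sK]; apply/exists_inP; exists s.
move: le; rewrite -(ler_nat R) natrD !natrM natrX => le.
have fc := ler_wpM2l (ler0n R #|S|) (faces_count_le_bin R n jk).
rewrite natrD !natrM mulrDl; rewrite mulrBr natrM in fc.
by apply: le_trans (_ : _ <= #|S|%:R * ('C(n - j.+1, k - j))%:R - #|S|%:R * #|S|%:R * n%:R ^+ (k - j - 1)) _; lra.
Qed.

(** About [#|S| * nu] hyperedges contain an element of [S], and all but those in [X0], [X1] and [Z]
    have to be absent at [q]. [Z] holds hyperedges whose birth is left open; [m] collects overlaps
    and exceptions, whose effect is bounded through [q * m%:R]. *)
Lemma first_moment X0 X1 Z S (p0 p1 p2 q : R) (m : nat) :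
  uniform k.+1 X0 -> uniform k.+1 X1 -> avoid X0 X1 ->
  (forall s, s \in S -> #|s| = j.+1) ->
  0 <= p0 <= 1 -> 0 <= p1 -> p1 <= p2 -> p2 <= 1 -> 0 <= q <= 1 ->
  (#|S| * (k * k.+1) + #|S| * #|S| + (#|X0| + #|X1| + #|Z|) <= m)%N ->
  q * m%:R * n%:R ^+ (k - j - 1) <= 1 ->
  prob P [set x | [/\ X0 \subset B p0 x, X1 \subset B p2 x, avoid X1 (B p1 x) &
      forall s K, s \in S -> K \in B q x -> s \subset K -> K \in X0 :|: X1 :|: Z]] <=
  p0 ^+ #|X0| * (p2 - p1) ^+ #|X1| * expR (1 - q * (#|S|%:R * nu)).
Proof.
move=> uX0 uX1 dX uS p001 p10 p12 p21 q01 mS qm.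
have [p00 _] := andP p001; have [q0 _] := andP q01.
pose Y := (hit S :\: (X0 :|: X1 :|: Z))%SET.
have uY : uniform k.+1 Y by move=> K; rewrite !inE => /and3P[_ /eqP].
have dX0Y : avoid X0 Y by move=> K KX; rewrite !inE KX.
have dX1Y : avoid X1 Y by move=> K KX; rewrite !inE KX orbT.
have := prob_cylinder hb uX0 uX1 uY dX dX0Y dX1Y p001 p10 p12 p21 q01.
set C := [set x | _]; move=> CE.
apply: (@le_trans _ _ (prob P C)).
  apply: le_prob.
  - exact: (measurable_born4 p0 p2 p1 q (fun H0 H2 H1 Hq => [/\ X0 \subset H0, X1 \subset H2,
      avoid X1 H1 & forall s K, s \in S -> K \in Hq -> s \subset K -> K \in (X0 :|: X1 :|: Z)%SET])).
  - exact: (measurable_born4 p0 p2 p1 q (fun H0 H2 H1 Hq => [/\ X0 \subset H0, X1 \subset H2,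
      avoid X1 H1 & avoid Y Hq])).
  move=> x /= [s0 s2 s1 sq]; split=> // K; rewrite finset.in_setD => /andP[nX KS].
  apply: contra nX => KB; move: KS; rewrite finset.in_set => /andP[_ /exists_inP[s sS sK]].
  exact: sq sS KB sK.
rewrite CE; apply: ler_wpM2l.
  by rewrite mulr_ge0 ?exprn_ge0 // subr_ge0.
apply: le_trans (onem_expR_le _ q01) _; rewrite ler_expR lerNl opprB lerBlDl {C CE uX0 uX1 dX uY dX0Y dX1Y}.
have cY : #|hit S|%:R - (#|X0| + #|X1| + #|Z|)%:R <= #|Y|%:R :> R.
  rewrite lerBlDr -natrD ler_nat.
  have := cardsID (X0 :|: X1 :|: Z)%SET (hit S).
  have : (#|hit S :&: (X0 :|: X1 :|: Z)%SET| <= #|X0| + #|X1| + #|Z|)%N.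
    apply: leq_trans (subset_leq_card (finset.subsetIr _ _)) _.
    by rewrite (leq_trans (leq_card_setU _ _)) // leq_add2r leq_card_setU.
  by rewrite -/Y => h1 h2; rewrite -h2 addnC leq_add2l.
have hS := card_hit uS.
have n1 : 1 <= n%:R ^+ (k - j - 1) :> R by rewrite -natrX ler1n expn_gt0 n0.
set pw := n%:R ^+ (k - j - 1) in n1 hS qm.
have mR : (#|S| * (k * k.+1) + #|S| * #|S|)%:R + (#|X0| + #|X1| + #|Z|)%:R <= m%:R :> R.
  by rewrite -natrD ler_nat.
set a := (#|S| * _ + _)%:R in mR hS.
set z := (#|X0| + _ + _)%:R in mR cY.
have z0 : 0 <= z by apply: ler0n.
exact: deficit_bound q0 n1 z0 mR qm hS cY.
Qed.

Lemma card_hyperedges_le : (#|[set K : {set 'I_n} | #|K| == k.+1]%SET| <= n ^ k.+1)%N.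
Proof. by rewrite card_draws card_ord bin_le_expn. Qed.

Lemma card_up_le t : #|t| = j.+1 ->
  (#|[set K : {set 'I_n} | (t \subset K) && (#|K| == k.+1)]%SET| <= n ^ (k - j))%N.
Proof.
move=> tj; have := @card_supersets_le _ k.+1 t; rewrite tj card_ord subSS.
by apply; apply: ltnW.
Qed.

Lemma card_faces_le i K : #|K| = k.+1 -> (#|faces i K| <= 2 ^ k.+1)%N.
Proof.
move=> Kk; rewrite -Kk -card_powerset; apply/subset_leq_card/fintype.subsetP => s.
by rewrite !inE => /andP[].
Qed.

Lemma card_powerset_faces_le i K : #|K| = k.+1 ->
  (#|powerset (faces i K)| <= 2 ^ 2 ^ k.+1)%N.
Proof. by move=> Kk; rewrite card_powerset leq_exp2l // card_faces_le. Qed.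

(** The flags [u0] and [u1] select the birth condition imposed on [K], so that one union bound over
    [K] and [S] serves all the lonely events. *)
Lemma lonely_bound a (u0 u1 : bool) (p0 p1 p2 q : R) (m : nat) :
  ~~ (u0 && u1) -> 0 <= p0 <= 1 -> 0 <= p1 -> p1 <= p2 -> p2 <= 1 -> 0 <= q <= 1 ->
  (a * (k * k.+1) + a * a + 3 <= m)%N -> q * m%:R * n%:R ^+ (k - j - 1) <= 1 ->
  prob P [set x | exists K S, [/\ #|K| = k.+1, u0 -> K \in B p0 x,
      u1 -> K \in B p2 x /\ K \notin B p1 x, S \subset faces j.+1 K /\ #|S| = a &
      lonely (B q x) K S]] <=
  (n ^ k.+1)%:R * ((2 ^ 2 ^ k.+1)%:R * ((if u0 then p0 else 1) *
     (if u1 then p2 - p1 else 1) * expR (1 - q * (a%:R * nu)))).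
Proof.
move=> u01 p001 p10 p12 p21 q01 am qm; have [p00 _] := andP p001.
set beta := (X in _ * (_ * X)).
have beta0 : 0 <= beta.
  by rewrite !mulr_ge0 ?expR_ge0 //; case: ifP; rewrite ?subr_ge0.
pose good (H0 H2 H1 Hq : {set {set 'I_n}}) K S :=
  [/\ #|K| = k.+1, u0 -> K \in H0, u1 -> K \in H2 /\ K \notin H1,
      S \subset faces j.+1 K /\ #|S| = a & lonely Hq K S].
apply: (union_card (Q := [set K : {set 'I_n} | #|K| == k.+1]%SET)
    (A := fun K => [set x | exists S, good (B p0 x) (B p2 x) (B p1 x) (B q x) K S])).
- exact: (measurable_born4 p0 p2 p1 q (fun H0 H2 H1 Hq => exists K S, good H0 H2 H1 Hq K S)).
- by move=> K; apply: (measurable_born4 p0 p2 p1 q (fun H0 H2 H1 Hq => exists S, good H0 H2 H1 Hq K S)).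
- by rewrite mulr_ge0.
- exact: card_hyperedges_le.
- move=> K; rewrite inE => /eqP Kk.
  apply: (union_card (Q := powerset (faces j.+1 K))
    (A := fun S => [set x | good (B p0 x) (B p2 x) (B p1 x) (B q x) K S])).
  + exact: (measurable_born4 p0 p2 p1 q (fun H0 H2 H1 Hq => exists S, good H0 H2 H1 Hq K S)).
  + by move=> S; apply: (measurable_born4 p0 p2 p1 q (fun H0 H2 H1 Hq => good H0 H2 H1 Hq K S)).
  + by [].
  + exact: card_powerset_faces_le.
  + move=> S; rewrite inE => SF; have [Sa|Sa] := eqVneq #|S| a; last first.
      rewrite (_ : mkset _ = set0) ?/prob ?measure0 // predeqE => x; split=> // -[_ _ _ [_ /eqP]].
      by rewrite (negPf Sa).
    have uS s : s \in S -> #|s| = j.+1.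
      by move=> /(fintype.subsetP SF); rewrite inE => /andP[_ /eqP].
    pose X0 := if u0 then [set K]%SET else finset.set0.
    pose X1 := if u1 then [set K]%SET else finset.set0.
    have uX (u : bool) : uniform k.+1 (if u then [set K]%SET else finset.set0).
      by case: u => K'; rewrite !inE // => /eqP ->.
    have av : avoid X0 X1.
      by rewrite /X0 /X1; move: u01; case: ifP; case: ifP => // _ _ _ K'; rewrite !inE.
    have sz (u : bool) : (#|if u then [set K]%SET else finset.set0| <= 1)%N.
      by case: u; rewrite ?cards1 ?cards0.
    have fm := first_moment (Z := [set K]%SET) (m := m) (uX u0) (uX u1) av uS p001 p10 p12 p21 q01 _ qm.
    apply: le_trans (le_trans (fm _) _).
    * apply: le_prob; [exact: (measurable_born4 p0 p2 p1 q (fun H0 H2 H1 Hq => good H0 H2 H1 Hq K S))|..].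
        exact: (measurable_born4 p0 p2 p1 q (fun H0 H2 H1 Hq => [/\ X0 \subset H0, X1 \subset H2,
          avoid X1 H1 & forall s K', s \in S -> K' \in Hq -> s \subset K' -> K' \in (X0 :|: X1 :|: [set K])%SET])).
      move=> x [_ h0 h1 _ lo]; rewrite /X0 /X1; split.
      -- by case: ifP => [u|_]; rewrite ?finset.sub0set // finset.sub1set; apply: h0.
      -- by case: ifP => [u|_]; rewrite ?finset.sub0set // finset.sub1set; case: (h1 u).
      -- case: ifP => [u K' /finset.set1P ->|_ K']; first by case: (h1 u).
         by rewrite finset.in_set0.
      -- by move=> s K' sS K'H sK'; rewrite !finset.in_setU (lo s K') // finset.set11 !orbT.
    * by rewrite Sa (leq_trans _ am) // leq_add2l cards1 (leq_add (leq_add (sz _) (sz _))).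
    * rewrite Sa /beta ler_wpM2r ?expR_ge0 // /X0 /X1.
      by do 2!case: ifP => _; rewrite ?cards1 ?cards0 ?expr1 ?expr0.
  + by move=> x [S gS]; exists S => //; case: gS => _ _ _ [SF _] _; rewrite inE.
- by move=> x [K [S gS]]; exists K; [case: gS => Kk; rewrite inE Kk|exists S].
Qed.

Lemma le_prob_born p1 p2 (G G' : {set {set 'I_n}} -> {set {set 'I_n}} -> Prop) :
  (forall x, G (B p1 x) (B p2 x) -> G' (B p1 x) (B p2 x)) ->
  prob P [set x | G (B p1 x) (B p2 x)] <= prob P [set x | G' (B p1 x) (B p2 x)].
Proof.
move=> GG; apply: le_prob => [||x /GG //].
- exact: (measurable_born4 p1 p2 p1 p2 (fun H1 H2 _ _ => G H1 H2)).
- exact: (measurable_born4 p1 p2 p1 p2 (fun H1 H2 _ _ => G' H1 H2)).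
Qed.

Lemma prob_born_or p1 p2 (G G1 G2 : {set {set 'I_n}} -> {set {set 'I_n}} -> Prop) :
  (forall x, G (B p1 x) (B p2 x) -> G1 (B p1 x) (B p2 x) \/ G2 (B p1 x) (B p2 x)) ->
  prob P [set x | G (B p1 x) (B p2 x)] <=
  prob P [set x | G1 (B p1 x) (B p2 x)] + prob P [set x | G2 (B p1 x) (B p2 x)].
Proof.
move=> GG; pose A (u : bool) := if u then [set x | G1 (B p1 x) (B p2 x)]
  else [set x | G2 (B p1 x) (B p2 x)].
apply: le_trans (_ : _ <= \sum_(u <- [:: true; false]) prob P (A u)) _.
  apply: union_bound.
  - exact: (measurable_born4 p1 p2 p1 p2 (fun H1 H2 _ _ => G H1 H2)).
  - case.
      exact: (measurable_born4 p1 p2 p1 p2 (fun H1 H2 _ _ => G1 H1 H2)).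
    exact: (measurable_born4 p1 p2 p1 p2 (fun H1 H2 _ _ => G2 H1 H2)).
  - by move=> x /GG[?|?]; [exists true|exists false].
by rewrite !big_cons big_nil addr0.
Qed.

Lemma union_born (I : finType) (Q : {set I}) p1 p2
    (G : I -> {set {set 'I_n}} -> {set {set 'I_n}} -> Prop) (m : nat) (beta : R) :
  0 <= beta -> (#|Q| <= m)%N ->
  (forall i, i \in Q -> prob P [set x | G i (B p1 x) (B p2 x)] <= beta) ->
  prob P [set x | exists2 i, i \in Q & G i (B p1 x) (B p2 x)] <= m%:R * beta.
Proof.
move=> b0 Qm Gb; apply: (union_card (Q := Q) (A := fun i => [set x | G i (B p1 x) (B p2 x)])) => //.
- exact: (measurable_born4 p1 p2 p1 p2 (fun H1 H2 _ _ => exists2 i, i \in Q & G i H1 H2)).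
- by move=> i; apply: (measurable_born4 p1 p2 p1 p2 (fun H1 H2 _ _ => G i H1 H2)).
Qed.

(** [t'] acts as one more lonely set beside the [a] sets in [S], whence [a.+1]. Of the two summands
    one is for no hyperedge above [t'] at [pm], the other for exactly one, with [n ^ (k - j)]
    choices and a further factor [pm]. *)
Lemma merging_bound a (pm pp : R) (m : nat) :
  0 <= pm -> pm <= pp -> pp <= 1 ->
  (a.+1 * (k * k.+1) + a.+1 * a.+1 + 3 <= m)%N -> pm * m%:R * n%:R ^+ (k - j - 1) <= 1 ->
  prob P [set x | exists K0 K S t t', [/\ K0 \in B pm x, K \in B pp x, K \notin B pm x,
    S \subset faces j.+1 K0 /\ #|S| = a & [/\ t \in S, t \subset K, t' \in faces j.+1 K,
    ~~ (t' \subset K0) & lonely (B pm x) K0 S /\ light (B pm x) t']]] <=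
  (n ^ k.+1)%:R * ((2 ^ 2 ^ k.+1)%:R * ((2 ^ k.+1)%:R * ((n ^ (k - j))%:R * ((2 ^ k.+1)%:R *
   (pm * (pp - pm) * expR (1 - pm * (a.+1%:R * nu)) +
    (n ^ (k - j))%:R * (pm ^+ 2 * (pp - pm) * expR (1 - pm * (a.+1%:R * nu)))))))).
Proof.
move=> pm0 pmp pp1 am qm.
have pm01 : 0 <= pm <= 1 by rewrite pm0 (le_trans pmp).
have d0 : 0 <= pp - pm by rewrite subr_ge0.
pose core K0 S t K t' (H H' : {set {set 'I_n}}) :=
  [/\ K0 \in H, K \in H', K \notin H, lonely H K0 S & light H t'].
pose G4 K0 S t K H H' := exists2 t', t' \in [set t' in faces j.+1 K | ~~ (t' \subset K0)]%SET &
  core K0 S t K t' H H'.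
pose G3 K0 S t H H' := exists2 K,
  K \in [set K : {set 'I_n} | (t \subset K) && (#|K| == k.+1)]%SET & G4 K0 S t K H H'.
pose G2 K0 S H H' := exists2 t, t \in S & G3 K0 S t H H'.
pose G1 K0 H H' := exists2 S, S \in [set S in powerset (faces j.+1 K0) | #|S| == a]%SET &
  G2 K0 S H H'.
pose G0 H H' := exists2 K0, K0 \in [set K : {set 'I_n} | #|K| == k.+1]%SET & G1 K0 H H'.
apply: (le_trans (le_prob_born (G' := G0) (G := fun H H' => exists K0 K S t t',
    [/\ K0 \in H, K \in H', K \notin H,
    S \subset faces j.+1 K0 /\ #|S| = a & [/\ t \in S, t \subset K, t' \in faces j.+1 K,
    ~~ (t' \subset K0) & lonely H K0 S /\ light H t']]) _)).
  move=> x [K0 [K [S [t [t' [K0H KH' KH [SF Sa] [tS tK t'F t'K0 [lo li]]]]]]]].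
  exists K0; first by rewrite finset.in_set (born_uniform K0H).
  exists S; first by rewrite !finset.in_set SF Sa eqxx.
  exists t => //.
  exists K; first by rewrite finset.in_set tK (born_uniform KH') eqxx.
  by exists t'; [rewrite finset.in_set t'F t'K0|split].
set beta := _ * expR _; set beta1 := _ * expR _.
have beta0 : 0 <= beta by rewrite !mulr_ge0 ?expR_ge0.
have beta10 : 0 <= beta1 by rewrite !mulr_ge0 ?expR_ge0 ?exprn_ge0.
have sum0 : 0 <= beta + (n ^ (k - j))%:R * beta1 by rewrite addr_ge0 // mulr_ge0.
apply: (union_born (G := G1)); [by rewrite !mulr_ge0|exact: card_hyperedges_le|].
move=> K0; rewrite inE => /eqP K0k.
apply: (union_born (G := G2 K0)); [by rewrite !mulr_ge0|..].
  apply: leq_trans (card_powerset_faces_le j.+1 K0k).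
  by apply/subset_leq_card/fintype.subsetP => S; rewrite !inE => /andP[].
move=> S /setIdP[]; rewrite inE => SF /eqP Sa.
apply: (union_born (G := G3 K0 S)); [by rewrite !mulr_ge0|..].
  by apply: leq_trans (card_faces_le j.+1 K0k); apply: subset_leq_card.
move=> t tS; have tj : #|t| = j.+1.
  by have /(fintype.subsetP SF) := tS; rewrite inE => /andP[_ /eqP].
apply: (union_born (G := G4 K0 S t)); [by rewrite !mulr_ge0|exact: card_up_le|].
move=> K; rewrite inE => /andP[tK /eqP Kk].
apply: (union_born (G := core K0 S t K)) => //.
  apply: leq_trans (card_faces_le j.+1 Kk).
  by apply/subset_leq_card/fintype.subsetP => s; rewrite !inE => /andP[].
move=> t' /setIdP[t'F t'K0].
have [t'K t'j] : t' \subset K /\ #|t'| = j.+1 by move: t'F; rewrite inE => /andP[? /eqP].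
have KK0 : K != K0 by apply: contraNneq t'K0 => <-.
pose S' := (t' |: S)%SET.
have t'S : t' \notin S.
  by apply: contra t'K0 => /(fintype.subsetP SF); rewrite inE => /andP[].
have S'a : #|S'| = a.+1 by rewrite cardsU1 t'S Sa.
have uS' s : s \in S' -> #|s| = j.+1.
  move=> /setU1P[-> //|/(fintype.subsetP SF)]; rewrite inE => /andP[_ /eqP //].
have u1 K1 : #|K1| = k.+1 -> uniform k.+1 [set K1]%SET by move=> h K2 /set1P ->.
pose E0 (H H' : {set {set 'I_n}}) := [/\ [set K0]%SET \subset H, [set K]%SET \subset H', avoid [set K]%SET H &
    forall s K', s \in S' -> K' \in H -> s \subset K' ->
    K' \in ([set K0] :|: [set K] :|: finset.set0)%SET].
pose E2 K1 (H H' : {set {set 'I_n}}) := [/\ [set K0; K1]%SET \subset H, [set K]%SET \subset H',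
    avoid [set K]%SET H & forall s K', s \in S' -> K' \in H -> s \subset K' ->
    K' \in ([set K0; K1] :|: [set K] :|: finset.set0)%SET].
pose E1 K1 H H' := K1 != K /\ E2 K1 H H'.
pose Q1 := [set K1 : {set 'I_n} | (t' \subset K1) && (#|K1| == k.+1)]%SET.
apply: (le_trans (prob_born_or (G := core K0 S t K t') (G1 := E0)
  (G2 := fun H H' => exists2 K1, K1 \in Q1 & E1 K1 H H') _)).
  move=> x [K0H KH' KH lo li].
  have av : avoid [set K]%SET (B pm x) by move=> K' /set1P ->.
  have [c0|] := eqVneq (cover_of (B pm x) t') finset.set0.
    left; split; rewrite ?finset.sub1set // => s K' /setU1P[->|sS] K'H sK'.
      by have /finset.setP/(_ K') := c0; rewrite finset.in_set K'H sK' finset.in_set0.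
    by rewrite (lo s K') // !finset.in_setU finset.set11.
  move=> /set0Pn[K1 K1c]; right; exists K1.
    by have /setIdP[K1H t'K1] := K1c; rewrite finset.in_set t'K1 (born_uniform K1H) eqxx.
  have /setIdP[K1H t'K1] := K1c; split; first by apply: contraNneq KH => <-.
  split; rewrite ?finset.sub1set //.
  - by rewrite finset.subUset !finset.sub1set K0H.
  - move=> s K' /setU1P[->|sS] K'H sK'; last first.
      by rewrite (lo s K') // !finset.in_setU finset.set11.
    have := li; rewrite /light => /card_le1P/(_ K1 K1c K').
    rewrite [in LHS]finset.in_set K'H sK' => /esym; rewrite inE => /eqP ->.
    by rewrite !finset.in_setU finset.set11 orbT.
apply: lerD.
  have av : avoid [set K0]%SET [set K]%SET by move=> K' /set1P ->; rewrite finset.in_set1 eq_sym.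
  have := first_moment (Z := finset.set0) (m := m) (u1 _ K0k) (u1 _ Kk) av uS' pm01 pm0 pmp pp1 pm01 _ qm.
  by rewrite S'a !cards1 cards0 !expr1; apply; rewrite (leq_trans _ am) // leq_add2l.
apply: (union_born (G := E1)) => //; first exact: card_up_le.
move=> K1; rewrite inE => /andP[t'K1 /eqP K1k].
have K10 : K0 != K1 by apply: contraNneq t'K0 => ->.
have [E|K1K] := eqVneq K1 K.
  rewrite [leLHS](_ : _ = prob P set0); first by rewrite /prob measure0.
  by congr prob; rewrite predeqE => x; split => // -[]; rewrite E eqxx.
have u2 : uniform k.+1 [set K0; K1]%SET by move=> K2 /set2P[] ->.
have av : avoid [set K0; K1]%SET [set K]%SET.
  by move=> K' /set2P[] ->; rewrite finset.in_set1 // eq_sym.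
have := first_moment (Z := finset.set0) (m := m) u2 (u1 _ Kk) av uS' pm01 pm0 pmp pp1 pm01 _ qm.
rewrite S'a cards2 K10 !cards1 cards0 expr1 => fm.
apply: le_trans (fm _); last by rewrite (leq_trans _ am) // leq_add2l.
apply: (le_prob_born (G := E1 K1) (G' := E2 K1)).
by move=> x [].
Qed.

End FirstMoment.

(** * Failure of apexes and minimal supports *)

Section BadEvents.
Context (R : realType) (k n j : nat) d (T : measurableType d) (P : probability T R).
Variable b : hyperedge k n -> {RV P >-> R}.
Hypothesis hb : iid_uniform01 b.
Hypotheses (jk : (j < k)%N) (n0 : (0 < n)%N).
Implicit Types (X Y Z S U : {set {set 'I_n}}) (K s t : {set 'I_n}) (v : 'I_n).

Local Notation B p x := (born (fun e => b e x) p).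
Local Notation nu := (faces_count R k n j).

(* If no apex works for [t], choose for each [v] a face [v |: t :\ u] that is
   not covered: these faces are distinct. *)
Lemma apex_failure H (V0 : {set 'I_n}) (M : nat) : #|V0| = (M + k.+1)%N -> ~ good_apex k j H ->
  exists K t S, [/\ #|K| = k.+1, t \in faces j.+1 K, S \subset faces j.+1 (t :|: V0),
    #|S| = M & forall s K', s \in S -> K' \in H -> ~~ (s \subset K')].
Proof.
move=> V0M nga.
have /existsNP[K /existsNP[t /not_implyP[Kk /not_implyP[tK /not_implyP[tj nex]]]]] := nga.
have ex v : exists s : {set 'I_n}, (v \in (V0 :\: K)%SET) ==>
    [&& s \in faces j.+1 (t :|: V0), (s :\: t)%SET == [set v]%SET &
        [forall (K' | K' \in H), ~~ (s \subset K')]].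
  case: (boolP (v \in (V0 :\: K)%SET)) => [|_]; last by exists finset.set0.
  rewrite inE => /andP[vK vV]; have vt : v \notin t by apply: contra vK; apply: (fintype.subsetP tK).
  have : ~ (forall u, u \in t -> exists2 K', K' \in H & (v |: t) :\ u \subset K').
    by move=> h; apply: nex; exists v.
  move=> /existsNP[u /not_implyP[ut nK]]; exists ((v |: t) :\ u)%SET => /=.
  have uv : v != u by apply: contraNneq vt => ->.
  apply/and3P; split.
  - rewrite inE; apply/andP; split.
      apply: fintype.subset_trans (finset.subsetDl _ _) _.
      by rewrite finset.subUset finset.sub1set !finset.inE vV orbT finset.subsetUl.
    have := cardsD1 u (v |: t)%SET; rewrite !finset.inE ut orbT cardsU1 vt tj => -[E].
    by apply/eqP; exact: esym E.
  - apply/eqP/finset.setP => z; rewrite !finset.inE; have [->|zv] := eqVneq z v.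
      by rewrite vt uv.
    by case: (z \in t); rewrite //= ?andbF.
  - by apply/forall_inP => K' K'H; apply/negP => sub; apply: nK; exists K'.
pose F v := xchoose (ex v).
have FP v : v \in (V0 :\: K)%SET -> [&& F v \in faces j.+1 (t :|: V0), (F v :\: t)%SET == [set v]%SET &
    [forall (K' | K' \in H), ~~ (F v \subset K')]].
  exact/implyP/(xchooseP (ex v)).
have injF : {in (V0 :\: K)%SET &, injective F}.
  move=> v w /FP/and3P[_ /eqP Ev _] /FP/and3P[_ /eqP Ew _] E.
  by move: Ev; rewrite E Ew => /finset.set1_inj.
have cM : (M <= #|F @: (V0 :\: K)%SET|)%N.
  rewrite card_in_imset // cardsD V0M leq_subRL; last first.
    by rewrite -V0M subset_leq_card // finset.subsetIl.
  by rewrite addnC leq_add2l -Kk subset_leq_card // finset.subsetIr.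
have [S SF SM] : exists2 S : {set {set 'I_n}}, S \subset F @: (V0 :\: K)%SET & #|S| = M.
  have : (0 < #|[set S : {set {set 'I_n}} | (S \subset F @: (V0 :\: K)%SET) && (#|S| == M)]%SET|)%N.
    by rewrite cards_draws bin_gt0.
  by move=> /card_gt0P[S]; rewrite inE => /andP[SF /eqP SM]; exists S.
exists K, t, S; split=> //; first by rewrite inE tK tj eqxx.
  apply/fintype.subsetP => s /(fintype.subsetP SF)/imsetP[v vV ->].
  by have /and3P[] := FP v vV.
move=> s K' /(fintype.subsetP SF)/imsetP[v vV ->] K'H.
by have /and3P[_ _ /forall_inP] := FP v vV; apply.
Qed.

(** Trying only the candidates in a set [V0] of bounded size keeps the number of families [S]
    bounded, so the union bound costs a constant times [n ^ k.+1]; [M] is chosen later to beat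
    it. *)
Lemma apex_bound (M m : nat) (V0 : {set 'I_n}) (p : R) :
  #|V0| = (M + k.+1)%N -> 0 <= p <= 1 ->
  (M * (k * k.+1) + M * M <= m)%N -> p * m%:R * n%:R ^+ (k - j - 1) <= 1 ->
  prob P [set x | ~ good_apex k j (B p x)] <=
  (n ^ k.+1)%:R * ((2 ^ k.+1)%:R * ((2 ^ 2 ^ (k.+1 + (M + k.+1)))%:R *
     expR (1 - p * (M%:R * nu)))).
Proof.
move=> V0M p01 Mm pm.
pose G3 S (H _ : {set {set 'I_n}}) := #|S| = M /\ forall s K', s \in S -> K' \in H -> ~~ (s \subset K').
pose G2 t H H' := exists2 S, S \in powerset (faces j.+1 (t :|: V0)) & G3 S H H'.
pose G1 K H H' := exists2 t, t \in faces j.+1 K & G2 t H H'.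
pose G0 H H' := exists2 K, K \in [set K : {set 'I_n} | #|K| == k.+1]%SET & G1 K H H'.
apply: (le_trans (le_prob_born (p1 := p) (p2 := p) (G' := G0)
    (G := fun H _ => ~ good_apex k j H) _)).
  move=> x /(apex_failure V0M)[K [t [S [Kk tK SF SM lo]]]].
  exists K; first by rewrite inE Kk.
  by exists t => //; exists S; rewrite ?inE.
apply: (union_born (G := G1)); [by rewrite !mulr_ge0 ?expR_ge0|exact: card_hyperedges_le|].
move=> K; rewrite inE => /eqP Kk.
apply: (union_born (G := G2)); [by rewrite !mulr_ge0 ?expR_ge0|exact: card_faces_le|].
move=> t; rewrite inE => /andP[tK /eqP tj].
apply: (union_born (G := G3)); [by rewrite expR_ge0|..].
  rewrite card_powerset leq_exp2l //.
  apply: (@leq_trans #|powerset (t :|: V0)|).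
    by apply/subset_leq_card/fintype.subsetP => s; rewrite !inE => /andP[].
  rewrite card_powerset leq_exp2l // (leq_trans (leq_card_setU _ _)) // V0M leq_add2r tj.
  by rewrite ltnS ltnW.
move=> S; rewrite inE => SF; have [SM|SM] := eqVneq #|S| M; last first.
  rewrite [leLHS](_ : _ = prob P set0); first by rewrite /prob measure0 expR_ge0.
  by congr prob; rewrite predeqE => x; split => // -[E]; rewrite E eqxx in SM.
have uS s : s \in S -> #|s| = j.+1.
  by move=> /(fintype.subsetP SF); rewrite inE => /andP[_ /eqP].
have u0 : uniform k.+1 (finset.set0 : {set {set 'I_n}}) by move=> K'; rewrite inE.
have av : avoid (finset.set0 : {set {set 'I_n}}) finset.set0 by move=> K'; rewrite inE.
have [p0 p1] := andP p01.
have := first_moment hb jk n0 (Z := finset.set0) (m := m) u0 u0 av uS p01 p0 (lexx p) p1 p01 _ pm.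
rewrite SM cards0 !addn0 !expr0 !mul1r => fm; apply: le_trans (fm Mm).
apply: (le_prob_born (G' := fun H H' => [/\ finset.set0 \subset H, finset.set0 \subset H',
   avoid finset.set0 H & forall s K', s \in S -> K' \in H -> s \subset K' ->
   K' \in (finset.set0 :|: finset.set0 :|: finset.set0)%SET]) (G := G3 S)).
move=> x [_ lo]; split; rewrite ?finset.sub0set //.
  by move=> K'; rewrite finset.in_set0.
move=> s K' sS K'H sK'.
by have := lo s K' sS K'H; rewrite sK'.
Qed.

(** For the exploration the vertices are the (j+1)-sets and the edges the (k+1)-sets; sets of any
    other size are edges without vertices. *)
Let inc K := if #|K| == k.+1 then faces j.+1 K else finset.set0.

Lemma incE K t : #|K| = k.+1 -> (t \in inc K) = (t \subset K) && (#|t| == j.+1).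
Proof. by move=> Kk; rewrite /inc Kk eqxx inE. Qed.

(* The supports of minimal non-trivial cochains, see [minimal_nontrivial]. *)
Definition bad_support S H :=
  [/\ (forall s, s \in S -> #|s| = j.+1), compat H (ind S), linked H S,
    (k - j + 1 < #|S|)%N & (n * #|S| <= j.+2 * #|supp (cobd (ind S))|)%N].

(** As [S] is linked, the exploration can find it from any of its elements using born hyperedges
    only; as [ind S] is compatible, no forbidden hyperedge is born. *)
Lemma bad_support_explored p x S t : bad_support S (B p x) -> t \in S ->
  exists2 U, (S, U) \in explore inc (2 * #|S|) [:: t] [set t]%SET finset.set0 &
    [/\ U \subset B p x & avoid (forbidden k (ind S)) (B p x)].
Proof.
move=> [uS cS lS _ _] tS.
have uB K : K \in B p x -> #|K| = k.+1 by apply: born_uniform.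
have S0 : (0 < #|S|)%N by apply/card_gt0P; exists t.
have [| | | | | | | |U UE UB] := @explore_complete _ _ inc (B p x) S (2 * #|S|) [:: t] [set t]%SET finset.set0.
- move=> F FS F0 lF; apply: lS => // K s s' KH sF s'S sK s'K.
  have sS := fintype.subsetP FS s sF.
  by apply: (lF K s s') => //; rewrite (incE _ (uB K KH)) ?sK ?s'K ?(uS s sS) ?(uS s' s'S) eqxx.
- by rewrite finset.sub1set.
- by apply/set0Pn; exists t; rewrite finset.set11.
- exact: finset.sub0set.
- by move=> s; rewrite inE => /eqP ->; rewrite finset.set11.
- by move=> e; rewrite inE.
- by move=> e v; rewrite finset.in_set1 => /eqP ->; rewrite inE eqxx.
- by rewrite cards1; case: #|S| S0 => // s0 _; rewrite subn1 mulnS leq_add2r.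
exists U => //; split => // K; rewrite inE => /andP[_]; apply: contra => KB.
by move/compatP: cS; apply.
Qed.

(** For each size [s] and start [t], the outcomes [(S, U)] of [2 * s] steps are summed: [U] is born
    and the forbidden hyperedges are not, which are independent events. The lower bound [f] for the
    number of the latter is left open. *)
Lemma base_bound (p : R) (f : nat -> R) : 0 <= p <= 1 ->
  (forall S, (forall s, s \in S -> #|s| = j.+1) ->
     (n * #|S| <= j.+2 * #|supp (cobd (ind S))|)%N -> f #|S| <= #|forbidden k (ind S)|%:R) ->
  prob P [set x | exists S, bad_support S (B p x)] <=
  \sum_(s < (n ^ j.+1).+1 | (k - j + 1 < s)%N) (n ^ j.+1)%:R *
     ((1 + p * (n ^ (k - j) * 2 ^ 2 ^ k.+1)%:R) ^+ (2 * s) * expR (- (p * f s))).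
Proof.
move=> p01 fle; have [p0 p1] := andP p01.
pose c := (n ^ (k - j) * 2 ^ 2 ^ k.+1)%N.
pose beta (s : nat) : R := (1 + p * c%:R) ^+ (2 * s) * expR (- (p * f s)).
have beta0 (s : nat) : 0 <= beta s.
  by rewrite mulr_ge0 ?expR_ge0 // exprn_ge0 // addr_ge0 // mulr_ge0.
have mB (Q : {set {set 'I_n}} -> Prop) : measurable [set x | Q (B p x)].
  exact: (measurable_born4 b p p p p (fun H _ _ _ => Q H)).
pose A (s : 'I_(n ^ j.+1).+1) := [set x | exists S, #|S| = s /\ bad_support S (B p x)].
pose sizes := [seq s : 'I__ <- index_enum 'I_(n ^ j.+1).+1 | (k - j + 1 < s)%N].
apply: (@le_trans _ _ (\sum_(s <- sizes) prob P (A s))).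
  apply: union_bound.
  - exact: (mB (fun H => exists S, bad_support S H)).
  - by move=> s; exact: (mB (fun H => exists S, #|S| = s /\ bad_support S H)).
  move=> x [S bS]; have [uS _ _ rS _] := bS.
  have leS : (#|S| < (n ^ j.+1).+1)%N.
    rewrite ltnS; apply: (@leq_trans #|[set s : {set 'I_n} | #|s| == j.+1]%SET|).
      by apply/subset_leq_card/fintype.subsetP => s /uS; rewrite inE => ->.
    by rewrite card_draws card_ord bin_le_expn.
  by exists (Ordinal leS); [rewrite mem_filter rS mem_index_enum|exists S].
rewrite big_filter; apply: ler_sum => s _.
pose At (t : {set 'I_n}) := [set x | exists S, [/\ t \in S, #|S| = s & bad_support S (B p x)]].
apply: (union_card (Q := [set t : {set 'I_n} | #|t| == j.+1]%SET) (A := At)).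
- exact: (mB (fun H => exists S, #|S| = s /\ bad_support S H)).
- by move=> t; exact: (mB (fun H => exists S, [/\ t \in S, #|S| = s & bad_support S H])).
- exact: beta0.
- by rewrite card_draws card_ord bin_le_expn.
- move=> t tj.
  pose At' (SU : {set {set 'I_n}} * {set {set 'I_n}}) := [set x |
    [/\ #|SU.1| = s, (forall s, s \in SU.1 -> #|s| = j.+1),
      (n * #|SU.1| <= j.+2 * #|supp (cobd (ind SU.1))|)%N, SU.2 \subset B p x &
      avoid (forbidden k (ind SU.1)) (B p x)]].
  pose ex := explore inc (2 * s) [:: t] [set t]%SET finset.set0.
  apply: (@le_trans _ _ (\sum_(SU <- ex) prob P (At' SU))).
    apply: union_bound.
    + exact: (mB (fun H => exists S, [/\ t \in S, #|S| = s & bad_support S H])).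
    + move=> SU; exact: (mB (fun H => [/\ #|SU.1| = s, (forall s, s \in SU.1 -> #|s| = j.+1),
      (n * #|SU.1| <= j.+2 * #|supp (cobd (ind SU.1))|)%N, SU.2 \subset H &
      avoid (forbidden k (ind SU.1)) H])).
    + move=> x [S [tS Ss bS]]; have [U UE [UB av]] := bad_support_explored bS tS.
      exists (S, U); first by rewrite /ex -Ss.
      by case: bS => uS _ _ _ iso; split.
  have deg (v : {set 'I_n}) : (#|[set K : {set 'I_n} | v \in inc K]%SET| <= n ^ (k - j))%N.
    have [vj|vj] := eqVneq #|v| j.+1.
      apply: leq_trans (card_up_le jk vj); apply/subset_leq_card/fintype.subsetP => K.
      rewrite !finset.in_set /inc; case: eqP => [Kk|_]; last by rewrite finset.in_set0.
      by rewrite inE => /andP[-> _].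
    rewrite (_ : [set K | _]%SET = finset.set0) ?cards0 //; apply/finset.setP => K.
    rewrite finset.in_set finset.in_set0 /inc; case: ifP => _; last by rewrite finset.in_set0.
    by rewrite inE (negPf vj) andbF.
  have szc K : (#|inc K| <= 2 ^ k.+1)%N.
    by rewrite /inc; case: eqP => [Kk|_]; [apply: card_faces_le|rewrite cards0].
  have := explore_weight (2 * s) [:: t] [set t]%SET finset.set0 p0 deg szc.
  rewrite cards0 expr0 mul1r -/ex => wt.
  apply: (@le_trans _ _ (\sum_(SU <- ex) p ^+ #|SU.2| * expR (- (p * f s)))).
    apply: ler_sum => -[S U] _ /=; rewrite {}/At' /=.
    have b0 : 0 <= p ^+ #|U| * expR (- (p * f s)) by rewrite mulr_ge0 ?exprn_ge0 ?expR_ge0.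
    (* Outcomes that no bad support produces have probability 0, among them those in which [U]
       contains a forbidden hyperedge. *)
    have null (Q : T -> Prop) : (forall x, ~ Q x) -> prob P [set x | Q x] <= p ^+ #|U| * expR (- (p * f s)).
      move=> nQ; rewrite (_ : mkset _ = set0) ?/prob ?measure0 // predeqE => x; split => // /nQ //.
    have [Ss|Ss] := eqVneq #|S| s; last by apply: null => x [E]; rewrite E eqxx in Ss.
    have [uS|uS] := pselect (forall s, s \in S -> #|s| = j.+1); last by apply: null => x [].
    have [iso|iso] := pselect (n * #|S| <= j.+2 * #|supp (cobd (ind S))|)%N; last by apply: null => x [].
    have [uU|uU] := pselect (uniform k.+1 U); last first.
      apply: null => x [_ _ _ /fintype.subsetP UB _]; apply: uU => K /UB; exact: born_uniform.
    have [dU|dU] := pselect (avoid U (forbidden k (ind S))); last first.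
      apply: null => x [_ _ _ /fintype.subsetP UB av]; apply: dU => K /UB KB.
      by apply: contraTN KB => /av.
    have u0 : uniform k.+1 (finset.set0 : {set {set 'I_n}}) by move=> K'; rewrite inE.
    have uF : uniform k.+1 (forbidden k (ind S)) by move=> K; rewrite inE => /andP[/eqP].
    have av0 X : avoid (finset.set0 : {set {set 'I_n}}) X by move=> K'; rewrite inE.
    have av0' X : avoid X (finset.set0 : {set {set 'I_n}}) by move=> K' _; rewrite inE.
    have := prob_cylinder hb uU u0 uF (av0' U) dU (av0 _) p01 p0 (lexx p) p1 p01.
    rewrite cards0 expr0 mulr1 => cyl; apply: (@le_trans _ _ (p ^+ #|U| * (1 - p) ^+ #|forbidden k (ind S)|)).
      rewrite -cyl; apply: (le_prob_born (p1 := p) (p2 := p)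
        (G := fun H _ => [/\ #|S| = s, (forall s, s \in S -> #|s| = j.+1),
          (n * #|S| <= j.+2 * #|supp (cobd (ind S))|)%N, U \subset H &
          avoid (forbidden k (ind S)) H])
        (G' := fun H H' => [/\ U \subset H, finset.set0 \subset H', avoid finset.set0 H &
          avoid (forbidden k (ind S)) H])).
      move=> x [_ _ _ UB av]; split => //; exact: finset.sub0set.
    rewrite ler_wpM2l ?exprn_ge0 //; apply: le_trans (onem_expR_le _ p01) _.
    by rewrite ler_expR lerN2 ler_wpM2l // -Ss; apply: fle.
  by rewrite -mulr_suml /beta ler_wpM2r ?expR_ge0.
- move=> x [S [Ss bS]]; have [uS _ _ rS _] := bS.
  have /card_gt0P[t tS] : (0 < #|S|)%N by apply: leq_trans rS.
  by exists t; [rewrite inE uS|exists S].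
Qed.

End BadEvents.

(** Used with [u], [u'], [w], [w'] the probabilities that two neighbourhoods, their union and their
    intersection are absent; the point is that [(1 + 2 * z) * (1 - z)] is at least 1 for [z] up to
    1/2. *)
Lemma almost_independent (R : realFieldType) (q z u u' w w' : R) : 0 <= z -> z <= 1 / 2 ->
  0 <= w -> u * u' = w * w' -> 1 - z <= w' ->
  q ^+ 2 * w <= (1 + 2 * z) * (q * u * (q * u')).
Proof.
move=> z0 z2 w0 e w'z.
have -> : (1 + 2 * z) * (q * u * (q * u')) = q ^+ 2 * w * ((1 + 2 * z) * w').
  by rewrite mulrACA e; ring.
rewrite ler_peMr //; first by rewrite mulr_ge0 // sqr_ge0.
nra.
Qed.

(** * Hosts: hyperedges with an isolated flower *)

Section Hosts.
Context (R : realType) (k n i : nat) d (T : measurableType d) (P : probability T R).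
Variable b : hyperedge k n -> {RV P >-> R}.
Hypothesis hb : iid_uniform01 b.
Hypothesis ik : (i < k)%N.
Implicit Types (H S : {set {set 'I_n}}) (K s t : {set 'I_n}).

Local Notation B p x := (born (fun e => b e x) p).

(** A fixed choice of one centre per hyperedge, so that isolated flowers are counted by
    hyperedges. *)
Definition first_vertices K : {set 'I_n} := [set x in take i (enum K)]%SET.

Lemma first_vertices_sub K : first_vertices K \subset K.
Proof. by apply/fintype.subsetP => x; rewrite inE => /mem_take; rewrite mem_enum. Qed.

Lemma card_first_vertices K : #|K| = k.+1 -> #|first_vertices K| = i.
Proof.
move=> Kk; rewrite cardsE; have /card_uniqP -> : uniq (take i (enum K)).
  by apply: take_uniq; apply: enum_uniq.
by rewrite size_takel // -cardE Kk ltnW // ltnW.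
Qed.

Local Notation F K := (petals K (first_vertices K)).

Definition neighbours K := [set K' : {set 'I_n} | [&& #|K'| == k.+1, K' != K &
  [exists (s | s \in F K), s \subset K']]]%SET.

(** The pair stands for the born hyperedges at the two ends of a time interval: born by its start
    and isolated at its end, the flower is isolated throughout. *)
Definition host K (HH : {set {set 'I_n}} * {set {set 'I_n}}) :=
  [&& #|K| == k.+1, K \in HH.1 & [forall (K' | K' \in HH.2), K' \notin neighbours K]].

Lemma petals_first_verticesP K s : #|K| = k.+1 -> s \in F K -> #|s| = i.+1.
Proof. by move=> Kk /petals_size; rewrite card_first_vertices. Qed.

Lemma card_petals_first_vertices K : #|K| = k.+1 -> #|F K| = (k - i + 1)%N.
Proof.
by move=> Kk; rewrite card_petals ?first_vertices_sub // Kk card_first_vertices // subSn ?addn1 // ltnW.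
Qed.

Lemma card_neighbours K : #|K| = k.+1 ->
  (#|neighbours K| <= (k - i + 1) * 'C(n - i.+1, k - i))%N.
Proof.
move=> Kk; pose up s := [set K' : {set 'I_n} | (s \subset K') && (#|K'| == k.+1)]%SET.
apply: (@leq_trans #|\bigcup_(s in F K) up s|%SET).
  apply/subset_leq_card/fintype.subsetP => K'; rewrite inE => /and3P[K'k _ /exists_inP[s sF sK']].
  by apply/finset.bigcupP; exists s; rewrite // inE sK'.
apply: leq_trans (leq_bigcup_card _ _) _; rewrite -(card_petals_first_vertices Kk) -sum_nat_const.
apply: leq_sum => s sF; rewrite card_supersets ?(petals_first_verticesP Kk sF) ?card_ord ?subSS //.
by rewrite ltnS ltnW.
Qed.

(** As [K'] is no neighbour of [K], the two flowers share no petal, so a common neighbour contains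
    two distinct petals. *)
Lemma card_common_neighbours K K' : #|K| = k.+1 -> #|K'| = k.+1 -> K != K' ->
  K' \notin neighbours K ->
  (#|neighbours K :&: neighbours K'| <= k.+1 * k.+1 * n ^ (k - i - 1))%N.
Proof.
move=> Kk K'k KK' nb; pose up s := [set K' : {set 'I_n} | (s \subset K') && (#|K'| == k.+1)]%SET.
apply: (@leq_trans #|\bigcup_(s in F K) \bigcup_(s' in F K') up (s :|: s')|%SET).
  apply/subset_leq_card/fintype.subsetP => K1; rewrite !inE.
  move=> /andP[/and3P[K1k _ /exists_inP[s sF sK1]] /and3P[_ _ /exists_inP[s' s'F s'K1]]].
  apply/finset.bigcupP; exists s => //; apply/finset.bigcupP; exists s' => //.
  by rewrite inE finset.subUset sK1 s'K1.
apply: leq_trans (leq_bigcup_card _ _) _.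
have pk K1 : #|K1| = k.+1 -> (#|F K1| <= k.+1)%N.
  by move=> h; rewrite card_petals_first_vertices // addn1 ltnS leq_subr.
apply: (@leq_trans (\sum_(s in F K) k.+1 * n ^ (k - i - 1))); last first.
  by rewrite sum_nat_const mulnA leq_mul2r leq_mul2r pk ?orbT.
apply: leq_sum => s sF; apply: leq_trans (leq_bigcup_card _ _) _.
apply: (@leq_trans (\sum_(s' in F K') n ^ (k - i - 1))); last first.
  by rewrite sum_nat_const leq_mul2r pk ?orbT.
apply: leq_sum => s' s'F.
have := @card_supersets_pair _ k i s s' ik (petals_first_verticesP Kk sF) (petals_first_verticesP K'k s'F).
rewrite card_ord; apply; apply: contraNneq nb => E.
rewrite inE K'k eqxx eq_sym KK' /=; apply/exists_inP; exists s => //.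
by rewrite E; apply: petals_sub (first_vertices_sub _) s'F.
Qed.

Lemma prob_host K q q' : #|K| = k.+1 -> 0 <= q <= 1 -> 0 <= q' <= 1 ->
  prob P [set x | host K (B q x, B q' x)] = q * (1 - q') ^+ #|neighbours K|.
Proof.
move=> Kk q01 q'01; have [q0 q1] := andP q01.
have u1 : uniform k.+1 [set K]%SET by move=> K' /set1P ->.
have u0 : uniform k.+1 (finset.set0 : {set {set 'I_n}}) by move=> K'; rewrite inE.
have uN : uniform k.+1 (neighbours K) by move=> K'; rewrite inE => /and3P[/eqP].
have av0 (X : {set {set 'I_n}}) : avoid finset.set0 X by move=> K'; rewrite inE.
have av0' (X : {set {set 'I_n}}) : avoid X finset.set0 by move=> K' _; rewrite inE.
have avN : avoid [set K]%SET (neighbours K) by move=> K' /set1P ->; rewrite inE eqxx andbF.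
have := prob_cylinder hb u1 u0 uN (av0' _) avN (av0 _) q01 q0 (lexx q) q1 q'01.
rewrite cards1 cards0 expr0 expr1 mulr1 => <-; congr prob.
rewrite predeqE => x /=; rewrite /host Kk eqxx /=; split.
  move=> /andP[KH /forall_inP iso]; split; rewrite ?finset.sub1set ?finset.sub0set //.
  by move=> K' K'N; apply: contraL K'N => /iso.
rewrite finset.sub1set => -[-> _ _ av]; apply/forall_inP => K' K'H.
by apply: contraL K'H => /av.
Qed.

Lemma prob_host2 K K' q q' : K != K' -> #|K| = k.+1 -> #|K'| = k.+1 ->
  K' \notin neighbours K -> K \notin neighbours K' -> 0 <= q <= 1 -> 0 <= q' <= 1 ->
  prob P [set x | host K (B q x, B q' x) && host K' (B q x, B q' x)] =
  q ^+ 2 * (1 - q') ^+ #|neighbours K :|: neighbours K'|.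
Proof.
move=> KK' Kk K'k nK' nK q01 q'01; have [q0 q1] := andP q01.
have u1 : uniform k.+1 [set K; K']%SET by move=> K1 /set2P[] ->.
have u0 : uniform k.+1 (finset.set0 : {set {set 'I_n}}) by move=> K1; rewrite inE.
have uN K1 : uniform k.+1 (neighbours K1) by move=> K2; rewrite inE => /and3P[/eqP].
have uNN : uniform k.+1 (neighbours K :|: neighbours K')%SET by move=> K1 /finset.setUP[] /uN.
have av0 (X : {set {set 'I_n}}) : avoid finset.set0 X by move=> K1; rewrite inE.
have av0' (X : {set {set 'I_n}}) : avoid X finset.set0 by move=> K1 _; rewrite inE.
have self K1 : K1 \notin neighbours K1 by rewrite inE eqxx andbF.
have avN : avoid [set K; K']%SET (neighbours K :|: neighbours K')%SET.
  by move=> K1 /set2P[] ->; rewrite finset.in_setU negb_or ?self ?nK' ?nK.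
have := prob_cylinder hb u1 u0 uNN (av0' _) avN (av0 _) q01 q0 (lexx q) q1 q'01.
rewrite cards2 KK' cards0 expr0 mulr1 => <-; congr prob.
rewrite predeqE => x /=; rewrite /host Kk K'k eqxx /=; split.
  move=> /andP[/andP[KH /forall_inP iso] /andP[K'H /forall_inP iso']].
  split; rewrite ?finset.subUset ?finset.sub1set ?finset.sub0set ?KH //.
  move=> K1 /finset.setUP[K1N|K1N]; [apply: contraL K1N => /iso|apply: contraL K1N => /iso'] => //.
rewrite finset.subUset !finset.sub1set => -[/andP[-> ->] _ _ av] /=.
by apply/andP; split; apply/forall_inP => K1 K1H; apply: contraL K1H => K1N; apply: av;
  rewrite finset.in_setU K1N ?orbT.
Qed.

(** Two neighbouring hyperedges are never both hosts. Other pairs depend on each other only through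
    common neighbours, which change the joint probability by a factor of at most [1 + 2 * z], where
    [z] bounds the expected number of those that are born. *)
Lemma hosts_bound q q' (mu : R) : 0 <= q -> q <= q' -> q' <= 1 -> 0 < mu ->
  q' * (k.+1 * k.+1 * n ^ (k - i - 1))%:R <= 1 / 2 ->
  mu <= ('C(n, k.+1))%:R * (q * (1 - q') ^+ ((k - i + 1) * 'C(n - i.+1, k - i))) ->
  prob P [set x | 2 * #|[set K | host K (B q x, B q' x)]%SET|%:R < mu] <=
  4 * (mu^-1 + 2 * (q' * (k.+1 * k.+1 * n ^ (k - i - 1))%:R)).
Proof.
move=> q0 qq' q'1 mu0 zle mule.
have q01 : 0 <= q <= 1 by rewrite q0 (le_trans qq').
have q'01 : 0 <= q' <= 1 by rewrite (le_trans q0 qq').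
set z := q' * _ in zle *; have z0 : 0 <= z by rewrite mulr_ge0 // (le_trans q0).
have o0 : 0 <= 1 - q' by rewrite subr_ge0.
have o1 : 1 - q' <= 1 by rewrite gerBl (le_trans q0).
pose X x := (B q x, B q' x).
have mX : fin_measurable X by apply: fin_measurable_pair; apply: fin_measurable_born.
pose mean := \sum_K prob P [set x | host K (X x)].
have mumean : mu <= mean.
  apply: le_trans mule _; rewrite /mean (bigID (fun K => #|K| == k.+1)) /=.
  rewrite -[leLHS]addr0; apply: lerD; last by apply: sumr_ge0 => K _; apply: prob_ge0.
  rewrite -[n in 'C(n, _)]card_ord -card_draws mulr_natl -sumr_const.
  rewrite big_mkcond [leRHS]big_mkcond.
  apply: ler_sum => K _; rewrite inE; case: eqP => // Kk; rewrite prob_host // ler_wpM2l //.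
  by apply: ler_wiXn2l => //; apply: card_neighbours.
have pair K K' : K != K' -> prob P [set x | host K (X x) && host K' (X x)] <=
    (1 + 2 * z) * (prob P [set x | host K (X x)] * prob P [set x | host K' (X x)]).
  move=> KK'; have rhs0 : 0 <= (1 + 2 * z) * (prob P [set x | host K (X x)] * prob P [set x | host K' (X x)]).
    by rewrite mulr_ge0 ?mulr_ge0 ?prob_ge0 // addr_ge0 // mulr_ge0.
  have null : (forall x, ~~ (host K (X x) && host K' (X x))) ->
      prob P [set x | host K (X x) && host K' (X x)] <=
    (1 + 2 * z) * (prob P [set x | host K (X x)] * prob P [set x | host K' (X x)]).
    move=> h; rewrite [leLHS](_ : _ = 0) // /prob (_ : mkset _ = set0) ?measure0 //.
    by rewrite predeqE => x; split => // /= hx; have := h x; rewrite hx.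
  have [Kk|Kk] := eqVneq #|K| k.+1; last by apply: null => x; rewrite /host (negPf Kk).
  have [K'k|K'k] := eqVneq #|K'| k.+1; last by apply: null => x; rewrite /host (negPf K'k) andbF.
  have BB x := fintype.subsetP (born_mono (fun e => b e x) qq').
  have [nK'|nK'] := boolP (K' \in neighbours K).
    apply: null => x; apply/negP => /andP[/and3P[_ _ /forall_inP iso] /and3P[_ K'H _]].
    by have := iso K' (BB x _ K'H); rewrite nK'.
  have [nK|nK] := boolP (K \in neighbours K').
    apply: null => x; apply/negP => /andP[/and3P[_ KH _] /and3P[_ _ /forall_inP iso]].
    by have := iso K (BB x _ KH); rewrite nK.
  rewrite prob_host2 // !prob_host //.
  have common := card_common_neighbours Kk K'k KK' nK'.
  set N := neighbours K in common *; set N' := neighbours K' in common *.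
  have cU : (#|N :|: N'|%SET + #|N :&: N'|%SET = #|N| + #|N'|)%N := cardsUI _ _.
  have e : (1 - q') ^+ #|N| * (1 - q') ^+ #|N'| =
      (1 - q') ^+ #|N :|: N'|%SET * (1 - q') ^+ #|N :&: N'|%SET by rewrite -!exprD cU.
  have cI : 1 - z <= (1 - q') ^+ #|N :&: N'|%SET.
    apply: le_trans (onem_expn_ge _ q'01) _; exact: ler_wiXn2l.
  exact: almost_independent z0 zle (exprn_ge0 _ o0) e cI.
have e0 : 0 <= 2 * z by rewrite mulr_ge0.
have sm := prob_second_moment (erefl : mean = \sum_K prob P [set x | host K (X x)]) mX e0 pair.
have mean0 : 0 < mean by apply: lt_le_trans mumean.
apply: (@le_trans _ _ (prob P [set x | 2 * #|[set K | host K (X x)]%SET|%:R < mean])).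
  apply: (le_prob_born (p1 := q) (p2 := q')
    (G := fun H H' => 2 * #|[set K | host K (H, H')]%SET|%:R < mu)
    (G' := fun H H' => 2 * #|[set K | host K (H, H')]%SET|%:R < mean)).
  by move=> x /lt_le_trans; apply.
set pr := prob P _ in sm *.
have : pr <= 4 * (mean^-1 + 2 * z).
  rewrite -(ler_pM2r (x := mean ^+ 2)) ?exprn_gt0 //; apply: le_trans sm _.
  have E : (mean^-1 + 2 * z) * mean ^+ 2 = mean + 2 * z * mean ^+ 2.
    by rewrite mulrDl expr2 mulKf // gt_eqF.
  by rewrite -[leRHS]mulrA E.
move=> /le_trans; apply; rewrite ler_wpM2l // lerD2r lef_pV2 //.
Qed.

End Hosts.

(** * Isolated vertices *)

Section IsolatedVertex.
Context (R : realType) (k n : nat) d (T : measurableType d) (P : probability T R).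
Variable b : hyperedge k n -> {RV P >-> R}.
Hypothesis hb : iid_uniform01 b.

Local Notation B p x := (born (fun e => b e x) p).

Lemma covered_vertex_bound (v : 'I_n) q : 0 <= q <= 1 ->
  prob P [set x | exists2 K, K \in B q x & v \in K] <= (n ^ k)%:R * q.
Proof.
move=> q01; have [q0 q1] := andP q01.
pose up := [set K : {set 'I_n} | ([set v]%SET \subset K) && (#|K| == k.+1)]%SET.
apply: (le_trans (le_prob_born (p1 := q) (p2 := q)
  (G := fun H _ => exists2 K, K \in H & v \in K)
  (G' := fun H _ => exists2 K, K \in up & K \in H) _)).
  move=> x [K KH vK]; exists K => //.
  by rewrite inE finset.sub1set vK (born_uniform KH) eqxx.
apply: (union_born (G := fun K H _ => K \in H)) => //.
  by have := @card_supersets_le 'I_n k.+1 [set v]%SET; rewrite cards1 card_ord subn1; apply.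
move=> K; rewrite inE => /andP[_ /eqP Kk].
have u1 : uniform k.+1 [set K]%SET by move=> K' /set1P ->.
have u0 : uniform k.+1 (finset.set0 : {set {set 'I_n}}) by move=> K'; rewrite inE.
have av0 (X : {set {set 'I_n}}) : avoid finset.set0 X by move=> K'; rewrite inE.
have av0' (X : {set {set 'I_n}}) : avoid X finset.set0 by move=> K' _; rewrite inE.
have := prob_cylinder hb u1 u0 u0 (av0' _) (av0' _) (av0 _) q01 q0 (lexx q) q1 q01.
rewrite cards1 cards0 !expr0 expr1 !mulr1 => cyl; rewrite -[leRHS]cyl.
apply: (le_prob_born (p1 := q) (p2 := q) (G := fun H _ => K \in H)
  (G' := fun H H' => [/\ [set K]%SET \subset H, finset.set0 \subset H', avoid finset.set0 H &
    avoid finset.set0 H])).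
by move=> x KH; split; rewrite ?finset.sub1set ?finset.sub0set.
Qed.

(** The indicator of [v] is a 0-cocycle besides [0] and the constant [one], so there are three where
    connectedness allows two. *)
Lemma not_connected_of_isolated (c : hyperedge k n -> R) p j (v : 'I_n) :
  (0 < j)%N -> (1 < n)%N -> (forall K, K \in born c p -> v \notin K) ->
  ~ cohomologically_connected (complex_at c p) j.
Proof.
move=> j0 n1 iso /connectedE[] // c2 _.
set G := complex_at c p in c2.
have G1 u : ([set u]%SET \in G) && (#|[set u]%SET| == 1%N).
  by rewrite mem_complex_at cards1.
pose pt u : simplex G 0 := Sub [set u]%SET (G1 u).
pose one : cochain G 0 := [ffun=> 1].
pose dv : cochain G 0 := res G 0 (ind [set [set v]%SET]%SET).
have [w wv] : exists w, w != v.
  have : (1 < #|'I_n|)%N by rewrite card_ord.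
  move=> /card_gt1P[u [w [_ _ uw]]]; have [E|] := eqVneq u v; last by exists u.
  by exists w; rewrite -E eq_sym.
have sub : [set 0; one; dv]%SET \subset cocycles G 0.
  apply/fintype.subsetP => f /finset.setUP[/finset.set2P[->|->]|/finset.set1P ->].
  - apply/cocyclesP/ffunP => s; rewrite !ffunE big1 // => t _; by rewrite ffunE.
  - apply/cocyclesP; rewrite (_ : one = res G 0 (cobd (ind [set finset.set0]%SET))).
      by apply: cocycle_res; apply: compat_cobd.
    apply/ffunP => t; rewrite !ffunE; have /andP[_ /cards1P[x ->]] := valP t.
    by rewrite big_set1 ffunE inE finset.setDv eqxx.
  - apply/cocyclesP/cocycle_res/compatP => K KH; apply/closed_onP => s sK.
    rewrite ffunE big1 // => x xs; rewrite ffunE inE; case: eqP => // E.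
    have : v \in s by have := finset.set11 v; rewrite -E inE => /andP[].
    by move=> /(fintype.subsetP sK); rewrite (negPf (iso K KH)).
have := subset_leq_card sub; rewrite c2 leqNgt; case/negP.
apply/card_gt2P; exists 0, one, dv; split; split; rewrite ?inE ?eqxx ?orbT //.
- apply/eqP => /ffunP/(_ (pt v)); rewrite !ffunE => /eqP; rewrite eq_sym.
  by rewrite oner_eq0.
- apply/eqP => /ffunP/(_ (pt w)); rewrite !ffunE SubK inE.
  rewrite (_ : _ == _ = false); first by move=> /eqP; rewrite oner_eq0.
  by apply/negP => /eqP/finset.set1_inj E; rewrite E eqxx in wv.
- apply/eqP => /ffunP/(_ (pt v)); rewrite !ffunE SubK inE eqxx => /eqP.
  by rewrite oner_eq0.
Qed.

End IsolatedVertex.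

(** * Events of vanishing probability *)

Section Vanishing.
Context (R : realType) (d : nat -> measure_display) (T : forall n, measurableType (d n)).
Variable P : forall n, probability (T n) R.
Implicit Types A B : forall n, set (T n).

Definition vanishing B := (forall n, measurable (B n)) /\
  forall e : R, 0 < e -> \forall n \near \oo, prob (P n) (B n) <= e.

Lemma vanishingU A B : vanishing A -> vanishing B -> vanishing (fun n => A n `|` B n).
Proof.
move=> [mA vA] [mB vB]; split; first by move=> n; apply: measurableU.
move=> e e0; have e2 : 0 < e / 2 by rewrite divr_gt0.
apply: filterS2 (vA _ e2) (vB _ e2) => n an bn.
rewrite [leRHS]splitr; apply: le_trans (lerD an bn).
apply: le_trans (_ : _ <= \sum_(u <- [:: true; false]) prob (P n) (if u then A n else B n)) _.
  apply: union_bound; [exact: measurableU|by case|].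
  by move=> x [?|?]; [exists true|exists false].
by rewrite !big_cons big_nil addr0.
Qed.

Lemma vanishing_bigU (m : nat) (B : nat -> forall n, set (T n)) :
  (forall i, (i < m)%N -> vanishing (B i)) ->
  vanishing (fun n => [set x | exists2 i, (i < m)%N & B i n x]).
Proof.
elim: m => [|m IH] vB.
  split=> [n|e e0]; first by rewrite (_ : mkset _ = set0) // predeqE => x; split => // -[].
  apply: nearW => n; rewrite (_ : mkset _ = set0) ?/prob ?measure0 ?ltW //.
  by rewrite predeqE => x; split => // -[].
have [|mU vU] := vanishingU (vB m (ltnSn m)) (IH _).
  by move=> i im; apply/vB/ltnW.
have E n : [set x | exists2 i, (i < m.+1)%N & B i n x] =
    B m n `|` [set x | exists2 i, (i < m)%N & B i n x].
  rewrite predeqE => x; split => [[i]|[Bm|[i im Bi]]].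
  - rewrite ltnS leq_eqVlt => /orP[/eqP ->|im Bi]; [by left|by right; exists i].
  - by exists m.
  - by exists i => //; apply: ltnW.
by split=> [n|e e0]; [rewrite E|apply: filterS (vU e e0) => n; rewrite E].
Qed.

Lemma whp_of_vanishing A B : vanishing B ->
  (\forall n \near \oo, forall x, ~ B n x -> A n x) -> whp P A.
Proof.
move=> [mB vB] [N _ BA].
(* Before [N] nothing is known about [A n], and the empty event serves. *)
exists (fun n => if (N <= n)%N then ~` B n else set0); split.
- by move=> n; case: ifP => // _; apply: measurableC.
- by move=> n x; case: ifP => // Nn; apply: BA.
apply/fine_cvgP; split.
  by apply: nearW => n; rewrite fin_num_measure //; case: ifP => // _; apply: measurableC.
apply/cvgrPdist_le => e e0; near=> n.
have Nn : (N <= n)%N by near: n; exists N.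
rewrite /= Nn probability_setC // -(EFin_prob (P n) (mB n)) /= opprB addrC subrK.
rewrite ger0_norm ?prob_ge0 //; near: n; exact: vB.
Unshelve. all: by end_near. Qed.

End Vanishing.

(** * The asymptotic regime *)

Section Regime.
Variables (R : realType) (omega : nat -> R).
Hypothesis homega : omega n @[n --> \oo] --> +oo.

Definition logn (n : nat) : R := ln n%:R.
Definition loglogn (n : nat) : R := ln (logn n).
Definition slow (n : nat) : R := Num.min (omega n / 2) (loglogn n / 4).

Lemma logn_large A : \forall n \near \oo, A <= logn n.
Proof.
near=> n; have nA : expR A <= n%:R.
  by near: n; apply: nbhs_infty_ger.
rewrite /logn -ler_expR lnK //.
by rewrite posrE (lt_le_trans _ nA) // expR_gt0.
Unshelve. all: by end_near. Qed.

Lemma loglogn_large A : \forall n \near \oo, A <= loglogn n.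
Proof.
apply: filterS (logn_large (expR A)) => n h; rewrite /loglogn -ler_expR lnK //.
by rewrite posrE (lt_le_trans _ h) // expR_gt0.
Qed.

Lemma slow_large A : \forall n \near \oo, A <= slow n.
Proof.
have hom : \forall n \near \oo, 2 * A <= omega n by move/cvgryPge: homega; apply.
apply: filterS2 (loglogn_large (4 * A)) hom => n h1 h2.
by rewrite /slow le_min; apply/andP; split; lra.
Qed.

Lemma expR_ge_sqr (x : R) : 0 <= x -> x ^+ 2 / 2 <= expR x.
Proof. by move=> /(expR_ge1Dxn 1); rewrite !factS fact0 !muln1; apply: le_trans; rewrite lerDr. Qed.

(** Asymptotics enter only through these inequalities at a single [n], with [A] a large and [e] a
    small constant. With n and log n written as exponentials, most estimates become linear in log n,
    log log n and w. *)
Definition regime A e n :=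
  [/\ (0 < n)%N, n%:R = expR (logn n), logn n = expR (loglogn n),
      slow n <= loglogn n / 4 & slow n <= omega n / 2] /\
  [/\ A <= logn n, A <= loglogn n, A <= slow n, loglogn n <= e * logn n &
      A * logn n ^+ 2 <= n%:R].

Lemma near_regime A e : 0 < e -> \forall n \near \oo, regime A e n.
Proof.
move=> e0.
(* The term [2 / e] gives log log n <= e log n by x^2/2 <= exp x. The multiple of [|A|] gives A (log
   n)^2 <= n by x^3/6 <= exp x, with room to spare. *)
pose A' := Num.max A (Num.max 1 (Num.max (2 / e) (48 * `|A|))).
have [[h1 h2] [h3 h4]] : [/\ A <= A' & 1 <= A'] /\ [/\ 2 / e <= A' & 48 * `|A| <= A'].
  by rewrite /A' !le_max !lexx !orbT.
apply: filterS3 (logn_large A') (loglogn_large A') (slow_large A') => n l1 l2 l3.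
have L0 : 0 < logn n by apply: lt_le_trans l1; apply: lt_le_trans h2.
have n0 : (0 < n)%N.
  by rewrite lt0n; apply: contraTneq L0 => ->; rewrite /logn ln0 // ltxx.
have nE : n%:R = expR (logn n) by rewrite /logn lnK // posrE ltr0n.
have LE : logn n = expR (loglogn n) by rewrite /loglogn lnK // posrE.
have lam0 : 0 < loglogn n by apply: lt_le_trans l2; apply: lt_le_trans h2.
split; split=> //; try by apply: le_trans h1 _.
- by rewrite /slow ge_min lexx orbT.
- by rewrite /slow ge_min lexx.
- have := expR_ge_sqr (ltW lam0); rewrite -LE => sq.
  have : 2 <= e * loglogn n by rewrite -ler_pdivrMl // mulrC; apply: le_trans l2.
  nra.
- have [A0|A0] := leP A 0.
    by apply: (@le_trans _ _ 0) => //; rewrite mulr_le0_ge0 // sqr_ge0.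
  rewrite (ger0_norm (ltW A0)) in h4; rewrite nE.
  have := expR_ge1Dxn 2 (ltW L0); rewrite !factS fact0 !muln1 => cube.
  apply: le_trans (_ : logn n ^+ 3 / 6 <= _); last first.
    by apply: le_trans cube; rewrite -[leLHS]add0r lerD //.
  rewrite exprSr; have : 0 <= logn n ^+ 2 by apply: sqr_ge0.
  nra.
Qed.

End Regime.

Lemma mul_expR_le (R : realType) (c x u v w : R) : 0 <= c -> x <= expR u -> u + v <= w ->
  c * (x * expR v) <= c * expR w.
Proof.
move=> c0 xu uvw; rewrite ler_wpM2l //; apply: (@le_trans _ _ (expR u * expR v)).
  by rewrite ler_wpM2r // expR_ge0.
by rewrite -expRD ler_expR.
Qed.

Lemma le_expR (R : realType) (x : R) : x <= expR x.
Proof. by apply: le_trans (expR_ge1Dx x); rewrite lerDr. Qed.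

(** * Estimates at the thresholds *)

Section Thresholds.
Variables (R : realType) (k j : nat) (omega : nat -> R).
Hypotheses (j0 : (0 < j)%N) (jk : (j < k)%N).

Local Notation L n := (logn R n).
Local Notation lam n := (loglogn R n).
Local Notation w n := (slow omega n).
Local Notation m := (j.+1%:R).
Local Notation r := ((k - j + 1)%:R).
Local Notation nu n := (faces_count R k n j).
Local Notation fr := ((k - j)`!%:R).

(* At [thr n y] a flower is met by [y] other hyperedges on average. *)
Definition thr n (y : R) : R := y / (r * nu n).
Definition ym n : R := m * L n + lam n - w n.
Definition yp n : R := m * L n + lam n + w n.
Definition pm n := thr n (ym n).
Definition pp n := thr n (yp n).
(** With the factor k + 2 the probability of staying lonely outweighs all [n ^ k.+1] hyperedges
    without the help of a birth probability. *)
Definition pB n := thr n (k.+2%:R * yp n).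

Lemma r_ge1 : 1 <= r :> R. Proof. by rewrite ler1n addn1. Qed.
Lemma fr_ge1 : 1 <= fr :> R. Proof. by rewrite ler1n fact_gt0. Qed.

Lemma nu_gt0 n : (0 < n)%N -> 0 < nu n.
Proof. by move=> n0; rewrite divr_gt0 ?exprn_gt0 ?ltr0n ?fact_gt0. Qed.

Lemma thr_nu n y a : (0 < n)%N -> thr n y * (a * nu n) = y * (a / r).
Proof.
move=> n0; have r0 : r != 0 :> R by rewrite gt_eqF // (lt_le_trans _ r_ge1).
have nu0 : nu n != 0 by rewrite gt_eqF // nu_gt0.
rewrite /thr; move: (nu n) nu0 r r0 => nu' nu0 r' r0; field.
by rewrite nu0 r0.
Qed.

Lemma expn_top n : (0 < n)%N -> n%:R ^+ k.+1 = n%:R ^+ j.+1 * fr * nu n.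
Proof.
move=> n0; have f0 : fr != 0 :> R by rewrite pnatr_eq0 -lt0n fact_gt0.
rewrite /faces_count mulrA [_ * fr * _]mulrAC mulfK // -exprD; congr (_ ^+ _).
by rewrite addSn subnKC // ltnW.
Qed.

Lemma expn_top_thr n y : (0 < n)%N ->
  n%:R ^+ k.+1 * thr n y = fr / r * (y * n%:R ^+ j.+1).
Proof.
move=> n0; have r0 : r != 0 :> R by rewrite gt_eqF // (lt_le_trans _ r_ge1).
have nu0 : nu n != 0 by rewrite gt_eqF // nu_gt0.
rewrite expn_top // /thr; move: (nu n) nu0 r r0 (n%:R ^+ _) fr => nu' nu0 r' r0 x f; field.
by rewrite nu0 r0.
Qed.

Lemma expn_thr n y : (0 < n)%N -> n%:R ^+ (k - j) * thr n y = fr / r * y.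
Proof.
move=> n0; have r0 : r != 0 :> R by rewrite gt_eqF // (lt_le_trans _ r_ge1).
have f0 : fr != 0 :> R by rewrite pnatr_eq0 -lt0n fact_gt0.
have x0 : n%:R ^+ (k - j) != 0 :> R by rewrite expf_neq0 // pnatr_eq0 -lt0n.
rewrite /thr /faces_count; move: r r0 fr f0 (n%:R ^+ _) x0 => r' r0 f f0 x x0; field.
by rewrite x0 f0 r0.
Qed.

Lemma expn_pred_thr n y : (0 < n)%N ->
  n%:R ^+ (k - j - 1) * thr n y = fr / r * y / n%:R.
Proof.
move=> n0; have x0 : n%:R != 0 :> R by rewrite pnatr_eq0 -lt0n.
rewrite -(expn_thr y n0) [RHS]mulrAC; congr (_ * _); apply: (canRL (mulfK x0)).
by rewrite -exprSr -subnDA addn1 subnSK.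
Qed.

Section AtScale.
Variables (A e : R) (n : nat).
Hypotheses (A1 : 1 <= A) (e0 : 0 < e) (e1 : e <= 1) (reg : regime omega A e n).

Lemma regime_order : [/\ (0 < n)%N, 1 <= w n, 4 * w n <= lam n, lam n <= L n & 1 <= L n].
Proof.
have [[n0 _ _ wl _] [AL Al Aw lL _]] := reg.
have L1 : 1 <= L n by apply: le_trans AL.
split=> //; first by apply: le_trans Aw.
  by lra.
by apply: le_trans lL _; rewrite ler_piMl // (le_trans ler01).
Qed.

Lemma regime_n : n%:R = expR (L n). Proof. by have [[]] := reg. Qed.
Lemma regime_L : L n = expR (lam n). Proof. by have [[]] := reg. Qed.

Lemma regime_expn a : n%:R ^+ a = expR (a%:R * L n).
Proof. by rewrite regime_n expRM_natl. Qed.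

Lemma ym_bounds : m * L n <= ym n /\ ym n <= (m + 1) * L n.
Proof.
have [_ w1 wl lL L1] := regime_order; rewrite /ym.
by split; [lra|rewrite mulrDl mul1r; lra].
Qed.

Lemma yp_bounds : m * L n <= yp n /\ yp n <= (m + 2) * L n.
Proof.
have [_ w1 wl lL L1] := regime_order; rewrite /yp.
by split; [lra|rewrite mulrDl; lra].
Qed.

Lemma thr_ge0 y : 0 <= y -> 0 <= thr n y.
Proof.
move=> y0; have [n0 _ _ _ _] := regime_order.
by rewrite divr_ge0 // mulr_ge0 // ltW // nu_gt0.
Qed.

(** The left side is of order log n / n. This supplies the smallness condition of [first_moment]. *)
Lemma thr_small y (c : R) (M : nat) : 0 <= y -> y <= c * L n -> fr * c * M%:R <= A ->
  thr n y * M%:R * n%:R ^+ (k - j - 1) <= 1.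
Proof.
move=> y0 yc cA; have [n0 w1 wl lL L1] := regime_order.
have [_ [_ _ _ _ AL2]] := reg; have n1 : 0 < n%:R :> R by rewrite ltr0n.
rewrite mulrAC [_ * n%:R ^+ _]mulrC expn_pred_thr // mulrAC ler_pdivrMr // mul1r.
apply: le_trans AL2; apply: (@le_trans _ _ (fr * c * M%:R * L n ^+ 2)); last first.
  by rewrite ler_wpM2r // sqr_ge0.
have fr_r : fr / r <= fr :> R by rewrite ler_pdivrMr ?(lt_le_trans _ r_ge1) // ler_peMr ?r_ge1.
have y1 : fr / r * y <= fr * (c * L n).
  by apply: ler_pM => //; rewrite divr_ge0.
rewrite (_ : fr * c * M%:R * L n ^+ 2 = fr * (c * L n) * M%:R * L n); last by ring.
apply: (@le_trans _ _ (fr * (c * L n) * M%:R)).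
  by rewrite ler_wpM2r.
rewrite ler_peMr // mulr_ge0 // mulr_ge0 //.
by apply: le_trans yc.
Qed.

Lemma thr_le1 y (c : R) : 0 <= y -> y <= c * L n -> fr * c <= A -> thr n y <= 1.
Proof.
move=> y0 yc cA; have := @thr_small y c 1 y0 yc; rewrite !mulr1 => /(_ cA).
apply: le_trans; rewrite ler_peMr ?thr_ge0 //.
by rewrite -natrX ler1n expn_gt0; have [-> _ _ _ _] := regime_order.
Qed.

Lemma fr_r_le : fr / r <= fr :> R.
Proof. by rewrite ler_pdivrMr ?(lt_le_trans _ r_ge1) // ler_peMr ?r_ge1. Qed.

Lemma pp_sub_pm : pp n - pm n = thr n (2 * w n).
Proof. by rewrite /pp /pm /thr -mulrBl; congr (_ * _); rewrite /yp /ym; ring. Qed.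

Lemma scale_top (c y u : R) : n%:R ^+ k.+1 * (c * (thr n y * expR u)) =
  c * (fr / r) * (y * expR (m * L n + u)).
Proof.
have [n0 _ _ _ _] := regime_order.
rewrite [in RHS]expRD -regime_expn; have := expn_top_thr y n0.
move: (thr n y) (fr / r) (expR u) (n%:R ^+ k.+1) (n%:R ^+ j.+1) => p f x a b h.
by transitivity (c * ((a * p) * x)); [ring|rewrite h; ring].
Qed.

(** The left side is of order w exp(w) / log n. It is small because [4 * w n] is at most log log n,
    which is why [slow] has this cap. *)
Lemma late_small (c : R) : 0 <= c ->
  n%:R ^+ k.+1 * (c * ((pp n - pm n) * expR (1 - pm n * (r * nu n)))) <=
  c * fr * 2 * expR 1 * expR (- w n).
Proof.
move=> c0; have [n0 w1 wl lL L1] := regime_order.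
have r0 : r != 0 :> R by rewrite gt_eqF // (lt_le_trans _ r_ge1).
rewrite pp_sub_pm thr_nu // divff // mulr1.
have -> : n%:R ^+ k.+1 * (c * (thr n (2 * w n) * expR (1 - ym n))) =
    c * (fr / r) * 2 * (w n * expR (m * L n + (1 - ym n))).
  by rewrite scale_top; ring.
apply: (@le_trans _ _ (c * (fr / r) * 2 * expR (1 - w n))).
  apply: mul_expR_le (le_expR _) _; first by rewrite !mulr_ge0 // divr_ge0.
  by rewrite /ym; lra.
rewrite -[leRHS]mulrA -expRD; rewrite ler_wpM2r ?expR_ge0 // ler_wpM2r //.
by rewrite ler_wpM2l // fr_r_le.
Qed.

(** The birth probability contributes one factor log n, which the term log log n in [yp] cancels. *)
Lemma middle_small (c : R) : 0 <= c ->
  n%:R ^+ k.+1 * (c * (pB n * expR (1 - pp n * (r * nu n)))) <=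
  c * fr * k.+2%:R * (m + 2) * expR 1 * expR (- w n).
Proof.
move=> c0; have [n0 w1 wl lL L1] := regime_order.
have [yp1 yp2] := yp_bounds.
have r0 : r != 0 :> R by rewrite gt_eqF // (lt_le_trans _ r_ge1).
rewrite thr_nu // divff // mulr1.
have -> : n%:R ^+ k.+1 * (c * (pB n * expR (1 - yp n))) =
    c * (fr / r) * k.+2%:R * (yp n * expR (m * L n + (1 - yp n))).
  by rewrite scale_top; move: k.+2%:R => k2; ring.
have m2 : 0 <= (m + 2 : R) by rewrite addr_ge0.
apply: (@le_trans _ _ (c * (fr / r) * k.+2%:R * ((m + 2) * L n * expR (m * L n + (1 - yp n))))).
  by rewrite ler_wpM2l ?mulr_ge0 ?divr_ge0 // ler_wpM2r ?expR_ge0.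
rewrite -[_ * L n * _]mulrA mulrA; apply: (@le_trans _ _ (c * (fr / r) * k.+2%:R * (m + 2) * expR (1 - w n))).
  apply: mul_expR_le (_ : L n <= expR (lam n)) _; first by rewrite !mulr_ge0 // divr_ge0.
    by rewrite -regime_L.
  by rewrite /yp; lra.
rewrite -[leRHS]mulrA -expRD; rewrite ler_wpM2r ?expR_ge0 // ler_wpM2r // ler_wpM2r //.
by rewrite ler_wpM2l // fr_r_le.
Qed.

Lemma last_small (c : R) : 0 <= c ->
  n%:R ^+ k.+1 * (c * expR (1 - pB n * (r * nu n))) <= c * expR 1 * expR (- w n).
Proof.
move=> c0; have [n0 w1 wl lL L1] := regime_order.
have [yp1 yp2] := yp_bounds.
have r0 : r != 0 :> R by rewrite gt_eqF // (lt_le_trans _ r_ge1).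
rewrite thr_nu // divff // mulr1 mulrCA -[leRHS]mulrA ler_wpM2l // regime_expn -!expRD ler_expR.
have m1 : 1 <= m :> R by rewrite ler1n.
have k0 : 0 <= k%:R :> R by [].
rewrite -!natr1.
have : L n <= yp n by apply: le_trans yp1; rewrite ler_peMl // (le_trans ler01).
nra.
Qed.

(* One more uncovered set costs a factor [n ^ (- m / r)]. *)
Lemma extra_exponent (i : nat) : e * (r * (i%:R + 1)) <= 1 ->
  i%:R * lam n + (m * L n + (1 - ym n * ((k - j + 1).+1%:R / r))) <= 1 - w n.
Proof.
move=> ei; have i0 : 0 <= i%:R :> R by [].
have [n0 w1 wl lL L1] := regime_order.
have r1 := r_ge1; have r0 : 0 < r :> R by apply: lt_le_trans r1.
have [ym1 ym2] := ym_bounds.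
have -> : (k - j + 1).+1%:R / r = 1 + r^-1 :> R.
  by rewrite -natr1 mulrDl divff ?mul1r // gt_eqF.
have [_ [_ _ _ le _]] := reg.
have m1 : 1 <= m :> R by rewrite ler1n.
have Lym : L n <= ym n by apply: le_trans ym1; rewrite ler_peMl // (le_trans ler01).
have : (i%:R + 1) * lam n <= ym n / r.
  rewrite ler_pdivlMr //; apply: le_trans Lym.
  apply: (@le_trans _ _ ((i%:R + 1) * (e * L n) * r)).
    by rewrite ler_wpM2r ?(ltW r0) // ler_wpM2l // addr_ge0.
  rewrite (_ : (i%:R + 1) * (e * L n) * r = e * (r * (i%:R + 1)) * L n); last by ring.
  by rewrite ler_piMl // (le_trans ler01).
have : ym n = m * L n + lam n - w n by [].
rewrite mulrDr mulr1; lra.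
Qed.

Lemma isolated_small (c : R) : 0 <= c -> e * (r * 2) <= 1 ->
  n%:R ^+ k.+1 * (c * (pm n * expR (1 - pm n * ((k - j + 1).+1%:R * nu n)))) <=
  c * fr * (m + 1) * expR 1 * expR (- w n).
Proof.
move=> c0 er; have [n0 w1 wl lL L1] := regime_order.
have [ym1 ym2] := ym_bounds; rewrite thr_nu //.
set E := 1 - _.
have -> : n%:R ^+ k.+1 * (c * (pm n * expR E)) =
    c * (fr / r) * (ym n * expR (m * L n + E)).
  by rewrite scale_top; ring.
apply: (@le_trans _ _ (c * (fr / r) * ((m + 1) * L n * expR (m * L n + E)))).
  by rewrite ler_wpM2l ?mulr_ge0 ?divr_ge0 // ler_wpM2r ?expR_ge0.
rewrite -[_ * L n * _]mulrA mulrA; apply: (@le_trans _ _ (c * (fr / r) * (m + 1) * expR (1 - w n))).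
  apply: mul_expR_le (_ : L n <= expR (lam n)) _.
  - by rewrite !mulr_ge0 ?divr_ge0 ?addr_ge0.
  - by rewrite -regime_L.
  - by have := @extra_exponent 1; rewrite mul1r; apply.
rewrite -[leRHS]mulrA -expRD; rewrite ler_wpM2r ?expR_ge0 // ler_wpM2r ?addr_ge0 //.
by rewrite ler_wpM2l // fr_r_le.
Qed.

(** Three factors of log n arise: from the birth of the first hyperedge, from the window of the
    second and from the possible hyperedge above the extra face. [extra_exponent] with [i = 3]
    absorbs them. *)
Lemma merging_small (c E : R) : 0 <= c -> e * (r * 4) <= 1 ->
  E = expR (1 - pm n * ((k - j + 1).+1%:R * nu n)) ->
  n%:R ^+ k.+1 * (n%:R ^+ (k - j) * (c * (pm n * (pp n - pm n) * E +
    n%:R ^+ (k - j) * (pm n ^+ 2 * (pp n - pm n) * E)))) <=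
  c * (fr ^+ 3 * (m + 1) * 2 * (m + 2)) * expR 1 * expR (- w n).
Proof.
move=> c0 er ->; have [n0 w1 wl lL L1] := regime_order.
have [ym1 ym2] := ym_bounds; rewrite thr_nu // {E}.
set E := 1 - _; rewrite pp_sub_pm.
have m0 : 0 <= m :> R by [].
have y0 : 0 <= ym n by apply: le_trans ym1; rewrite mulr_ge0 // (le_trans ler01).
have f1 := fr_ge1; have f0 : 0 <= fr / r :> R by rewrite divr_ge0.
have -> : n%:R ^+ k.+1 * (n%:R ^+ (k - j) * (c * (pm n * thr n (2 * w n) * expR E +
    n%:R ^+ (k - j) * (pm n ^+ 2 * thr n (2 * w n) * expR E)))) =
  c * ((fr / r * ym n) * (fr / r * (2 * w n)) * (1 + fr / r * ym n) * expR (m * L n + E)).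
  rewrite [in RHS]expRD -regime_expn.
  have h1 := expn_top_thr (ym n) n0; have h2 := expn_thr (2 * w n) n0.
  have h3 := expn_thr (ym n) n0; rewrite -/(pm n) in h1 h3.
  move: h1 h2 h3; rewrite /pm; move: (thr n (ym n)) (thr n (2 * w n)) (fr / r) (expR E).
  move: (n%:R ^+ k.+1) (n%:R ^+ (k - j)) (n%:R ^+ j.+1) => a b x p q f u h1 h2 h3.
  transitivity (c * ((a * p) * (b * q) * (1 + b * p) * u)); first by ring.
  by rewrite h1 h2 h3; ring.
have yL : fr / r * ym n <= fr * ((m + 1) * L n).
  by apply: ler_pM => //; apply: fr_r_le.
have wL : fr / r * (2 * w n) <= fr * (2 * L n).
  apply: ler_pM => //; [by lra|exact: fr_r_le|by lra].
have oL : 1 + fr / r * ym n <= fr * ((m + 2) * L n).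
  apply: (@le_trans _ _ (fr * L n + fr * ((m + 1) * L n))).
    by rewrite lerD // mulr_ege1.
  by rewrite -mulrDr ler_wpM2l //; lra.
apply: (@le_trans _ _ (c * (fr * ((m + 1) * L n) * (fr * (2 * L n)) * (fr * ((m + 2) * L n)) *
    expR (m * L n + E)))).
  rewrite ler_wpM2l // ler_wpM2r ?expR_ge0 //.
  apply: ler_pM => //; [by rewrite !mulr_ge0 //; lra|by rewrite addr_ge0 // mulr_ge0|].
  by apply: ler_pM => //; rewrite mulr_ge0 //; lra.
have -> : c * (fr * ((m + 1) * L n) * (fr * (2 * L n)) * (fr * ((m + 2) * L n)) *
    expR (m * L n + E)) = c * (fr ^+ 3 * (m + 1) * 2 * (m + 2)) * (L n ^+ 3 * expR (m * L n + E)).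
  by move: fr m (expR _) => f m' u; ring.
rewrite -[leRHS]mulrA -expRD; apply: mul_expR_le (_ : L n ^+ 3 <= expR (3%:R * lam n)) _.
- by rewrite !mulr_ge0 ?addr_ge0 ?exprn_ge0.
- by rewrite regime_L expRM_natl -regime_L.
- by apply: (@extra_exponent 3) => //; apply: le_trans er; rewrite natr1.
Qed.

(** Chosen with [k.+1%:R * alpha = 1 / 4], so that a flower with centre of size i is still unmet at
    stage i + 1 with probability at least of order n^(-1/4). *)
Definition alpha : R := (4 * k.+1%:R)^-1.

(* For [p] from [stage i] to [stage i.+1] the flowers with centres of size [i]
   keep the complex from being connected. *)
Definition stage (i : nat) : R := alpha * L n / n%:R ^+ (k.+1 - i).

Lemma alpha_gt0 : 0 < alpha. Proof. by rewrite invr_gt0 mulr_gt0 ?ltr0n. Qed.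

Lemma stage_nu (M : R) : stage j.+1 * (M * nu n) = M * alpha / fr * L n.
Proof.
have [n0 _ _ _ _] := regime_order; rewrite /stage /faces_count subSS.
have x0 : n%:R ^+ (k - j) != 0 :> R by rewrite expf_neq0 // pnatr_eq0 -lt0n.
have f0 : fr != 0 :> R by rewrite pnatr_eq0 -lt0n fact_gt0.
move: (n%:R ^+ _) x0 fr f0 alpha (L n) => x x0 f f0 a l; field.
by rewrite x0 f0.
Qed.

Lemma apex_small (c M : R) : 0 <= c -> k.+2%:R * fr <= M * alpha ->
  n%:R ^+ k.+1 * (c * expR (1 - stage j.+1 * (M * nu n))) <= c * expR 1 * expR (- w n).
Proof.
move=> c0 Ma; have [n0 w1 wl lL L1] := regime_order.
rewrite stage_nu mulrCA -[leRHS]mulrA ler_wpM2l // regime_expn -!expRD ler_expR.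
have : k.+2%:R <= M * alpha / fr by rewrite ler_pdivlMr // (lt_le_trans _ fr_ge1).
move: (M * alpha / fr) => x; rewrite -!natr1 => kx; nra.
Qed.

Lemma vertex_small : e * 2 <= 1 -> n%:R ^+ k * stage 0 <= expR (- w n).
Proof.
move=> e2; have [n0 w1 wl lL L1] := regime_order.
have n1 : n%:R != 0 :> R by rewrite pnatr_eq0 -lt0n.
have -> : n%:R ^+ k * stage 0 = alpha * (L n * expR (- L n)).
  rewrite expRN -regime_n /stage subn0 exprSr.
  by move: n%:R n1 alpha (L n) => y y0 a l; field; rewrite y0 expf_neq0.
apply: (@le_trans _ _ (alpha * expR (- w n))).
  apply: mul_expR_le (_ : L n <= expR (lam n)) _; first exact/ltW/alpha_gt0.
    by rewrite -regime_L.
  have [_ [_ _ _ le _]] := reg; nra.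
rewrite ler_piMl ?expR_ge0 // invf_le1 ?mulr_gt0 ?ltr0n // mulr_ege1 ?ler1n //.
Qed.

(* Lower bounds for the number of forbidden hyperedges, of the right order for
   bounded supports and with a worse constant for large ones. *)
Definition gam : R := (2 * (k - j - 1)`!%:R * j.+2%:R * (2 ^ k.+1)%:R)^-1.

Definition forbidden_lower (s0 s : nat) : R :=
  if (s <= s0)%N then s%:R * nu n - (s * (k * k.+1) + s * s)%:R * n%:R ^+ (k - j - 1)
  else s%:R * (gam * n%:R ^+ (k - j)).

Lemma gam_gt0 : 0 < gam.
Proof. by rewrite invr_gt0 !mulr_gt0 ?ltr0n ?fact_gt0 ?expn_gt0. Qed.

(** For large supports the isoperimetric inequality gives [n * #|S| / j.+2] sets in the coboundary,
    each below order n^(k-j-1) forbidden hyperedges, with repetition at most [2 ^ k.+1]. These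
    constants make up [gam]. *)
Lemma forbidden_lowerP (s0 : nat) (S : {set {set 'I_n}}) : (2 * (k * k.+1))%:R <= A ->
  (forall s, s \in S -> #|s| = j.+1) ->
  (n * #|S| <= j.+2 * #|supp (cobd (ind S))|)%N ->
  forbidden_lower s0 #|S| <= #|forbidden k (ind S)|%:R.
Proof.
move=> kA uS iso; rewrite /forbidden_lower; have [n0 w1 wl lL L1] := regime_order.
case: ifP => _.
  have h := card_forbidden_small jk uS; rewrite card_ord in h.
  move: h; rewrite -(ler_nat R) natrD !natrM natrX => h.
  have fc := ler_wpM2l (ler0n R #|S|) (faces_count_le_bin R n jk).
  rewrite natrD !natrM mulrDl; rewrite mulrBr natrM in fc.
  lra.
have dS : degree j.+1 (ind S) by apply/degreeP => s; rewrite ind_neq0 => /uS.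
have h := card_forbidden_large jk dS; rewrite card_ord in h.
have kn : (2 * (k * k.+1) <= n)%N.
  rewrite -(ler_nat R); apply: le_trans kA _; have [_ [_ _ _ _]] := reg.
  by apply: le_trans; rewrite ler_peMr // ?exprn_ege1 // (le_trans ler01).
have kj : (0 < k - j)%N by rewrite subn_gt0.
set q := (k - j - 1)%N in h *.
have kq : (k - j = q.+1)%N by rewrite /q subn1 prednK.
have hq : (n ^ q <= 2 * ('C(n - j.+2, q) * q`!))%N.
  have := expn_le_bin n j.+2 q.
  case E: (q) => [|q']; first by rewrite expn0 bin0 fact0.
  have qk : (q'.+1 * (j.+2 + q'.+1) <= k * k.+1)%N.
    rewrite -E /q -subnDA addn1; apply: leq_mul; first exact: leq_subr.
    by rewrite addSn subnKC.
  rewrite [q'.+1.-1]/= => le.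
  have : (2 * (q'.+1 * (j.+2 + q'.+1) * n ^ q') <= n ^ q'.+1)%N.
    by rewrite expnS mulnA leq_mul2r (leq_trans _ kn) ?orbT // leq_mul2l qk orbT.
  move: le; move: (n ^ q'.+1)%N ('C(_, _) * _)%N (q'.+1 * _ * _)%N => a b c; clear; lia.
rewrite /gam kq -/q mulrCA mulrC ler_pdivrMr; last by rewrite !mulr_gt0 ?ltr0n ?fact_gt0 ?expn_gt0.
rewrite -natrX -!natrM ler_nat.
apply: (@leq_trans (n * #|S| * (2 * ('C(n - j.+2, q) * q`!)))).
  by rewrite expnS mulnCA mulnA leq_mul.
apply: (@leq_trans (2 * q`! * j.+2 * (#|supp (cobd (ind S))| * 'C(n - j.+2, q)))).
  apply: (@leq_trans (j.+2 * #|supp (cobd (ind S))| * (2 * ('C(n - j.+2, q) * q`!)))).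
    by rewrite leq_mul2r iso orbT.
  by apply: eq_leq; ring.
apply: (@leq_trans (2 * q`! * j.+2 * (2 ^ k.+1 * #|forbidden k (ind S)|))).
  by rewrite leq_mul2l h orbT.
by rewrite subn1 mulnA mulnC.
Qed.

(** The exploration costs at most (log n)^(4s). For [s] up to [s0] the support has more than r sets,
    and [extra_exponent] pays for this bounded power. Beyond [s0] the forbidden hyperedges outweigh
    the exploration and the choice of a start, and what remains is small enough to be summed over
    all sizes. *)
Lemma term_small (c : R) (s0 s : nat) : 0 <= c ->
  1 + fr * (m + 1) * c <= A -> fr * (m + 1) * (s0 * (k * k.+1) + s0 * s0)%:R <= A ->
  e * (r * ((4 * s0)%:R + 1)) <= 1 -> e * 8 <= gam * (fr / r) ->
  2 * (2 * m + 1) <= s0%:R * (gam * (fr / r)) ->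
  (k - j + 1 < s)%N ->
  n%:R ^+ j.+1 * ((1 + pm n * (n%:R ^+ (k - j) * c)) ^+ (2 * s) *
    expR (- (pm n * forbidden_lower s0 s))) <=
  (s <= s0)%N%:R * (expR 2 * expR (- w n)) + expR (- ((m + 1) * L n)).
Proof.
move=> c0 cA MA es eg gs rs; have [n0 w1 wl lL L1] := regime_order.
have [ym1 ym2] := ym_bounds; have L0 : 0 <= L n by apply: le_trans L1.
have m1 : 1 <= m :> R by rewrite ler1n.
have f1 := fr_ge1; have y0 : 0 <= ym n by apply: le_trans ym1; rewrite mulr_ge0.
have p0 : 0 <= pm n by apply: thr_ge0.
have base : 1 + pm n * (n%:R ^+ (k - j) * c) <= expR (2 * lam n).
  have -> : pm n * (n%:R ^+ (k - j) * c) = fr / r * ym n * c.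
    by rewrite -(expn_thr _ n0) mulrCA mulrA.
  have [_ [AL _ _ _ _]] := reg.
  rewrite expRM_natl -regime_L expr2; apply: (@le_trans _ _ (A * L n)); last first.
    by rewrite ler_wpM2r.
  apply: (@le_trans _ _ ((1 + fr * (m + 1) * c) * L n)); last by rewrite ler_wpM2r.
  rewrite mulrDl mul1r lerD //.
  rewrite [leRHS]mulrAC ler_wpM2r // -[leRHS]mulrA.
  by apply: ler_pM => //; exact: fr_r_le.
have pow : (1 + pm n * (n%:R ^+ (k - j) * c)) ^+ (2 * s) <= expR ((4 * s)%:R * lam n).
  have -> : (4 * s)%:R * lam n = (2 * s)%:R * (2 * lam n) by rewrite !natrM; ring.
  rewrite expRM_natl; apply: lerXn2r; rewrite ?nnegrE ?expR_ge0 //.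
  by rewrite addr_ge0 // mulr_ge0 // mulr_ge0 // exprn_ge0.
rewrite regime_expn.
apply: (@le_trans _ _ (expR (m * L n + ((4 * s)%:R * lam n - pm n * forbidden_lower s0 s)))).
  by rewrite expRD ler_wpM2l ?expR_ge0 // expRD ler_wpM2r ?expR_ge0.
rewrite /forbidden_lower; have [ss0|s0s] := leqP s s0.
  rewrite mul1r; apply: (@le_trans _ _ (expR 2 * expR (- w n))); last by rewrite lerDl expR_ge0.
  rewrite -expRD ler_expR mulrBr thr_nu //.
  have small : pm n * ((s * (k * k.+1) + s * s)%:R * n%:R ^+ (k - j - 1)) <= 1.
    rewrite mulrA; apply: (thr_small (c := m + 1)) => //; apply: le_trans MA.
    rewrite ler_wpM2l // ?ler_nat ?leq_add ?leq_mul //.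
  have le_s : ym n * ((k - j + 1).+1%:R / r) <= ym n * (s%:R / r).
    by rewrite ler_wpM2l // ler_wpM2r // ler_nat.
  have le4 : (4 * s)%:R * lam n <= (4 * s0)%:R * lam n.
    by rewrite ler_wpM2r ?ler_nat ?leq_mul2l ?ss0 ?orbT //; lra.
  have := extra_exponent es; lra.
rewrite mul0r add0r ler_expR.
have -> : pm n * (s%:R * (gam * n%:R ^+ (k - j))) = s%:R * (gam * (fr / r) * ym n).
  rewrite -mulrA -(expn_thr _ n0) -/(pm n).
  by move: (pm n) (n%:R ^+ _) s%:R gam => p x y z; ring.
set g := gam * (fr / r) in eg gs *.
have g0 : 0 <= g by rewrite mulr_ge0 ?divr_ge0 // ltW ?gam_gt0.
clearbody g; have [_ [_ _ _ le _]] := reg.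
have Lym : L n <= ym n by apply: le_trans ym1; rewrite ler_peMl.
have sg : 2 * (2 * m + 1) <= s%:R * g.
  by apply: le_trans gs _; rewrite ler_wpM2r // ler_nat ltnW.
have half : (4 * s)%:R * lam n <= s%:R * g * L n / 2.
  rewrite natrM [4%:R * _]mulrC -!mulrA ler_wpM2l //.
  by have := ler_wpM2r L0 eg; lra.
have full : s%:R * g * L n <= s%:R * (g * ym n).
  by rewrite -mulrA ler_wpM2l // ler_wpM2l.
have := ler_wpM2r L0 sg; lra.
Qed.

Lemma sum_few (N s0 : nat) (x : R) : 0 <= x ->
  \sum_(s < N) (s <= s0)%N%:R * x <= s0.+1%:R * x.
Proof.
move=> x0; rewrite -mulr_suml ler_wpM2r // -natr_sum ler_nat.
elim: N => [|N IH]; first by rewrite big_ord0.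
have [Ns|sN] := leqP N.+1 s0.+1.
  apply: (@leq_trans (\sum_(s < N.+1) 1)%N).
    by apply: leq_sum => s _; exact: leq_b1.
  by rewrite sum1_card card_ord.
by rewrite ltnS ltnNge in sN; rewrite big_ord_recr /= (negbTE sN) addn0.
Qed.

Lemma base_small (c : R) (s0 : nat) : 0 <= c ->
  1 + fr * (m + 1) * c <= A -> fr * (m + 1) * (s0 * (k * k.+1) + s0 * s0)%:R <= A ->
  e * (r * ((4 * s0)%:R + 1)) <= 1 -> e * 8 <= gam * (fr / r) ->
  2 * (2 * m + 1) <= s0%:R * (gam * (fr / r)) ->
  \sum_(s < (n ^ j.+1).+1 | (k - j + 1 < s)%N) n%:R ^+ j.+1 *
     ((1 + pm n * (n%:R ^+ (k - j) * c)) ^+ (2 * s) * expR (- (pm n * forbidden_lower s0 s))) <=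
  (s0.+1%:R * expR 2 + 2) * expR (- w n).
Proof.
move=> c0 cA MA es eg gs; have [n0 w1 wl lL L1] := regime_order.
apply: (@le_trans _ _ (\sum_(s < (n ^ j.+1).+1)
    ((s <= s0)%N%:R * (expR 2 * expR (- w n)) + expR (- ((m + 1) * L n))))).
  rewrite big_mkcond; apply: ler_sum => s _; case: ifP => rs; first exact: term_small.
  by rewrite addr_ge0 ?mulr_ge0 ?expR_ge0.
rewrite big_split /= [leRHS]mulrDl -mulrA lerD //.
  by apply: sum_few; rewrite mulr_ge0 ?expR_ge0.
rewrite sumr_const card_ord -[leLHS]mulr_natl.
apply: (@le_trans _ _ (2 * (n%:R ^+ j.+1 * expR (- ((m + 1) * L n))))).
  rewrite mulrA ler_wpM2r ?expR_ge0 // -natr1 natrX [leRHS]mulrDl mul1r lerD2l.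
  by rewrite -natrX ler1n expn_gt0 n0.
rewrite ler_wpM2l // regime_expn -expRD ler_expR; lra.
Qed.

End AtScale.

End Thresholds.

(** * Numbers of hosts at the successive stages *)

Section HostsAtScale.
Context (R : realType) (k n j : nat) (omega : nat -> R).
Context d (T : measurableType d) (P : probability T R) (b : hyperedge k n -> {RV P >-> R}).
Hypothesis hb : iid_uniform01 b.
Hypotheses (j0 : (0 < j)%N) (jk : (j < k)%N).
Variables (A e : R).
Hypotheses (A1 : 1 <= A) (e0 : 0 < e) (e1 : e <= 1) (e4 : e * 8 <= 1).
Hypothesis reg : regime omega A e n.

Local Notation L := (logn R n).
Local Notation lam := (loglogn R n).
Local Notation w := (slow omega n).
Local Notation m := (j.+1%:R).
Local Notation fr := ((k - j)`!%:R).
Local Notation cc := (fr * (m + 1) : R).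

Hypotheses (A2 : 2 * (k.+1 * k.+1 * k.+1)%:R * cc ^+ 2 <= A) (A3 : 2 * (k.+1 * k.+1)%:R <= A).

(** The hyperedges of stage i, about n^i log n, would not leave enough isolated flowers at the next
    stage, but the n^(i+1/2) or so of the half stage do. Until the half stage few flowers are
    met. *)
Definition half_stage (i : nat) : R := expR (L / 2) / n%:R ^+ (k.+1 - i).

Let order := regime_order A1 e1 reg.

Lemma scale_small : L / n%:R <= expR (- w).
Proof.
have [n0 w1 wl lL L1] := order; rewrite (regime_n reg) -expRN [X in X * _](regime_L reg).
rewrite -expRD ler_expR; have [_ [_ _ _ le _]] := reg.
by have := ler_wpM2r (le_trans ler01 L1) e4; lra.
Qed.

Lemma cc_ge1 : 1 <= cc.
Proof. by rewrite mulr_ege1 ?fr_ge1 // lerDr. Qed.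

Lemma bin_top : n%:R ^+ k.+1 / (2 * (k.+1)`!%:R) <= 'C(n, k.+1)%:R :> R.
Proof.
have [n0 w1 wl lL L1] := order; have [_ [_ _ _ _ AL]] := reg.
have kn : (2 * (k.+1 * k.+1) <= n)%N.
  rewrite -(ler_nat R) natrM; apply: le_trans A3 (le_trans _ AL).
  by rewrite ler_peMr ?exprn_ege1 // (le_trans ler01).
rewrite ler_pdivrMr ?mulr_gt0 ?ltr0n ?fact_gt0 // -natrX mulrCA -!natrM ler_nat.
have := expn_le_bin n 0 k.+1; rewrite subn0 add0n.
have : (2 * (k.+1 * k.+1 * n ^ k) <= n ^ k.+1)%N by rewrite mulnA expnS leq_mul2r kn orbT.
by rewrite [_.+1.-1]/=; move: (_ * n ^ k)%N (n ^ k.+1)%N (_ * _`!)%N => x y z; clear; lia.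
Qed.

(** [hosts_bound] with leading terms for the binomial coefficients. The [- 1] in the exponent pays
    for the quadratic error of [expR_le_onem], the factor 2 in the denominator for [bin_top]. *)
Lemma hosts_at_scale (i : nat) (q q' mu : R) : (i < k)%N -> 0 <= q -> q <= q' ->
  q' * n%:R ^+ (k - i) <= cc * L -> 0 < mu ->
  mu <= n%:R ^+ k.+1 / (2 * (k.+1)`!%:R) *
    (q * expR (- (q' * ((k - i + 1)%:R * faces_count R k n i)) - 1)) ->
  prob P [set x | 2 * #|[set K | host k i K
    (born (fun e => b e x) q, born (fun e => b e x) q')]%SET|%:R < mu] <=
  4 * (mu^-1 + 2 * ((k.+1 * k.+1)%:R * cc * expR (- w))).
Proof.
move=> ik q0 qq' q'c mu0 mule; have [n0 w1 wl lL L1] := order.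
have n1 : 0 < n%:R :> R by rewrite ltr0n.
have [_ [_ _ _ _ AL]] := reg; have q'0 := le_trans q0 qq'.
have c1 := cc_ge1; have c0 : 0 <= cc := le_trans ler01 c1.
have L0 : 0 <= L := le_trans ler01 L1.
have kk1 : 1 <= (k.+1 * k.+1)%:R :> R by rewrite ler1n.
have ki : (k - i = (k - i - 1).+1)%N by rewrite subn1 prednK // subn_gt0.
have qn : q' * n%:R ^+ (k - i - 1) <= cc * (L / n%:R).
  by rewrite mulrA ler_pdivlMr // -[leLHS]mulrA -exprSr -ki.
have cLn : (k.+1 * k.+1)%:R * cc * (L / n%:R) <= 1 / 2.
  rewrite mulrA ler_pdivrMr // mul1r ler_pdivlMl //; apply: le_trans AL.
  apply: le_trans (_ : A * L <= _); last first.
    by rewrite expr2 mulrA ler_peMr // mulr_ge0 // (le_trans ler01).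
  rewrite [leLHS]mulrA ler_wpM2r //; apply: le_trans A2.
  rewrite [leLHS]mulrA; apply: ler_pM => //; rewrite ?mulr_ge0 //.
    by rewrite ler_wpM2l // ler_nat leq_pmulr.
  by rewrite expr2 ler_peMr.
have z12 : q' * (k.+1 * k.+1 * n ^ (k - i - 1))%:R <= (k.+1 * k.+1)%:R * cc * (L / n%:R).
  by rewrite natrM natrX mulrCA -mulrA ler_wpM2l.
have q'n : q' <= cc * (L / n%:R).
  by apply: le_trans qn; rewrite ler_peMr // exprn_ege1 // ler1n.
have q'2 : q' <= 1 / 2.
  apply: le_trans q'n (le_trans _ cLn); rewrite -[leRHS]mulrA ler_peMl //.
  by rewrite mulr_ge0 // divr_ge0.
have := hosts_bound hb ik q0 qq' _ mu0 (le_trans z12 cLn).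
have -> : q' <= 1 by apply: le_trans q'2 _; lra.
move=> /(_ isT) H; apply: (le_trans (H _)).
  apply: (le_trans mule); apply: ler_pM; rewrite ?divr_ge0 ?mulr_ge0 ?exprn_ge0 ?expR_ge0 //.
    exact: bin_top.
  rewrite ler_wpM2l //; apply: le_trans (expR_le_onem _ _); last by rewrite q'0.
  rewrite ler_expR; set M := ((k - i + 1) * _)%N.
  have Mf : M%:R <= (k - i + 1)%:R * faces_count R k n i.
    by rewrite natrM ler_wpM2l // bin_le_faces_count.
  have q'M : q' * M%:R <= k.+1%:R * (cc * L).
    apply: le_trans (ler_wpM2l q'0 Mf) _; rewrite mulrCA; apply: ler_pM => //.
    - by rewrite mulr_ge0 // divr_ge0 // exprn_ge0.
    - by rewrite ler_nat addn1 ltnS leq_subr.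
    - apply: le_trans q'c; rewrite ler_wpM2l // ler_pdivrMr ?ltr0n ?fact_gt0 //.
      by rewrite ler_peMr ?exprn_ge0 // ler1n fact_gt0.
  have sq : 2 * q' ^+ 2 * M%:R <= 1.
    have -> : 2 * q' ^+ 2 * M%:R = 2 * (q' * (q' * M%:R)) by ring.
    apply: (@le_trans _ _ (2 * (cc * (L / n%:R) * (k.+1%:R * (cc * L))))).
      by rewrite ler_wpM2l // ler_pM // mulr_ge0.
    have -> : 2 * (cc * (L / n%:R) * (k.+1%:R * (cc * L))) =
        2 * k.+1%:R * cc ^+ 2 * L ^+ 2 / n%:R.
      by move: n%:R^-1 cc k.+1%:R L => y c x l; ring.
    rewrite ler_pdivrMr // mul1r; apply: le_trans AL; rewrite ler_wpM2r ?sqr_ge0 //.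
    apply: le_trans A2; rewrite ler_wpM2r ?sqr_ge0 // ler_wpM2l // ler_nat.
    by rewrite leq_pmull.
  by have := ler_wpM2l q'0 Mf; lra.
rewrite ler_wpM2l // lerD2l ler_wpM2l //; apply: le_trans z12 _.
by rewrite ler_wpM2l ?mulr_ge0 // scale_small.
Qed.

Local Notation stage := (stage R k n).
Local Notation alpha := (alpha R k).
Local Notation Hosts i q q' := (fun x => [set K | host k i K
  (born (fun e => b e x) q, born (fun e => b e x) q')]%SET).

(** A constant small enough for all three host counts; its exponent is what [hosts_first] needs. *)
Definition host_density : R := alpha / (2 * (k.+1)`!%:R) * expR (- k.+1%:R - 1).

Definition host_error : R := 4 * (host_density^-1 + 2 * ((k.+1 * k.+1)%:R * cc)).

Lemma host_density_gt0 : 0 < host_density.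
Proof. by rewrite mulr_gt0 ?expR_gt0 // divr_gt0 ?alpha_gt0 // mulr_gt0 ?ltr0n ?fact_gt0. Qed.

Lemma alpha_le1 : alpha <= 1.
Proof. by rewrite invf_le1 ?mulr_gt0 ?ltr0n // mulr_ege1 ?ler1n. Qed.

Lemma host_errorE mu : host_density * expR w <= mu ->
  4 * (mu^-1 + 2 * ((k.+1 * k.+1)%:R * cc * expR (- w))) <= host_error * expR (- w).
Proof.
move=> mule; have d0 : 0 < host_density * expR w by rewrite mulr_gt0 ?expR_gt0 ?host_density_gt0.
have mu0 := lt_le_trans d0 mule.
rewrite /host_error -[leRHS]mulrA ler_wpM2l // [leRHS]mulrDl -!mulrA lerD2r.
by rewrite expRN -invfM lef_pV2.
Qed.

Lemma w_le_lam : w <= lam.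
Proof. by have [n0 w1 wl lL L1] := order; lra. Qed.

Lemma scale_host (i : nat) (a u : R) : (i <= k)%N ->
  n%:R ^+ k.+1 / (2 * (k.+1)`!%:R) * (a / n%:R ^+ (k.+1 - i) * u) =
  (2 * (k.+1)`!%:R)^-1 * a * u * n%:R ^+ i.
Proof.
move=> ik; have [n0 w1 wl lL L1] := order.
have -> : n%:R ^+ k.+1 = n%:R ^+ (k.+1 - i) * n%:R ^+ i :> R.
  by rewrite -exprD subnK // leqW.
have x0 : n%:R ^+ (k.+1 - i) != 0 :> R by rewrite expf_neq0 // pnatr_eq0 -lt0n.
have f0 : (k.+1)`!%:R != 0 :> R by rewrite pnatr_eq0 -lt0n fact_gt0.
by move: (n%:R ^+ _) x0 (n%:R ^+ i) _`!%:R f0 => x x0 y f f0; field; rewrite x0 f0.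
Qed.

Lemma faces_count_scale (i : nat) (a : R) : (i <= k)%N -> 0 <= a ->
  a / n%:R ^+ (k - i) * ((k - i + 1)%:R * faces_count R k n i) <= k.+1%:R * a.
Proof.
move=> ik a0; have [n0 _ _ _ _] := order; rewrite /faces_count.
have x0 : n%:R ^+ (k - i) != 0 :> R by rewrite expf_neq0 // pnatr_eq0 -lt0n.
have f1 : 1 <= (k - i)`!%:R :> R by rewrite ler1n fact_gt0.
have rk : (k - i + 1)%:R <= k.+1%:R :> R by rewrite ler_nat addn1 ltnS leq_subr.
have -> : a / n%:R ^+ (k - i) * ((k - i + 1)%:R * (n%:R ^+ (k - i) / (k - i)`!%:R)) =
    (k - i + 1)%:R * (a / (k - i)`!%:R).
  by rewrite mulrCA; congr (_ * _); rewrite mulrA divfK.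
apply: ler_pM => //; first by rewrite divr_ge0.
by rewrite ler_pdivrMr ?(lt_le_trans _ f1) // ler_peMr.
Qed.

(** About n^i log n hyperedges are born by stage i, and until the half stage a flower is met by a
    bounded number of others on average, so a positive fraction survives. *)
Lemma hosts_first (i : nat) : (i < k)%N ->
  prob P [set x | 2 * #|Hosts i (stage i) (half_stage i) x|%:R < host_density * L * n%:R ^+ i] <=
  host_error * expR (- w).
Proof.
move=> ik; have [n0 w1 wl lL L1] := order.
have n1 : 1 <= n%:R :> R by rewrite ler1n.
have a0 := alpha_gt0 R k; have a1 := alpha_le1; have d0 := host_density_gt0.
have L0 : 0 <= L := le_trans ler01 L1.
have ki : (k.+1 - i = (k - i).+1)%N by rewrite subSn // ltnW.
have lam8 : lam * 8 <= L.
  have [_ [_ _ _ le _]] := reg; have := ler_wpM2r L0 e4; lra.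
have Lhalf : L <= expR (L / 2) by rewrite (regime_L reg) ler_expR -(regime_L reg); lra.
have half_n : expR (L / 2) <= n%:R by rewrite (regime_n reg) ler_expR; lra.
have s_scale : half_stage i * n%:R ^+ (k - i) = expR (L / 2) / n%:R.
  rewrite /half_stage ki exprS; have nn0 : n%:R != 0 :> R by rewrite gt_eqF // (lt_le_trans ltr01).
  have x0 : n%:R ^+ (k - i) != 0 :> R by rewrite expf_neq0.
  by move: (n%:R ^+ _) x0 => x x0; move: n%:R nn0 => y y0; field; rewrite x0 y0.
have s_scale1 : half_stage i * n%:R ^+ (k - i) <= 1.
  by rewrite s_scale ler_pdivrMr ?mul1r // (lt_le_trans _ n1).
apply: le_trans (hosts_at_scale ik _ _ _ _ _) (host_errorE _).
- by rewrite divr_ge0 ?exprn_ge0 // mulr_ge0 // ltW.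
- rewrite ler_wpM2r ?invr_ge0 ?exprn_ge0 //; apply: le_trans Lhalf.
  by rewrite ler_piMl // ltW.
- by apply: le_trans s_scale1 _; rewrite mulr_ege1 ?cc_ge1.
- by rewrite !mulr_gt0 // ?exprn_gt0 ?(lt_le_trans _ n1) ?(lt_le_trans _ L1).
- rewrite /stage scale_host ?(ltnW ik) // ler_wpM2r ?exprn_ge0 //.
  rewrite (_ : host_density * L = (2 * (k.+1)`!%:R)^-1 * (alpha * L) * expR (- k.+1%:R - 1)).
    rewrite ler_wpM2l ?mulr_ge0 ?invr_ge0 ?(ltW a0) // ler_expR lerD2r lerN2.
    rewrite (_ : half_stage i = expR (L / 2) / n%:R / n%:R ^+ (k - i)); last first.
      by rewrite /half_stage ki exprS invfM mulrA.
    apply: (le_trans (faces_count_scale (ltnW ik) _)); first by rewrite divr_ge0 ?expR_ge0.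
    by rewrite ler_piMr // ler_pdivrMr ?mul1r // (lt_le_trans _ n1).
  by rewrite /host_density; move: alpha L (_ * _`!%:R)^-1 (expR _) => a l f u; ring.
- rewrite -[leRHS]mulrA; apply: (ler_wpM2l (ltW d0)).
  rewrite -[leLHS]mulr1; apply: ler_pM; rewrite ?expR_ge0 //.
    by rewrite (regime_L reg) ler_expR w_le_lam.
  by rewrite exprn_ege1.
Qed.

(** Of order n^(i+1/2) hyperedges, a fraction of order at least n^(-1/4) stays isolated; this is far
    more than n^i log n. *)
Lemma hosts_second (i : nat) : (i < k)%N ->
  prob P [set x | 2 * #|Hosts i (half_stage i) (stage i.+1) x|%:R < host_density * L * n%:R ^+ i] <=
  host_error * expR (- w).
Proof.
move=> ik; have [n0 w1 wl lL L1] := order.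
have n1 : 1 <= n%:R :> R by rewrite ler1n.
have a0 := alpha_gt0 R k; have a1 := alpha_le1; have d0 := host_density_gt0.
have L0 : 0 <= L := le_trans ler01 L1.
have ki : (k.+1 - i = (k - i).+1)%N by rewrite subSn // ltnW.
have lam8 : lam * 8 <= L.
  have [_ [_ _ _ le _]] := reg; have := ler_wpM2r L0 e4; lra.
have n_neq0 : n%:R != 0 :> R by rewrite gt_eqF // (lt_le_trans ltr01).
have nexp_ge0 a : 0 <= n%:R ^+ a :> R by rewrite exprn_ge0.
have Lhalf : L <= expR (L / 4) by rewrite (regime_L reg) ler_expR -(regime_L reg); lra.
have aL1 : 1 <= alpha * L.
  rewrite mulrC ler_pdivlMr ?mulr_gt0 ?ltr0n // mul1r.
  have [_ [AL _ _ _ _]] := reg; apply: le_trans (le_trans A3 AL).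
  rewrite -!natrM ler_nat -[4%N]/(2 * 2)%N -mulnA leq_mul2l leq_mul2r /= ltnS.
  exact: leq_trans j0 (ltnW jk).
have st_scale : stage i.+1 * n%:R ^+ (k - i) = alpha * L.
  by rewrite /stage subSS divfK // expf_neq0.
apply: le_trans (hosts_at_scale ik _ _ _ _ _) (host_errorE _).
- by rewrite divr_ge0 ?expR_ge0.
- rewrite /stage /half_stage subSS ki exprS invfM mulrA ler_wpM2r ?invr_ge0 //.
  rewrite ler_pdivrMr ?(lt_le_trans _ n1) //.
  apply: (@le_trans _ _ (1 * n%:R)); last by rewrite ler_wpM2r.
  by rewrite mul1r (regime_n reg) ler_expR; lra.
- by rewrite st_scale ler_wpM2r // (le_trans a1) ?cc_ge1.
- by rewrite !mulr_gt0 // ?exprn_gt0 ?(lt_le_trans _ n1) ?(lt_le_trans _ L1).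
- rewrite /half_stage scale_host ?(ltnW ik) // ler_wpM2r //.
  apply: (@le_trans _ _ ((2 * (k.+1)`!%:R)^-1 * (expR (L / 2) * expR (- (L / 4) - 1)))).
    rewrite -expRD (_ : L / 2 + (- (L / 4) - 1) = L / 4 - 1); last by lra.
    rewrite (_ : host_density * L = (2 * (k.+1)`!%:R)^-1 * (alpha * L * expR (- k.+1%:R - 1))).
      rewrite ler_wpM2l ?invr_ge0 ?mulr_ge0 // [in leRHS]expRD; apply: ler_pM; rewrite ?expR_ge0 //.
      - by rewrite mulr_ge0 // ltW.
      - by apply: le_trans Lhalf; rewrite ler_piMl.
      - by rewrite ler_expR gerDr oppr_le0.
    by rewrite /host_density; move: alpha L (_ * _`!%:R)^-1 (expR _) => a l f u; ring.
  rewrite -[leRHS]mulrA ler_wpM2l ?invr_ge0 ?mulr_ge0 // ler_wpM2l ?expR_ge0 //.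
  rewrite ler_expR lerD2r lerN2 /stage subSS.
  apply: (le_trans (faces_count_scale (ltnW ik) _)); first by rewrite mulr_ge0 // ltW.
  rewrite mulrA (_ : k.+1%:R * alpha = 4^-1); first by rewrite mulrC.
  by rewrite /alpha invfM mulrCA divff ?mulr1 // pnatr_eq0.
- rewrite -[leRHS]mulrA; apply: (ler_wpM2l (ltW d0)).
  rewrite -[leLHS]mulr1; apply: ler_pM; rewrite ?expR_ge0 //.
    by rewrite (regime_L reg) ler_expR w_le_lam.
  by rewrite exprn_ege1.
Qed.

Lemma stage_le_pm : stage j.+1 <= pm k j omega n.
Proof.
have [n0 w1 wl lL L1] := order.
have a0 := alpha_gt0 R k; have L0 : 0 <= L := le_trans ler01 L1.
have [ym1 ym2] := ym_bounds j A1 e1 reg.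
have r1 := r_ge1 R k j; have f1 := fr_ge1 R k j.
have y0 : 0 <= ym j omega n by apply: le_trans ym1; rewrite mulr_ge0.
have r0 : 0 < (k - j + 1)%:R :> R by rewrite (lt_le_trans ltr01).
have x0 : 0 < n%:R ^+ (k - j) :> R by rewrite exprn_gt0 // ltr0n.
rewrite -(ler_pM2r x0) /stage subSS divfK ?gt_eqF // [leRHS]mulrC expn_thr //.
rewrite [leRHS]mulrAC ler_pdivlMr // mulrAC.
have ar : alpha * (k - j + 1)%:R <= 1.
  rewrite mulrC ler_pdivrMr ?mulr_gt0 ?ltr0n // mul1r -natrM ler_nat addn1.
  by rewrite -[X in (X <= _)%N]mul1n leq_mul // ltnS leq_subr.
apply: (@le_trans _ _ (1 * ym j omega n)); last by rewrite ler_wpM2r.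
apply: ler_pM; rewrite ?mulr_ge0 ?(ltW a0) //.
by apply: le_trans ym1; rewrite ler_peMl // ler1n.
Qed.

(** Order n^(j+1) log n hyperedges, each surviving with probability about exp(-ym), leave order
    exp(w) hosts. That this tends to infinity is due to the [- w n] in [ym]. *)
Lemma hosts_last :
  prob P [set x | 2 * #|Hosts j (stage j.+1) (pm k j omega n) x|%:R < host_density * expR w] <=
  host_error * expR (- w).
Proof.
have [n0 w1 wl lL L1] := order.
have n1 : 1 <= n%:R :> R by rewrite ler1n.
have a0 := alpha_gt0 R k; have a1 := alpha_le1; have d0 := host_density_gt0.
have L0 : 0 <= L := le_trans ler01 L1.
have [ym1 ym2] := ym_bounds j A1 e1 reg.
have r1 := r_ge1 R k j; have f1 := fr_ge1 R k j.
have n_neq0 : n%:R != 0 :> R by rewrite gt_eqF // (lt_le_trans ltr01).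
have nexp_ge0 a : 0 <= n%:R ^+ a :> R by rewrite exprn_ge0.
have y0 : 0 <= ym j omega n by apply: le_trans ym1; rewrite mulr_ge0.
have st_scale : stage j.+1 * n%:R ^+ (k - j) = alpha * L.
  by rewrite /stage subSS divfK // expf_neq0.
have pm_scale : pm k j omega n * n%:R ^+ (k - j) = fr / (k - j + 1)%:R * ym j omega n.
  by rewrite mulrC expn_thr.
have r0 : 0 < (k - j + 1)%:R :> R by rewrite (lt_le_trans ltr01).
apply: le_trans (hosts_at_scale jk _ _ _ _ _) (host_errorE _); last by [].
- by rewrite divr_ge0 // mulr_ge0 // ltW.
- exact: stage_le_pm.
- rewrite pm_scale -[leRHS]mulrA; apply: ler_pM => //; exact: fr_r_le.
- by rewrite !mulr_gt0 // ?expR_gt0.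
- rewrite /stage scale_host ?(ltnW jk) // thr_nu // divff ?gt_eqF // mulr1.
  rewrite (regime_expn reg).
  rewrite (_ : host_density * expR w =
      (2 * (k.+1)`!%:R)^-1 * alpha * (expR (- k.+1%:R - 1) * expR w)); last first.
    by rewrite /host_density; move: alpha (_ * _`!%:R)^-1 (expR _) => a f u; ring.
  have assoc (f a l u v : R) : f * (a * l) * u * v = f * a * (l * (u * v)) by ring.
  rewrite assoc ler_wpM2l ?mulr_ge0 ?invr_ge0 ?(ltW a0) //.
  rewrite [X in _ <= X * _](regime_L reg) -!expRD ler_expR /ym.
  have : 0 <= k.+1%:R :> R by []. lra.
Qed.

End HostsAtScale.

Lemma regime_weaken (R : realType) (omega : nat -> R) A A' e e' n : A' <= A -> e <= e' ->
  regime omega A e n -> regime omega A' e' n.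
Proof.
move=> AA' ee' [[n0 nE LE wl wo] [AL Al Aw lL AL2]].
have L0 : 0 <= logn R n by rewrite LE expR_ge0.
split; split=> //; try exact: le_trans AA' _.
- by apply: le_trans lL _; rewrite ler_wpM2r.
- by apply: le_trans AL2; rewrite ler_wpM2r // sqr_ge0.
Qed.

(** * The exceptional events vanish *)

Section Events.
Context (R : realType) (k j : nat) (omega : nat -> R).
Hypothesis homega : omega n @[n --> \oo] --> +oo.
Context (d : nat -> measure_display) (T : forall n, measurableType (d n)).
Context (P : forall n, probability (T n) R) (birth : forall n, hyperedge k n -> {RV (P n) >-> R}).
Arguments birth : clear implicits.
Hypothesis hb : forall n, iid_uniform01 (birth n).
Hypotheses (j0 : (0 < j)%N) (jk : (j < k)%N).

Local Notation L n := (logn R n).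
Local Notation w n := (slow omega n).
Local Notation m := (j.+1%:R).
Local Notation r := (k - j + 1)%N.
Local Notation fr := ((k - j)`!%:R).
Local Notation pm n := (pm k j omega n).
Local Notation pp n := (pp k j omega n).
Local Notation pB n := (pB k j omega n).
Local Notation H p x := (born (fun K => birth _ K x) p).

(** Each event below then needs only a bound at a single [n] in the regime, since [slow] tends to
    infinity. *)
Lemma vanishing_of_regime A e C (B : forall n, set (T n)) : 0 < e ->
  (forall n, measurable (B n)) ->
  (forall n, regime omega A e n -> prob (P n) (B n) <= C * expR (- w n)) ->
  vanishing P B.
Proof.
move=> e0 mB bound; split=> // eps eps0.
have [C0|C0] := leP C 0.
  apply: filterS (near_regime homega A e0) => n /bound; move=> /le_trans; apply.
  by apply: le_trans (ltW eps0); rewrite mulr_le0_ge0 ?expR_ge0.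
apply: filterS2 (near_regime homega A e0) (slow_large homega (ln (C / eps))) => n /bound h sl.
apply: (le_trans h); rewrite expRN ler_pdivrMr ?expR_gt0 // -ler_pdivrMl // mulrC.
by rewrite -(@lnK _ (C / eps)) ?ler_expR // posrE divr_gt0.
Qed.

Definition lonely_event n (a : nat) (u0 u1 : bool) (p0 p1 p2 q : R) : set (T n) :=
  [set x | exists (K : {set 'I_n}) (S : {set {set 'I_n}}), [/\ #|K| = k.+1, u0 -> K \in H p0 x,
    u1 -> K \in H p2 x /\ K \notin H p1 x,
    S \subset faces j.+1 K /\ #|S| = a & lonely (H q x) K S]].

Definition merging_event n : set (T n) :=
  [set x | exists (K0 K : {set 'I_n}) (S : {set {set 'I_n}}) (t t' : {set 'I_n}),
    [/\ K0 \in H (pm n) x, K \in H (pp n) x, K \notin H (pm n) x,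
    S \subset faces j.+1 K0 /\ #|S| = r &
    [/\ t \in S, t \subset K, t' \in faces j.+1 K, ~~ (t' \subset K0) &
        lonely (H (pm n) x) K0 S /\ light (H (pm n) x) t']]].

Lemma measurable_lonely_event n a u0 u1 p0 p1 p2 q :
  measurable (@lonely_event n a u0 u1 p0 p1 p2 q).
Proof.
exact: (measurable_born4 (birth n) p0 p1 p2 q (fun H0 H1 H2 Hq =>
  exists (K : {set 'I_n}) (S : {set {set 'I_n}}),
  [/\ #|K| = k.+1, u0 -> K \in H0, u1 -> K \in H2 /\ K \notin H1,
    S \subset faces j.+1 K /\ #|S| = a & lonely Hq K S])).
Qed.

(** Large enough as the [m] of [first_moment] in all lonely and merging events, where at most k - j
    + 2 sets are uncovered at once. *)
Definition overlap : nat := ((k - j + 2) * (k * k.+1) + (k - j + 2) * (k - j + 2) + 3)%N.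
Definition top_scale : R := k.+2%:R * (m + 2).
Definition scale_bound : R := 1 + fr * top_scale * overlap%:R.
(** The value with which [extra_exponent] applies for [i = 3]. *)
Definition scale_eps : R := (r%:R * 4)^-1.

Lemma top_scale_ge : m + 2 <= top_scale.
Proof. by rewrite ler_peMl ?addr_ge0 // ler1n. Qed.

Lemma top_scale_ge0 : 0 <= top_scale. Proof. by rewrite mulr_ge0 // addr_ge0. Qed.

Lemma scale_eps_gt0 : 0 < scale_eps.
Proof. by rewrite invr_gt0 mulr_gt0 // ltr0n addn1. Qed.

Section Scale.
Variable n : nat.
Hypothesis reg : regime omega scale_bound scale_eps n.

Lemma scale_bound_ge1 : 1 <= scale_bound.
Proof. by rewrite lerDl mulr_ge0 // mulr_ge0 // top_scale_ge0. Qed.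

Lemma scale_eps_le1 : scale_eps <= 1.
Proof. by rewrite invf_le1 ?mulr_gt0 ?ltr0n ?addn1 // mulr_ege1 ?ler1n. Qed.

Let order := regime_order scale_bound_ge1 scale_eps_le1 reg.

Lemma thr_ok y : 0 <= y -> y <= top_scale * L n ->
  0 <= thr k j n y <= 1 /\ thr k j n y * overlap%:R * n%:R ^+ (k - j - 1) <= 1.
Proof.
move=> y0 yt; have t0 := top_scale_ge0.
have big : fr * top_scale * overlap%:R <= scale_bound by rewrite lerDr.
split; last exact: (thr_small jk scale_bound_ge1 scale_eps_le1 reg y0 yt).
apply/andP; split; first exact: (thr_ge0 k j scale_bound_ge1 scale_eps_le1 reg y0).
apply: (thr_le1 jk scale_bound_ge1 scale_eps_le1 reg y0 yt).
apply: le_trans big; rewrite ler_peMr ?mulr_ge0 // ler1n /overlap addn3 //.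
Qed.

Lemma pm_ok : 0 <= pm n <= 1 /\ pm n * overlap%:R * n%:R ^+ (k - j - 1) <= 1.
Proof.
have [_ w1 wl lL L1] := order; have [y1 y2] := ym_bounds j scale_bound_ge1 scale_eps_le1 reg.
apply: thr_ok; first by apply: le_trans y1; rewrite mulr_ge0 // (le_trans ler01).
apply: le_trans y2 _; rewrite ler_wpM2r ?(le_trans ler01) //.
by apply: le_trans top_scale_ge; rewrite lerD2l ler1n.
Qed.

Lemma pp_ok : 0 <= pp n <= 1 /\ pp n * overlap%:R * n%:R ^+ (k - j - 1) <= 1.
Proof.
have [_ w1 wl lL L1] := order; have [y1 y2] := yp_bounds j scale_bound_ge1 scale_eps_le1 reg.
apply: thr_ok; first by apply: le_trans y1; rewrite mulr_ge0 // (le_trans ler01).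
by apply: le_trans y2 _; rewrite ler_wpM2r ?(le_trans ler01) // top_scale_ge.
Qed.

Lemma pB_ok : 0 <= pB n <= 1 /\ pB n * overlap%:R * n%:R ^+ (k - j - 1) <= 1.
Proof.
have [_ w1 wl lL L1] := order; have [y1 y2] := yp_bounds j scale_bound_ge1 scale_eps_le1 reg.
have y0 : 0 <= yp j omega n by apply: le_trans y1; rewrite mulr_ge0 // (le_trans ler01).
by apply: thr_ok; rewrite ?mulr_ge0 // -mulrA ler_wpM2l.
Qed.

Lemma thr_lt (y y' : R) : y < y' -> thr k j n y < thr k j n y'.
Proof.
have [n0 _ _ _ _] := order; move=> lt; rewrite ltr_pM2r // invr_gt0 mulr_gt0 ?nu_gt0 //.
Qed.

Lemma pm_lt_pp : pm n < pp n.
Proof. by have [_ w1 _ _ _] := order; apply: thr_lt; rewrite ltrD2l; lra. Qed.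

Lemma pp_le_pB : pp n <= pB n.
Proof.
have [_ w1 wl lL L1] := order; have [y1 y2] := yp_bounds j scale_bound_ge1 scale_eps_le1 reg.
have y0 : 0 <= yp j omega n by apply: le_trans y1; rewrite mulr_ge0 // (le_trans ler01).
have [n0 _ _ _ _] := order; rewrite ler_wpM2r // ?ler_peMl ?ler1n // invr_ge0 mulr_ge0 //.
by rewrite ltW // nu_gt0.
Qed.

End Scale.

Lemma lonely_scale n a u0 u1 p0 p1 p2 q : (0 < n)%N -> (a <= k - j + 2)%N -> ~~ (u0 && u1) ->
  0 <= p0 <= 1 -> 0 <= p1 -> p1 <= p2 -> p2 <= 1 ->
  0 <= q <= 1 /\ q * overlap%:R * n%:R ^+ (k - j - 1) <= 1 ->
  prob (P n) (@lonely_event n a u0 u1 p0 p1 p2 q) <=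
  n%:R ^+ k.+1 * ((2 ^ 2 ^ k.+1)%:R * ((if u0 then p0 else 1) * (if u1 then p2 - p1 else 1) *
    expR (1 - q * (a%:R * faces_count R k n j)))).
Proof.
move=> n0 ar u p01 p10 p12 p21 [q01 qs]; rewrite -natrX.
apply: (lonely_bound (hb n) jk n0 (m := overlap)) => //.
by rewrite /overlap leq_add2r leq_add // leq_mul.
Qed.

Lemma vanishing_late : vanishing P (fun n =>
  @lonely_event n r false true (pm n) (pm n) (pp n) (pm n)).
Proof.
apply: (vanishing_of_regime (A := scale_bound) (C := (2 ^ 2 ^ k.+1)%:R * fr * 2 * expR 1)
  scale_eps_gt0) => [n|n reg]; first exact: measurable_lonely_event.
have [n0 _ _ _ _] := regime_order scale_bound_ge1 scale_eps_le1 reg.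
have [/andP[m0 m1] _] := pm_ok reg; have [/andP[p0 p1] _] := pp_ok reg.
apply: le_trans (lonely_scale n0 _ _ _ _ _ _ (pm_ok reg)) _; rewrite ?m0 ?leq_add2l ?(ltW (pm_lt_pp reg)) //.
rewrite mul1r; exact: (late_small jk scale_bound_ge1 scale_eps_le1 reg).
Qed.

Lemma vanishing_middle : vanishing P (fun n =>
  @lonely_event n r true false (pB n) (pm n) (pm n) (pp n)).
Proof.
apply: (vanishing_of_regime (A := scale_bound)
  (C := (2 ^ 2 ^ k.+1)%:R * fr * k.+2%:R * (m + 2) * expR 1)
  scale_eps_gt0) => [n|n reg]; first exact: measurable_lonely_event.
have [n0 _ _ _ _] := regime_order scale_bound_ge1 scale_eps_le1 reg.
have [/andP[m0 m1] _] := pm_ok reg; have [p01 _] := pB_ok reg.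
apply: le_trans (lonely_scale n0 _ _ _ _ _ _ (pp_ok reg)) _; rewrite ?leq_add2l //.
rewrite mulr1; exact: (middle_small jk scale_bound_ge1 scale_eps_le1 reg).
Qed.

Lemma vanishing_last : vanishing P (fun n =>
  @lonely_event n r false false (pm n) (pm n) (pm n) (pB n)).
Proof.
apply: (vanishing_of_regime (A := scale_bound) (C := (2 ^ 2 ^ k.+1)%:R * expR 1)
  scale_eps_gt0) => [n|n reg]; first exact: measurable_lonely_event.
have [n0 _ _ _ _] := regime_order scale_bound_ge1 scale_eps_le1 reg.
have [/andP[m0 m1] _] := pm_ok reg.
apply: le_trans (lonely_scale n0 _ _ _ _ _ _ (pB_ok reg)) _; rewrite ?m0 ?leq_add2l //.
rewrite !mul1r; exact: (last_small k j scale_bound_ge1 scale_eps_le1 reg).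
Qed.

Lemma vanishing_extra : vanishing P (fun n =>
  @lonely_event n (k - j + 2) true false (pm n) (pm n) (pm n) (pm n)).
Proof.
apply: (vanishing_of_regime (A := scale_bound)
  (C := (2 ^ 2 ^ k.+1)%:R * fr * (m + 1) * expR 1)
  scale_eps_gt0) => [n|n reg]; first exact: measurable_lonely_event.
have [n0 _ _ _ _] := regime_order scale_bound_ge1 scale_eps_le1 reg.
have [/andP[m0 m1] _] := pm_ok reg.
apply: le_trans (lonely_scale n0 _ _ _ _ _ _ (pm_ok reg)) _; rewrite ?m0 //.
rewrite mulr1 addnS; apply: (isolated_small jk scale_bound_ge1 scale_eps_le1 reg) => //.
by rewrite mulrC /scale_eps ler_pdivrMr ?mulr_gt0 ?ltr0n ?addn1 // mul1r ler_wpM2l // ler_nat.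
Qed.

Lemma vanishing_merging : vanishing P merging_event.
Proof.
pose c : R := (2 ^ 2 ^ k.+1)%:R * ((2 ^ k.+1)%:R * (2 ^ k.+1)%:R).
apply: (vanishing_of_regime (A := scale_bound)
  (C := c * (fr ^+ 3 * (m + 1) * 2 * (m + 2)) * expR 1)
  scale_eps_gt0) => [n|n reg].
  exact: (measurable_born4 (birth n) (pm n) (pp n) 0 0 (fun Hm Hp _ _ =>
    exists (K0 K : {set 'I_n}) (S : {set {set 'I_n}}) (t t' : {set 'I_n}),
    [/\ K0 \in Hm, K \in Hp, K \notin Hm, S \subset faces j.+1 K0 /\ #|S| = r &
    [/\ t \in S, t \subset K, t' \in faces j.+1 K, ~~ (t' \subset K0) &
        lonely Hm K0 S /\ light Hm t']])).
have [n0 _ _ _ _] := regime_order scale_bound_ge1 scale_eps_le1 reg.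
have [/andP[m0 m1] ms] := pm_ok reg; have [/andP[p0 p1] _] := pp_ok reg.
have e4 : scale_eps * (r%:R * 4) <= 1 by rewrite mulVf // gt_eqF // mulr_gt0 ?ltr0n ?addn1.
have := merging_small jk scale_bound_ge1 scale_eps_le1 reg (c := c) _ e4 erefl.
have -> : 0 <= c by rewrite !mulr_ge0.
move=> /(_ isT); apply: le_trans.
apply: le_trans (merging_bound (hb n) jk n0 m0 (ltW (pm_lt_pp reg)) p1 (leqnn _) _) _.
  by move: ms; rewrite /overlap (_ : (k - j + 2 = (k - j + 1).+1)%N) ?addnS.
rewrite [(n ^ k.+1)%:R]natrX [(n ^ (k - j))%:R]natrX /c.
move: (n%:R ^+ k.+1) (n%:R ^+ (k - j)) (2 ^ 2 ^ k.+1)%:R (2 ^ k.+1)%:R (pm n) (pp n) (expR _).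
by move=> x y c1 c2 q q' u; rewrite le_eqVlt; apply/orP; left; apply/eqP; ring.
Qed.

Lemma vanishing_apex :
  vanishing P (fun n => [set x | ~ good_apex k j (H (stage R k n j.+1) x)]).
Proof.
(* [M] makes [M%:R * alpha R k] just large enough for [apex_small]. The last summand of [N] is the
   size of [V0], so that [V0] fits into the vertex set. *)
pose M := (k.+2 * (k - j)`! * (4 * k.+1))%N.
pose N := (M * (k * k.+1) + M * M + (M + k.+1))%N.
pose c : R := (2 ^ k.+1)%:R * (2 ^ 2 ^ (k.+1 + (M + k.+1)))%:R.
apply: (vanishing_of_regime (A := 1 + N%:R) (e := 1) (C := c * expR 1)) => [//|n|n reg].
  exact: (measurable_born4 (birth n) (stage R k n j.+1) 0 0 0
    (fun Ha _ _ _ => ~ good_apex k j Ha)).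
have A1 : 1 <= 1 + N%:R :> R by rewrite lerDl.
have [n0 w1 wl lL L1] := regime_order A1 (lexx 1) reg.
have [_ [AL _ _ _ AL2]] := reg; have a0 := alpha_gt0 R k; have a1 := alpha_le1 R k.
have L0 : 0 <= L n := le_trans ler01 L1.
have n1 : 1 <= n%:R :> R by rewrite ler1n.
have n_neq0 : n%:R != 0 :> R by rewrite gt_eqF // (lt_le_trans ltr01).
have p0 : 0 <= stage R k n j.+1 by rewrite divr_ge0 ?exprn_ge0 // mulr_ge0 // ltW.
have pn : stage R k n j.+1 * n%:R ^+ (k - j - 1) <= L n / n%:R.
  rewrite /stage subSS; set q := (k - j - 1)%N.
  have -> : (k - j = q.+1)%N by rewrite /q subn1 prednK // subn_gt0.
  rewrite exprS invfM [_ * (n%:R^-1 * _)]mulrA divfK ?expf_neq0 // ler_wpM2r ?invr_ge0 //.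
  by rewrite ler_piMl.
have AL1 : (1 + N%:R) * L n <= n%:R :> R.
  by apply: le_trans AL2; rewrite ler_wpM2l // expr2 ler_peMr.
have Nn : (M + k.+1 <= n)%N.
  rewrite -(ler_nat R); apply: le_trans AL1; apply: (@le_trans _ _ (1 + N%:R)).
    by rewrite -[leLHS]add0r lerD // ler_nat leq_addl.
  by rewrite ler_peMr // addr_ge0.
have small : stage R k n j.+1 * N%:R * n%:R ^+ (k - j - 1) <= 1.
  rewrite mulrAC; apply: (@le_trans _ _ (L n / n%:R * N%:R)); first by rewrite ler_wpM2r.
  rewrite mulrAC ler_pdivrMr ?(lt_le_trans ltr01) // mul1r; apply: le_trans AL1.
  by rewrite mulrC ler_wpM2r // lerDr.
have p1 : stage R k n j.+1 <= 1.
  apply: le_trans small; rewrite -mulrA ler_peMr // mulr_ege1 ?exprn_ege1 //.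
  by rewrite ler1n (leq_trans _ (leq_addl _ _)) // addnS.
have [|V0 _ cV0] := @exists_superset 'I_n (M + k.+1) finset.set0.
  by rewrite finset.cards0 card_ord.
have Ma : k.+2%:R * fr <= M%:R * alpha R k.
  by rewrite /M [in leRHS]natrM [(4 * k.+1)%:R]natrM mulfK ?natrM // mulf_neq0 ?pnatr_eq0.
apply: le_trans (apex_bound (hb n) jk n0 (m := N) cV0 _ (leq_addr _ _) small) _.
  by rewrite p0.
apply: le_trans (apex_small A1 (lexx 1) reg (c := c) _ Ma); last by rewrite mulr_ge0.
by rewrite natrX /c -[(2 ^ k.+1)%:R * _ * _]mulrA.
Qed.

(** The vertex is named by its value because ['I_n] is empty for [n = 0]. *)
Lemma vanishing_vertex : vanishing P (fun n => [set x | exists v : 'I_n,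
  [/\ v = 0%N :> nat & exists2 K, K \in H (stage R k n 0) x & v \in K]]).
Proof.
apply: (vanishing_of_regime (A := 2) (e := 2^-1) (C := 1)) => [|n|n reg].
- by rewrite invr_gt0.
- exact: (measurable_born4 (birth n) (stage R k n 0) 0 0 0 (fun Ha _ _ _ => exists v : 'I_n,
    [/\ v = 0%N :> nat & exists2 K, K \in Ha & v \in K])).
have A1 : 1 <= 2 :> R by rewrite ler1n.
have e1 : 2^-1 <= 1 :> R by rewrite invf_le1 ?ler1n.
have [n0 w1 wl lL L1] := regime_order A1 e1 reg.
have e2 : 2^-1 * 2 <= 1 :> R by rewrite mulVf.
have a0 := alpha_gt0 R k.
have small := vertex_small k A1 e1 reg e2; rewrite mul1r.
have st0 : 0 <= stage R k n 0.
  by rewrite divr_ge0 ?exprn_ge0 // mulr_ge0 ?(ltW a0) // (le_trans ler01).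
have st1 : 0 <= stage R k n 0 <= 1.
  rewrite st0 (@le_trans _ _ (n%:R ^+ k * stage R k n 0)) //.
    by rewrite ler_peMl // exprn_ege1 // ler1n.
  by apply: (le_trans small); rewrite -expR0 ler_expR oppr_le0 (le_trans ler01).
apply: le_trans small; rewrite -natrX.
apply: le_trans (covered_vertex_bound (hb n) (Ordinal n0) st1).
apply: (le_prob_born (p1 := stage R k n 0) (p2 := 0)
  (G := fun Ha _ => exists v : 'I_n, [/\ v = 0%N :> nat & exists2 K, K \in Ha & v \in K])
  (G' := fun Ha _ => exists2 K, K \in Ha & Ordinal n0 \in K)).
move=> x [v [v0 [K KH vK]]]; exists K => //.
by rewrite (_ : Ordinal n0 = v) //; apply: val_inj; rewrite /= v0.
Qed.

Lemma vanishing_base :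
  vanishing P (fun n => [set x | exists S, bad_support k j S (H (pm n) x)]).
Proof.
pose g : R := gam R k j * (fr / r%:R); pose c : R := (2 ^ 2 ^ k.+1)%:R.
have f1 := fr_ge1 R k j; have r1 := r_ge1 R k j.
have f0 : 0 <= fr :> R := le_trans ler01 f1.
have g0 : 0 < g.
  rewrite /g mulr_gt0 ?gam_gt0 // divr_gt0 // (lt_le_trans ltr01) //.
have x0 : 0 <= 2 * (2 * m + 1) / g by rewrite divr_ge0 ?(ltW g0) // mulr_ge0 // addr_ge0.
(* From [s0] on the weak constant [gam] suffices. [A] and [e] are chosen after it, since they must
   absorb the overlaps and the powers of log n of supports up to that size. *)
pose s0 := Num.bound (2 * (2 * m + 1) / g).
have gs : 2 * (2 * m + 1) <= s0%:R * g.
  by rewrite -ler_pdivrMr //; apply/ltW/archi_boundP.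
pose a1 : R := fr * (m + 1) * c; pose a2 : R := fr * (m + 1) * (s0 * (k * k.+1) + s0 * s0)%:R.
have a10 : 0 <= a1 by rewrite !mulr_ge0 // addr_ge0.
have a20 : 0 <= a2 by rewrite !mulr_ge0 // addr_ge0.
have a30 : 0 <= (2 * (k * k.+1))%:R :> R by [].
pose A := 1 + a1 + a2 + scale_bound + (2 * (k * k.+1))%:R.
pose y : R := r%:R * ((4 * s0)%:R + 1).
have y1 : 1 <= y by rewrite mulr_ege1 // lerDr.
have g8 : 0 < 8 / g by rewrite divr_gt0.
pose e := (y + 8 / g + r%:R * 4)^-1.
have sb := scale_bound_ge1.
have den0 : 0 < y + 8 / g + r%:R * 4 by lra.
have e0 : 0 < e by rewrite invr_gt0.
have ey : e * y <= 1 by rewrite mulrC ler_pdivrMr // mul1r; lra.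
have eg : e * 8 <= g.
  rewrite mulrC ler_pdivrMr // -ler_pdivrMl // mulrC; lra.
apply: (vanishing_of_regime (A := A) (e := e) (C := s0.+1%:R * expR 2 + 2)) => // n.
  exact: (measurable_born4 (birth n) (pm n) 0 0 0
    (fun Hm _ _ _ => exists S, bad_support k j S Hm)).
move=> reg; have A1 : 1 <= A by rewrite /A; lra.
have e1 : e <= 1 by rewrite invf_le1 //; lra.
have reg' : regime omega scale_bound scale_eps n.
  apply: regime_weaken reg; first by rewrite /A; lra.
  rewrite /scale_eps lef_pV2 ?posrE // ?mulr_gt0 ?(lt_le_trans ltr01) //; lra.
have [pm01 _] := pm_ok reg'.
apply: le_trans (base_bound (hb n) jk (f := forbidden_lower R k j n s0) pm01 _) _.
  move=> S uS iso; apply: (forbidden_lowerP jk A1 e1 reg) => //.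
  by rewrite /A; lra.
apply: le_trans (base_small jk A1 e1 reg (c := c) (s0 := s0) _ _ _ ey eg gs) => //.
- rewrite le_eqVlt; apply/orP; left; apply/eqP; apply: eq_bigr => s _.
  by rewrite natrX natrM natrX.
- by rewrite /A -/a1; lra.
- by rewrite /A -/a2; lra.
Qed.

Definition few_hosts n (i : nat) (q q' mu : R) : set (T n) :=
  [set x | 2 * #|[set K | host k i K (H q x, H q' x)]%SET|%:R < mu].

Lemma measurable_few_hosts n i q q' mu : measurable (@few_hosts n i q q' mu).
Proof.
exact: (measurable_born4 (birth n) q q' 0 0 (fun Hq Hq' _ _ =>
  2 * #|[set K | host k i K (Hq, Hq')]%SET|%:R < mu)).
Qed.

Definition host_bound : R :=
  1 + 2 * (k.+1 * k.+1 * k.+1)%:R * (fr * (m + 1)) ^+ 2 + 2 * (k.+1 * k.+1)%:R.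

Lemma host_bound_ge : [/\ 1 <= host_bound,
  2 * (k.+1 * k.+1 * k.+1)%:R * (fr * (m + 1)) ^+ 2 <= host_bound &
  2 * (k.+1 * k.+1)%:R <= host_bound].
Proof.
rewrite /host_bound; have h1 : 0 <= 2 * (k.+1 * k.+1)%:R :> R by rewrite mulr_ge0.
have h2 : 0 <= 2 * (k.+1 * k.+1 * k.+1)%:R * (fr * (m + 1)) ^+ 2 :> R.
  by rewrite !mulr_ge0 // sqr_ge0.
by split; lra.
Qed.

Lemma vanishing_hosts_first i : (i < k)%N -> vanishing P (fun n =>
  @few_hosts n i (stage R k n i) (half_stage R k n i) (host_density R k * L n * n%:R ^+ i)).
Proof.
move=> ik; have [A1 A2 A3] := host_bound_ge.
apply: (vanishing_of_regime (A := host_bound) (e := 8^-1) (C := host_error R k j)) => [|n|n reg].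
- by rewrite invr_gt0.
- exact: measurable_few_hosts.
have e1 : 8^-1 <= 1 :> R by rewrite invf_le1 ?ler1n.
have e8 : 8^-1 * 8 <= 1 :> R by rewrite mulVf.
exact: (hosts_first (hb n) A1 e1 e8 reg A2 A3 ik).
Qed.

Lemma vanishing_hosts_second i : (i < k)%N -> vanishing P (fun n =>
  @few_hosts n i (half_stage R k n i) (stage R k n i.+1) (host_density R k * L n * n%:R ^+ i)).
Proof.
move=> ik; have [A1 A2 A3] := host_bound_ge.
apply: (vanishing_of_regime (A := host_bound) (e := 8^-1) (C := host_error R k j)) => [|n|n reg].
- by rewrite invr_gt0.
- exact: measurable_few_hosts.
have e1 : 8^-1 <= 1 :> R by rewrite invf_le1 ?ler1n.
have e8 : 8^-1 * 8 <= 1 :> R by rewrite mulVf.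
exact: (hosts_second (hb n) j0 jk A1 e1 e8 reg A2 A3 ik).
Qed.

Lemma vanishing_hosts_last : vanishing P (fun n =>
  @few_hosts n j (stage R k n j.+1) (pm n) (host_density R k * expR (w n))).
Proof.
have [A1 A2 A3] := host_bound_ge.
apply: (vanishing_of_regime (A := host_bound) (e := 8^-1) (C := host_error R k j)) => [|n|n reg].
- by rewrite invr_gt0.
- exact: measurable_few_hosts.
have e1 : 8^-1 <= 1 :> R by rewrite invf_le1 ?ler1n.
have e8 : 8^-1 * 8 <= 1 :> R by rewrite mulVf.
exact: (hosts_last (hb n) jk A1 e1 e8 reg A2 A3).
Qed.

End Events.

Lemma stage_interval (R : realType) (f : nat -> R) (N : nat) (p : R) :
  f 0%N <= p -> p < f N -> exists i, [/\ (i < N)%N, f i <= p & p < f i.+1].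
Proof.
move=> f0; elim: N => [|N IH] pN; first by have := le_lt_trans f0 pN; rewrite ltxx.
have [Np|/IH[i [iN fi fi1]]] := leP (f N) p; first by exists N.
by exists i; split=> //; apply: ltnW.
Qed.

(** * From typical births to the three statements *)

Section Outcome.
Context (R : realType) (k n j : nat) (omega : nat -> R) (c : hyperedge k n -> R).
Hypotheses (j0 : (0 < j)%N) (jk : (j < k)%N).

Local Notation L := (logn R n).
Local Notation w := (slow omega n).
Local Notation pm := (pm k j omega n).
Local Notation pp := (pp k j omega n).
Local Notation pB := (pB k j omega n).
Local Notation stage := (stage R k n).
Local Notation half_stage := (half_stage R k n).
Local Notation mu := (host_density R k).
Local Notation H p := (born c p).

(** The summand [3 / mu] makes the hosts outnumber n^i in spite of the factor [host_density]; [k.+2]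
    ensures [k < n]. *)
Definition typical_bound : R :=
  scale_bound R k j + host_bound R k j + 3 / mu + k.+2%:R.
Definition typical_eps : R := ((k - j + 1)%:R * 4 + 8)^-1.

Hypothesis reg : regime omega typical_bound typical_eps n.
Hypothesis late : ~ exists (K : {set 'I_n}) (S : {set {set 'I_n}}), [/\ #|K| = k.+1,
  false -> K \in H pm, true -> K \in H pp /\ K \notin H pm,
  S \subset faces j.+1 K /\ #|S| = (k - j + 1)%N & lonely (H pm) K S].
Hypothesis middle : ~ exists (K : {set 'I_n}) (S : {set {set 'I_n}}), [/\ #|K| = k.+1,
  true -> K \in H pB, false -> K \in H pm /\ K \notin H pm,
  S \subset faces j.+1 K /\ #|S| = (k - j + 1)%N & lonely (H pp) K S].
Hypothesis last : ~ exists (K : {set 'I_n}) (S : {set {set 'I_n}}), [/\ #|K| = k.+1,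
  false -> K \in H pm, false -> K \in H pm /\ K \notin H pm,
  S \subset faces j.+1 K /\ #|S| = (k - j + 1)%N & lonely (H pB) K S].
Hypothesis extra : ~ exists (K : {set 'I_n}) (S : {set {set 'I_n}}), [/\ #|K| = k.+1,
  true -> K \in H pm, false -> K \in H pm /\ K \notin H pm,
  S \subset faces j.+1 K /\ #|S| = (k - j + 2)%N & lonely (H pm) K S].
Hypothesis merging : ~ exists (K0 K : {set 'I_n}) (S : {set {set 'I_n}}) (t t' : {set 'I_n}),
  [/\ K0 \in H pm, K \in H pp, K \notin H pm, S \subset faces j.+1 K0 /\ #|S| = (k - j + 1)%N &
    [/\ t \in S, t \subset K, t' \in faces j.+1 K, ~~ (t' \subset K0) &
        lonely (H pm) K0 S /\ light (H pm) t']].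
Hypothesis apex : good_apex k j (H (stage j.+1)).
Hypothesis base : ~ exists S, bad_support k j S (H pm).
Hypothesis vertex : ~ exists v : 'I_n, [/\ v = 0%N :> nat &
  exists2 K, K \in H (stage 0) & v \in K].
Hypothesis first_hosts : forall i, (i < j.+1)%N -> ~~
  (2 * #|[set K | host k i K (H (stage i), H (half_stage i))]%SET|%:R < mu * L * n%:R ^+ i).
Hypothesis second_hosts : forall i, (i < j.+1)%N -> ~~
  (2 * #|[set K | host k i K (H (half_stage i), H (stage i.+1))]%SET|%:R < mu * L * n%:R ^+ i).
Hypothesis last_hosts : ~~
  (2 * #|[set K | host k j K (H (stage j.+1), H pm)]%SET|%:R < mu * expR w).

Lemma typical_terms : [/\ 1 <= scale_bound R k j, 1 <= host_bound R k j, 0 <= 3 / mu &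
  0 < typical_eps <= 8^-1] /\ typical_eps <= scale_eps R k j.
Proof.
have [h1 _ _] := host_bound_ge R k j; have s1 := scale_bound_ge1 R k j.
have r1 := r_ge1 R k j; have m0 := host_density_gt0 R k.
split; first split=> //; first by rewrite divr_ge0 // ltW.
  by rewrite /typical_eps; apply/andP; split; rewrite ?invr_gt0 ?lef_pV2 ?posrE; lra.
by rewrite /typical_eps /scale_eps lef_pV2 ?posrE; lra.
Qed.

Let reg_scale : regime omega (scale_bound R k j) (scale_eps R k j) n.
Proof.
have [[s1 h1 m0 _] e1] := typical_terms; apply: regime_weaken reg => //.
by have k0 : 0 <= k.+2%:R :> R by []; rewrite /typical_bound; lra.
Qed.

Let order := regime_order (scale_bound_ge1 R k j) (scale_eps_le1 R k j) reg_scale.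

Let L_large : 3 / mu <= L /\ k.+2%:R <= L.
Proof.
have [[s1 h1 m0 _] e1] := typical_terms; have [_ [AL _ _ _ _]] := reg.
have k0 : 0 <= k.+2%:R :> R by [].
by split; apply: le_trans AL; rewrite /typical_bound; lra.
Qed.

Let kn : (k < n)%N.
Proof.
have [_ kL] := L_large; rewrite -(ltr_nat R) (regime_n reg).
by apply: lt_le_trans (le_expR _); apply: lt_le_trans kL; rewrite ltr_nat.
Qed.

Let stage_pm : stage j.+1 <= pm.
Proof. exact: (stage_le_pm k j (scale_bound_ge1 R k j) (scale_eps_le1 R k j) reg_scale). Qed.

Let stage_ge0 i : 0 <= stage i.
Proof.
have [_ w1 wl lL L1] := order.
by rewrite divr_ge0 ?exprn_ge0 // mulr_ge0 ?(ltW (alpha_gt0 R k)) // (le_trans ler01).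
Qed.

Let pp_lt1 : pp < 1.
Proof.
have [/andP[B0 B1] _] := pB_ok jk reg_scale; apply: lt_le_trans B1.
have [n0 w1 wl lL L1] := order.
have [y1 y2] := yp_bounds j (scale_bound_ge1 R k j) (scale_eps_le1 R k j) reg_scale.
apply: (thr_lt reg_scale); rewrite -[ltLHS]mul1r ltr_pM2r ?ltr1n //.
by apply: lt_le_trans y1; rewrite mulr_gt0 ?ltr0n // (lt_le_trans ltr01).
Qed.

Let base_trivial F : degree j.+1 F -> compat (H pm) F -> almost_trivial j (H pm) F.
Proof.
move=> dF cF; have [//|nt] := boolP (almost_trivial j (H pm) F).
have [S [uS cS lS rS iso]] := minimal_nontrivial (@born_uniform _ _ _ c pm) jk dF cF nt.
by case: base; exists S; split; rewrite // -[X in (X * _)%N](card_ord n).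
Qed.

Lemma host_lonely i K q q' : host k i K (H q, H q') ->
  [/\ #|K| = k.+1, K \in H q & lonely (H q') K (petals K (first_vertices i K))].
Proof.
move=> /and3P[/eqP Kk KH /forall_inP iso]; split=> // s K' sF K'H sK'.
apply/eqP; apply: contraTT (iso K' K'H) => K'K; rewrite negbK inE K'K (born_uniform K'H) eqxx.
by apply/exists_inP; exists s.
Qed.

Let early : exists K C : {set 'I_n}, [/\ K \in H (stage j.+1), C \subset K, #|C| = j &
  lonely (H pm) K (petals K C)].
Proof.
have : (0 < #|[set K | host k j K (H (stage j.+1), H pm)]%SET|)%N.
  rewrite lt0n; apply: contraNneq last_hosts => ->.
  by rewrite mulr0 mulr_gt0 ?expR_gt0 // host_density_gt0.
move=> /card_gt0P[K]; rewrite finset.in_set => /host_lonely[Kk KH lo].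
by exists K, (first_vertices j K); split=> //; [exact: first_vertices_sub|rewrite (card_first_vertices jk)].
Qed.

Let late' (K : {set 'I_n}) (S : {set {set 'I_n}}) : K \in H pp -> K \notin H pm ->
  S \subset faces j.+1 K -> #|S| = (k - j + 1)%N -> ~ lonely (H pm) K S.
Proof. by move=> Kp Km SF Sr lo; apply: late; exists K, S; split=> //; exact: born_uniform Kp. Qed.

Let middle' (K : {set 'I_n}) (S : {set {set 'I_n}}) : K \in H pB -> S \subset faces j.+1 K ->
  #|S| = (k - j + 1)%N -> ~ lonely (H pp) K S.
Proof. by move=> Kp SF Sr lo; apply: middle; exists K, S; split=> //; exact: born_uniform Kp. Qed.

Let last' (K : {set 'I_n}) (S : {set {set 'I_n}}) : #|K| = k.+1 -> S \subset faces j.+1 K ->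
  #|S| = (k - j + 1)%N -> ~ lonely (H pB) K S.
Proof. by move=> Kk SF Sr lo; apply: last; exists K, S. Qed.

Let extra' (K : {set 'I_n}) (S : {set {set 'I_n}}) : K \in H pm -> S \subset faces j.+1 K ->
  #|S| = (k - j + 2)%N -> ~ lonely (H pm) K S.
Proof. by move=> Kp SF Sr lo; apply: extra; exists K, S; split=> //; exact: born_uniform Kp. Qed.

Let merging' (K0 K : {set 'I_n}) (S : {set {set 'I_n}}) (t t' : {set 'I_n}) :
  K0 \in H pm -> K \in H pp -> K \notin H pm -> S \subset faces j.+1 K0 -> #|S| = (k - j + 1)%N ->
  t \in S -> t \subset K -> t' \in faces j.+1 K -> ~~ (t' \subset K0) ->
  ~ (lonely (H pm) K0 S /\ light (H pm) t').
Proof.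
by move=> K0p Kp Km SF Sr tS tK t'K t'K0 [lo li]; apply: merging; exists K0, K, S, t, t'.
Qed.

Lemma not_connected_between i q q' p : (i < j.+1)%N -> q <= p -> p <= q' ->
  ~~ (2 * #|[set K | host k i K (H q, H q')]%SET|%:R < mu * L * n%:R ^+ i) ->
  ~ cohomologically_connected (complex_at c p) j.
Proof.
move=> ij qp pq' many; have ik : (i < k)%N by apply: leq_trans ij jk.
have [n0 w1 wl lL L1] := order; have m0 := host_density_gt0 R k.
apply: (@not_connected_of_hosts _ _ _ _ i j p [set K | host k i K (H q, H q')]%SET (first_vertices i)) => //.
  move=> K; rewrite finset.in_set => /host_lonely[Kk KH lo].
  have Kp : K \in H p := fintype.subsetP (born_mono c qp) _ KH.
  split; rewrite ?first_vertices_sub ?(card_first_vertices ik) // => s sF.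
  have sK := petals_sub (first_vertices_sub i K) sF; split=> //.
  apply/finset.setP => K'; rewrite finset.in_set finset.in_set1; apply/andP/eqP => [[K'p sK']|-> //].
  exact: (lo s K' sF (fintype.subsetP (born_mono c pq') _ K'p) sK').
rewrite -(ltr_nat R) natrX; rewrite -leNgt in many.
have n1 : 0 < n%:R ^+ i :> R by rewrite exprn_gt0 // ltr0n.
have : 3 <= mu * L by rewrite mulrC -ler_pdivrMr //; have [] := L_large.
move=> /(ler_wpM2r (ltW n1)); lra.
Qed.

Lemma typical_outcome :
  [/\ (j.+1%:R * ln n%:R + ln (ln n%:R) - omega n)
        / ((k - j + 1)%:R * n%:R ^+ (k - j)) * (k - j)`!%:R < p_M j c
      /\ p_M j c < (j.+1%:R * ln n%:R + ln (ln n%:R) + omega n)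
        / ((k - j + 1)%:R * n%:R ^+ (k - j)) * (k - j)`!%:R,
      forall p : R, 0 <= p <= 1 -> p < p_M j c ->
        ~ cohomologically_connected (complex_at c p) j &
      forall p : R, 0 <= p <= 1 -> p_M j c <= p ->
        cohomologically_connected (complex_at c p) j].
Proof.
have [n0 w1 wl lL L1] := order.
have mp := pm_lt_pp reg_scale; have pB' := pp_le_pB reg_scale.
have thrE y : y / ((k - j + 1)%:R * n%:R ^+ (k - j)) * (k - j)`!%:R = thr k j n y.
  by rewrite /thr /faces_count mulrA [in RHS]invfM invrK mulrA.
(* With w at most half of omega, the weak bounds by [pm] and [pp] become the strict ones of the
   theorem. *)
have womega : w < omega n by have [[_ _ _ _ wo] _] := reg; lra.
split.
- rewrite !thrE; split.
    apply: lt_le_trans (pm_le_p_M j0 jk (stage_ge0 _) stage_pm mp pp_lt1 apex early).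
    by apply: (thr_lt reg_scale); rewrite ltrD2l ltrN2.
  apply: le_lt_trans (p_M_le_pp j0 jk (stage_ge0 _) stage_pm mp pB' pp_lt1 apex
    late' middle' last' early) _.
  by apply: (thr_lt reg_scale); rewrite ltrD2l.
- move=> p p01 pM; have [late_p|early_p] := leP (stage j.+1) p.
    exact: (not_connected_before j0 jk (stage_ge0 _) stage_pm mp pp_lt1 apex
      late' middle' last' early late_p pM).
  (* Below [stage 0] the vertex 0 is isolated; from there up to [stage j.+1] each stage is split at
     its half stage. *)
  have [pos|zero] := leP (stage 0) p; last first.
    have n1 : (1 < n)%N by apply: leq_ltn_trans kn; apply: leq_trans j0 (ltnW jk).
    apply: (@not_connected_of_isolated _ _ _ c p j (Ordinal n0)) => // K Kp.
    apply/negP => vK; apply: vertex; exists (Ordinal n0); split=> //; exists K => //.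
    exact: fintype.subsetP (born_mono c (ltW zero)) _ Kp.
  have [i [ij ip pi]] := stage_interval pos early_p.
  have [hp|ph] := leP (half_stage i) p.
    exact: not_connected_between ij hp (ltW pi) (second_hosts ij).
  exact: not_connected_between ij ip (ltW ph) (first_hosts ij).
- move=> p /andP[p0 _]; exact: (connected_from j0 jk kn (stage_ge0 _) stage_pm mp pB' pp_lt1 apex
    base_trivial late' middle' last' extra' merging' early p0).
Qed.

End Outcome.

Theorem theorem1p11 (R : realType) (k : nat) (hk : (2 <= k)%N)
    (omega : nat -> R) (homega : omega n @[n --> \oo] --> +oo)
    (d : nat -> measure_display) (T : forall n, measurableType (d n))
    (P : forall n, probability (T n) R)
    (birth : forall n, hyperedge k n -> {RV (P n) >-> R})
    (hbirth : forall n, iid_uniform01 (birth n))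
    (j : nat) (hj : (1 <= j <= k - 1)%N) :
  whp P (fun n => [set x : T n |
    let b := fun K : hyperedge k n => birth n K x in
    let pM := p_M j b in
    [/\ (j.+1%:R * ln n%:R + ln (ln n%:R) - omega n)
          / ((k - j + 1)%:R * n%:R ^+ (k - j)) * (k - j)`!%:R < pM
        /\ pM < (j.+1%:R * ln n%:R + ln (ln n%:R) + omega n)
          / ((k - j + 1)%:R * n%:R ^+ (k - j)) * (k - j)`!%:R,
        forall p : R, 0 <= p <= 1 -> p < pM ->
          ~ cohomologically_connected (complex_at b p) j &
        forall p : R, 0 <= p <= 1 -> pM <= p ->
          cohomologically_connected (complex_at b p) j]]).
Proof.
move: hj => /andP[j0 jk1].
have jk : (j < k)%N by rewrite -(ltn_predK hk) ltnS -subn1.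
have few_first i : (i < j.+1)%N -> _ := fun ij =>
  vanishing_hosts_first j homega hbirth (leq_trans ij jk).
have few_second i : (i < j.+1)%N -> _ := fun ij =>
  vanishing_hosts_second homega hbirth j0 jk (leq_trans ij jk).
(* Outside this one union the three statements follow deterministically, hence hold
   simultaneously. *)
have rare := vanishingU (vanishing_late homega hbirth jk)
  (vanishingU (vanishing_middle homega hbirth jk)
  (vanishingU (vanishing_last homega hbirth jk)
  (vanishingU (vanishing_extra homega hbirth jk)
  (vanishingU (vanishing_merging homega hbirth jk)
  (vanishingU (vanishing_apex homega hbirth jk)
  (vanishingU (vanishing_base homega hbirth jk)
  (vanishingU (vanishing_vertex homega hbirth)
  (vanishingU (vanishing_bigU few_first)
  (vanishingU (vanishing_bigU few_second)
  (vanishing_hosts_last homega hbirth jk)))))))))).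
apply: (whp_of_vanishing rare).
have [[_ _ _ /andP[e0 _]] _] := typical_terms R k j.
apply: filterS (near_regime homega (typical_bound R k j) e0) => n reg x typical.
apply: (typical_outcome j0 jk reg).
- by move=> h; apply: typical; left.
- by move=> h; apply: typical; right; left.
- by move=> h; apply: typical; do 2 right; left.
- by move=> h; apply: typical; do 3 right; left.
- by move=> h; apply: typical; do 4 right; left.
- by apply: contrapT => h; apply: typical; do 5 right; left.
- by move=> h; apply: typical; do 6 right; left.
- by move=> h; apply: typical; do 7 right; left.
- by move=> i ij; apply/negP => h; apply: typical; do 8 right; left; exists i.
- by move=> i ij; apply/negP => h; apply: typical; do 9 right; left; exists i.
- by apply/negP => h; apply: typical; do 10 right.
Qed.
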